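(* Let $m>-1$ be real. Then $\mathcal{F}_m$ is a unitary involution on $L^2(0,\infty)$ diagonalizing $H_m$; more precisely $$\mathcal{F}_mH_m\mathcal{F}_m^{-1}=Q^2 .$$ It satisfies $\mathcal{F}_m e^{itD}=e^{-itD}\mathcal{F}_m$ for all $t\in\mathbb{R}$.
   Context: All operators act in $L^2=L^2(0,\infty)$ (complex-valued functions). $\mathcal{F}_m$ is given by $(\mathcal{F}_mf)(k)=\int_0^\infty J_m(kx)\sqrt{kx}\,f(x)\,dx$ (for $f\in C_c^\infty(0,\infty)$, and then by continuous extension), where $J_m$ is the Bessel function of the first kind. $Q$ is the self-adjoint operator of multiplication by $x$. $D$ is the self-adjoint generator of dilations, $(e^{i\tau D}f)(x)=e^{\tau/2}f(e^\tau x)$. For $m\in\mathbb{C}$ let $\tilde L_m=-\partial_x^2+(m^2-\tfrac14)x^{-2}$ act on distributions on $(0,\infty)$. $L_m^{\max}$ is its restriction to $\{f\in L^2: \tilde L_mf\in L^2\}$, and $L_m^{\min}$ is the closure in $L^2$ of its restriction to $C_c^\infty(0,\infty)$. Let $\zeta_m(x)=x^{1/2+m}$ and let $\xi$ be a smooth function on $(0,\infty)$ with $\xi=1$ on $(0,1]$ and $\xi=0$ on $[2,\infty)$. For $\mathrm{Re}\,m>-1$, $H_m$ is the restriction of $L_m^{\max}$ to $\mathcal{D}(L_m^{\min})+\mathbb{C}\,\xi\zeta_m$. *)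

(* Defs.v *)
From mathcomp Require Import all_boot all_order all_algebra.
From mathcomp Require Import all_classical all_reals all_analysis.
From mathcomp Require Import complex.

Set Implicit Arguments.
Unset Strict Implicit.
Unset Printing Implicit Defensive.

Import Order.TTheory GRing.Theory Num.Theory.
Import numFieldNormedType.Exports.

Local Open Scope classical_set_scope.
Local Open Scope ring_scope.
Local Open Scope complex_scope.

(* Elements of L^2(0,+oo) are represented by functions R -> R[i], of which only
   the values on the open half-line matter, and which are identified when they
   agree almost everywhere there. *)

Definition half_line (R : realType) : set R := `]0, +oo[.
Arguments half_line {R}.

Definition mu (R : realType) : {measure set (measurableTypeR R) -> \bar R} :=
  lebesgue_measure.
Arguments mu {R}.

Definition aeq (R : realType) (f g : R -> R[i]) : Prop :=
  ae_eq mu half_line f g.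

Definition sq_norm (R : realType) (f : R -> R[i]) : \bar R :=
  (\int[mu]_(x in half_line) (complex.Re (f x) ^+ 2 + complex.Im (f x) ^+ 2)%:E)%E.

Definition L2 (R : realType) : set (R -> R[i]) :=
  [set f | [/\ measurable_fun half_line (fun x : R => complex.Re (f x)),
               measurable_fun half_line (fun x : R => complex.Im (f x)) &
               (sq_norm f < +oo)%E]].
Arguments L2 {R}.

Definition cintegral (R : realType) (f : R -> R[i]) : R[i] :=
  Rintegral mu half_line (fun x => complex.Re (f x))
  +i* Rintegral mu half_line (fun x => complex.Im (f x)).

Definition inner (R : realType) (f g : R -> R[i]) : R[i] :=
  cintegral (fun x => (f x)^* * g x).

Definition cvg_L2 (R : realType) (u : nat -> R -> R[i]) (f : R -> R[i]) : Prop :=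
  (fun n => sq_norm (fun x => u n x - f x)) @ \oo --> 0%E.

(* Possibly unbounded operators in L^2, given by their graphs: [T f g] reads
   "f is in the domain of T and T f = g". *)

Definition operator (R : realType) := (R -> R[i]) -> (R -> R[i]) -> Prop.

Definition op_dom (R : realType) (T : operator R) : set (R -> R[i]) :=
  [set f | exists g, T f g].

Definition op_id (R : realType) : operator R :=
  fun f g => [/\ L2 f, L2 g & aeq g f].
Arguments op_id {R}.

Definition op_comp (R : realType) (S T : operator R) : operator R :=
  fun f h => exists2 g, T f g & S g h.

Definition op_inv (R : realType) (T : operator R) : operator R :=
  fun f g => T g f.

Definition op_closure (R : realType) (T : operator R) : operator R :=
  fun f g => [/\ L2 f, L2 g &
    exists u v : nat -> R -> R[i],
      [/\ forall n, T (u n) (v n), cvg_L2 u f & cvg_L2 v g]].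

Record linear_operator (R : realType) (T : operator R) : Prop := {
  op_L2 : forall f g, T f g -> L2 f /\ L2 g;
  op_aeq : forall f f' g g', L2 f' -> L2 g' -> aeq f f' -> aeq g g' ->
    T f g -> T f' g';
  op_functional : forall f g g', T f g -> T f g' -> aeq g g';
  op_linear : forall (a b : R[i]) f f' g g', T f g -> T f' g' ->
    T (fun x => a * f x + b * f' x) (fun x => a * g x + b * g' x) }.

Record unitary_operator (R : realType) (U : operator R) : Prop := {
  unitary_linear : linear_operator U;
  unitary_total : forall f, L2 f -> exists g, U f g;
  unitary_onto : forall g, L2 g -> exists f, U f g;
  unitary_inner : forall f f' g g', U f g -> U f' g' ->
    inner g g' = inner f f' }.

(* Smoothness on the half-line only constrains f there: for 0 < x, the iterated
   derivatives at x do not depend on the values of f outside ]0, +oo[. *)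
Definition smooth (R : realType) (f : R -> R[i]) : Prop :=
  forall (n : nat) (x : R), 0 < x ->
    derivable (derive1n n (fun y => complex.Re (f y))) x 1 /\
    derivable (derive1n n (fun y => complex.Im (f y))) x 1.

Definition test_function (R : realType) (f : R -> R[i]) : Prop :=
  smooth f /\
  exists a b : R, 0 < a /\ (forall x, 0 < x -> x < a \/ b < x -> f x = 0).

Definition cderive2 (R : realType) (f : R -> R[i]) (x : R) : R[i] :=
  derive1n 2 (fun y => complex.Re (f y)) x
  +i* derive1n 2 (fun y => complex.Im (f y)) x.

Definition Ltilde (R : realType) (m : R) (f : R -> R[i]) (x : R) : R[i] :=
  - cderive2 f x + ((m ^+ 2 - 4^-1) * x ^- 2)%:C * f x.

(* [Ltilde m] is formally symmetric for the bilinear pairing of distributions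
   with test functions, so g is the distribution [Ltilde m] f iff
   <f, Ltilde m phi> = <g, phi> for every test function phi. *)
Definition Lmax (R : realType) (m : R) : operator R :=
  fun f g => [/\ L2 f, L2 g &
    forall phi, test_function phi ->
      cintegral (fun x => f x * Ltilde m phi x) =
      cintegral (fun x => g x * phi x)].

Definition Lmin0 (R : realType) (m : R) : operator R :=
  fun f g => [/\ test_function f, L2 g & aeq g (Ltilde m f)].

Definition Lmin (R : realType) (m : R) : operator R := op_closure (Lmin0 m).

Definition zeta (R : realType) (m : R) (x : R) : R[i] := (x `^ (2^-1 + m))%:C.

Definition cutoff (R : realType) (xi : R -> R[i]) : Prop :=
  [/\ smooth xi,
      forall x, 0 < x <= 1 -> xi x = 1 &
      forall x, 2 <= x -> xi x = 0].

Definition H (R : realType) (xi : R -> R[i]) (m : R) : operator R :=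
  fun f g => Lmax m f g /\
    exists (f0 : R -> R[i]) (c : R[i]),
      op_dom (Lmin m) f0 /\ aeq f (fun x => f0 x + c * (xi x * zeta m x)).

(* Euler's integral, used for 0 < s only. *)
Definition Gamma (R : realType) (s : R) : R :=
  Rintegral mu half_line (fun t => t `^ (s - 1) * expR (- t)).

(* Bessel function of the first kind of real order -1 < m, at 0 < z. *)
Definition besselJ (R : realType) (m z : R) : R :=
  limn (series (fun n : nat =>
    (-1) ^+ n / (n`!%:R * Gamma (m + n%:R + 1))
      * (z / 2) `^ ((2 * n)%:R + m))).

Definition hankel_integral (R : realType) (m : R) (f : R -> R[i]) (k : R) : R[i] :=
  cintegral (fun x => (besselJ m (k * x) * Num.sqrt (k * x))%:C * f x).

Definition hankel0 (R : realType) (m : R) : operator R :=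
  fun f g => [/\ test_function f, L2 g & aeq g (hankel_integral m f)].

Definition hankel (R : realType) (m : R) : operator R := op_closure (hankel0 m).

Definition Q (R : realType) : operator R :=
  fun f g => [/\ L2 f, L2 g & aeq g (fun x => x%:C * f x)].
Arguments Q {R}.

(* The unitary group e^{i tau D}, by which the generator D is determined. *)
Definition exp_iD (R : realType) (tau : R) : operator R :=
  fun f g => [/\ L2 f, L2 g &
    aeq g (fun x => (expR (tau / 2))%:C * f (expR tau * x))].

(* Main.v *)
Require Import Defs.
From mathcomp Require Import all_boot all_order all_algebra.
From mathcomp Require Import all_classical all_reals all_analysis.
From mathcomp Require Import complex measurable_realfun.
From mathcomp Require Import ring lra.

Set Implicit Arguments.
Unset Strict Implicit.
Unset Printing Implicit Defensive.

Import Order.TTheory GRing.Theory Num.Theory.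
Import numFieldNormedType.Exports.

Local Open Scope classical_set_scope.
Local Open Scope ring_scope.

(** Why the theorem holds.

    For a > 0 let gauss a (x) = x^(m + 1/2) exp (- a x^2 / 2). Weber's integral
    says that the Hankel transform of gauss a is gauss_hat a =
    a^-(m + 1) gauss a^-1. The pairings of two such functions are moments of a
    Gaussian, and the pairing of gauss_hat a with gauss b is symmetric in a and
    b. Moreover a function whose pairings with all gauss a vanish is zero
    ([power_gaussian_moments_eq0]), so the Gaussians span a dense subspace. On
    this span the map gauss a |-> gauss_hat a is isometric, and it extends to a
    unitary involution of the real space L^2(0, oo). Its graph [weak_hankel] is
    described by duality: (f, g) belongs to it iff <gauss_hat a, f> = <gauss a, g>
    for every a. In this form the whole theorem reduces to identities between
    Gaussian moments and to limits in L^2.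

    The Bessel function enters once. Integrated term by term against a Gaussian
    its power series gives Weber's integral ([integral_kernel_gauss]), because
    the Gamma factors cancel the moments. By Fubini's theorem the integral
    transform of a bounded function with bounded support then pairs with
    Gaussians as its weak transform does ([weak_hankel_rhankel]). Since test
    functions are dense, the closure of the integral transform on them is
    [weak_hankel].

    Let [diag] be the operator that the transform turns into multiplication by
    x^2. On Gaussians it acts as L = - d^2/dx^2 + (m^2 - 1/4) x^-2, and (u, v)
    belongs to [diag] iff <gauss a, v> = <L gauss a, u> for every a ([diagP]). So
    [diag] is closed, symmetric and nonnegative, and by Green's formula it
    extends L on test functions; thus it contains L_min and is contained in
    L_max. Near 0 a Gaussian differs from the profile x^(m + 1/2) by a relative
    error O(x^2), and cutting off at scales tending to 0 and oo shows that
    gauss a - xi x^(m + 1/2) lies in the domain of L_min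
    ([rLmin_gauss_profile]). Hence [diag] contains H_m. Conversely, the range of
    1 + L on test functions together with (1 + L) (xi x^(m + 1/2)) spans a dense
    subspace: an orthogonal q satisfies <(1 + L) gauss a, q> = 0 for all a, that
    is L q = - q, and q = 0 by nonnegativity. Since 1 + [diag] is bounded below,
    every element of the domain of [diag] lies in the domain of L_min plus
    multiples of the profile ([diag_decomposition]).

    Dilations permute the Gaussians up to scalars, which gives the last claim.
    All these operators act on real and imaginary parts separately; only the
    cutoff xi may be complex, and its imaginary part contributes a test
    function. *)

Lemma eq_imp_le {d : Order.disp_t} {T : porderType d} (x y : T) :
  x = y -> (x <= y)%O.
Proof. by move=> ->. Qed.

(** * Square integrable real functions on a measure space *)

Section L2_space.
Context {d : measure_display} {T : measurableType d} {R : realType}.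
Context {mu : {measure set T -> \bar R}} {D : set T} (mD : measurable D).
Implicit Types (f g h : T -> R) (u v : nat -> T -> R) (a b c : R).

Definition sqint f :=
  measurable_fun D f /\ mu.-integrable D (EFin \o (fun x => f x ^+ 2)).

Definition ip f g : R := \int[mu]_(x in D) (f x * g x).

Definition cvgL2 u f :=
  (fun n => ip (u n - f) (u n - f)) @ \oo --> (0 : R).

Lemma le_integrable_real f g : measurable_fun D f ->
  (forall x, D x -> `|f x| <= g x) ->
  mu.-integrable D (EFin \o g) -> mu.-integrable D (EFin \o f).
Proof.
move=> mf fg; apply: le_integrable => //; first exact/measurable_EFinP.
move=> x Dx /=; rewrite lee_fin.
by apply: (le_trans (fg _ Dx)); rewrite ler_norm.
Qed.

Lemma sqint_meas f : sqint f -> measurable_fun D f.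
Proof. by case. Qed.

Lemma le_sqint f g : measurable_fun D f ->
  (forall x, D x -> `|f x| <= g x) -> sqint g -> sqint f.
Proof.
move=> mf fg [mg ig]; split => //; apply: le_integrable_real ig.
  exact: measurable_funX.
move=> x Dx; rewrite normrX ler_sqr ?nnegrE//; first exact: fg.
exact: le_trans (fg _ Dx).
Qed.

Lemma sqint_mul f g : sqint f -> sqint g ->
  mu.-integrable D (EFin \o (fun x => f x * g x)).
Proof.
move=> [mf i_f] [mg ig].
apply: (@le_integrable_real _ (fun x => f x ^+ 2 + g x ^+ 2)).
- exact: measurable_funM.
- move=> x _; rewrite ler_norml; apply/andP; split; nra.
- exact: (integrableD mD i_f ig).
Qed.

Lemma sqint0 : sqint 0.
Proof.
split; first exact: measurable_cst.
rewrite (_ : _ \o _ = cst 0%E); first exact: integrable0.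
by apply/funext => x /=; rewrite expr0n.
Qed.

Lemma sqintZ a f : sqint f -> sqint (a *: f).
Proof.
move=> [mf i_f]; split; first exact: measurable_funM.
apply: eq_integrable (integrableZl mD (a ^+ 2) i_f) => // x _ /=.
by rewrite -EFinM -exprMn.
Qed.

Lemma sqintD f g : sqint f -> sqint g -> sqint (f + g).
Proof.
move=> sf sg; split; first exact: measurable_funD sf.1 sg.1.
apply: eq_integrable (integrableD mD (integrableD mD sf.2 sg.2)
  (integrableZl mD 2 (sqint_mul sf sg))) => // x _ /=.
rewrite -!(EFinM, EFinD); congr EFin.
by rewrite fctE; ring.
Qed.

Lemma sqintN f : sqint f -> sqint (- f).
Proof. by move=> sf; rewrite -scaleN1r; exact: sqintZ. Qed.

Lemma sqintB f g : sqint f -> sqint g -> sqint (f - g).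
Proof. by move=> sf sg; apply: sqintD => //; exact: sqintN. Qed.

Lemma ipC f g : ip f g = ip g f.
Proof. by apply: eq_Rintegral => x _; rewrite mulrC. Qed.

Lemma ipDl f g h : sqint f -> sqint g -> sqint h ->
  ip (f + g) h = ip f h + ip g h.
Proof.
move=> sf sg sh; rewrite /ip -RintegralD//; try exact: sqint_mul.
by apply: eq_Rintegral => x _; rewrite mulrDl.
Qed.

Lemma ipZl a f h : sqint f -> sqint h -> ip (a *: f) h = a * ip f h.
Proof.
move=> sf sh; rewrite /ip -RintegralZl//; last exact: sqint_mul.
by apply: eq_Rintegral => x _; rewrite mulrA.
Qed.

Lemma ipNl f h : sqint f -> sqint h -> ip (- f) h = - ip f h.
Proof. by move=> sf sh; rewrite -scaleN1r ipZl// mulN1r. Qed.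

Lemma ipBl f g h : sqint f -> sqint g -> sqint h ->
  ip (f - g) h = ip f h - ip g h.
Proof. by move=> sf sg sh; rewrite ipDl ?ipNl//; exact: sqintN. Qed.

Lemma ipDr f g h : sqint f -> sqint g -> sqint h ->
  ip h (f + g) = ip h f + ip h g.
Proof. by move=> sf sg sh; rewrite ipC ipDl// !(ipC h). Qed.

Lemma ipZr a f h : sqint f -> sqint h -> ip h (a *: f) = a * ip h f.
Proof. by move=> sf sh; rewrite ipC ipZl// (ipC h). Qed.

Lemma ipBr f g h : sqint f -> sqint g -> sqint h ->
  ip h (f - g) = ip h f - ip h g.
Proof. by move=> sf sg sh; rewrite ipC ipBl// !(ipC h). Qed.

Lemma ip0l f : ip 0 f = 0.
Proof.
rewrite /ip (_ : (fun x => _) = cst 0); last by apply/funext => x; rewrite mul0r.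
by rewrite /Rintegral integral0.
Qed.

Lemma ip0r f : ip f 0 = 0.
Proof. by rewrite ipC ip0l. Qed.

Lemma ip_ge0 f : 0 <= ip f f.
Proof. by apply: Rintegral_ge0 => x _; rewrite -expr2 sqr_ge0. Qed.

Lemma ipBB f g : sqint f -> sqint g ->
  ip (f - g) (f - g) = ip f f - 2 * ip f g + ip g g.
Proof.
move=> sf sg; have sfg := sqintB sf sg.
by rewrite ipBl// !ipBr// (ipC g f); ring.
Qed.

Lemma ipDD f g : sqint f -> sqint g ->
  ip (f + g) (f + g) = ip f f + 2 * ip f g + ip g g.
Proof.
move=> sf sg; have sfg := sqintD sf sg.
by rewrite ipDl// !ipDr// (ipC g f); ring.
Qed.

Lemma ip_eq0 f : sqint f -> ip f f = 0 -> ae_eq mu D f (cst 0).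
Proof.
move=> sf f0.
have i_f := sqint_mul sf sf.
have e0 : (\int[mu]_(x in D) `|(EFin \o (fun x => (f x * f x)%R)) x| = 0)%E.
  transitivity (ip f f)%:E; last by rewrite f0.
  rewrite fineK; last exact: integrable_fin_num.
  apply: eq_integral => x _; rewrite /= ger0_norm//.
  by rewrite -expr2 sqr_ge0.
have [/(_ e0) + _] := ae_eq_integral_abs mu mD (measurable_int _ i_f).
apply: filterS => x /= /[apply] /eqP.
by rewrite eqe mulf_eq0 orbb => /eqP.
Qed.

Lemma ae_eq_meas_integral f g : measurable_fun D f -> measurable_fun D g ->
  ae_eq mu D f g -> \int[mu]_(x in D) f x = \int[mu]_(x in D) g x.
Proof.
move=> mf mg fg; congr fine; apply: ae_eq_integral => //.
- exact/measurable_EFinP.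
- exact/measurable_EFinP.
- by apply: filterS fg => x /[apply] /= ->.
Qed.

Lemma eq_ip f f' g g' : measurable_fun D f -> measurable_fun D f' ->
  measurable_fun D g -> measurable_fun D g' ->
  ae_eq mu D f f' -> ae_eq mu D g g' -> ip f g = ip f' g'.
Proof.
move=> mf mf' mg mg' ff' gg'; apply: ae_eq_meas_integral.
- exact: measurable_funM.
- exact: measurable_funM.
by apply: filterS2 ff' gg' => x /= fx gx Dx; rewrite fx// gx.
Qed.

Lemma ae_sqint f f' : measurable_fun D f' -> ae_eq mu D f f' -> sqint f ->
  sqint f'.
Proof.
move=> mf' ff' [mf /integrableP[_ i_f]]; split => //; apply/integrableP; split.
  by apply/measurable_EFinP; exact: measurable_funX.
apply: le_lt_trans i_f; apply: eq_imp_le.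
apply: ae_eq_integral => //.
- apply: measurableT_comp => //.
  by apply/measurable_EFinP; exact: measurable_funX.
- apply: measurableT_comp => //.
  by apply/measurable_EFinP; exact: measurable_funX.
- by apply: filterS ff' => x /[apply] /= ->.
Qed.

Lemma ip_ae_l f f' g : sqint f -> sqint f' -> sqint g ->
  ae_eq mu D f f' -> ip f g = ip f' g.
Proof.
move=> [mf _] [mf' _] [mg _] ff'; apply: eq_ip => //.
by apply: aeW => x.
Qed.

Lemma ip_ae_r f f' g : sqint f -> sqint f' -> sqint g ->
  ae_eq mu D f f' -> ip g f = ip g f'.
Proof. by move=> sf sf' sg ff'; rewrite !(ipC g); exact: ip_ae_l. Qed.

(** The discriminant of the nonnegative quadratic t |-> |f - t g|^2. *)
Lemma cauchy_schwarz f g : sqint f -> sqint g ->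
  ip f g ^+ 2 <= ip f f * ip g g.
Proof.
move=> sf sg.
have q t : 0 <= ip f f - 2 * t * ip f g + t ^+ 2 * ip g g.
  have := ip_ge0 (f - t *: g).
  rewrite ipBB//; last exact: sqintZ.
  rewrite ipZr// ipZr//; last exact: sqintZ.
  by rewrite ipZl//; congr (_ <= _); ring.
have f0 := ip_ge0 f.
have := ip_ge0 g; rewrite le_eqVlt => /predU1P[g0|g0].
  rewrite -g0 mulr0; have [->|fg0] := eqVneq (ip f g) 0; first by rewrite expr0n.
  have := q ((ip f f + 1) / (2 * ip f g)).
  rewrite -g0 mulr0 addr0 (_ : 2 * _ * _ = ip f f + 1); last by field.
  by rewrite opprD addrA subrr add0r ler0N1.
have := q (ip f g / ip g g).
rewrite -(@pmulr_lge0 _ (ip g g))// -[ip f g ^+ 2 <= _]subr_ge0.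
suff -> : forall a b c : R, 0 < c ->
  (a - 2 * (b / c) * b + (b / c) ^+ 2 * c) * c = a * c - b ^+ 2 by [].
by move=> a b c c0; field; rewrite gt_eqF.
Qed.

Lemma ip_triangle f g : sqint f -> sqint g ->
  ip (f + g) (f + g) <= 2 * ip f f + 2 * ip g g.
Proof.
move=> sf sg; have := ip_ge0 (f - g); rewrite ipBB// ipDD//; nra.
Qed.

Lemma cvgL2_ip u f g : (forall n, sqint (u n)) -> sqint f -> sqint g ->
  cvgL2 u f -> (fun n => ip (u n) g) @ \oo --> ip f g.
Proof.
move=> su sf sg uf.
apply/subr_cvg0.
have e n : ip (u n) g - ip f g = ip (u n - f) g by rewrite ipBl.
rewrite (_ : (fun n => _) = fun n => ip (u n - f) g); last exact/funext.
apply/norm_cvg0P.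
have sq : (fun n => Num.sqrt (ip (u n - f) (u n - f) * ip g g)) @ \oo --> (0 : R).
  rewrite -[X in _ --> X]sqrtr0; apply: continuous_cvg.
    exact: sqrt_continuous.
  rewrite -[X in _ --> X](mul0r (ip g g)); apply: cvgM => //; exact: cvg_cst.
apply: (squeeze_cvgr _ (cvg_cst _) sq); apply: nearW => n.
rewrite normr_ge0/= -sqrtr_sqr ler_wsqrtr// cauchy_schwarz//.
exact: sqintB.
Qed.

Lemma cvgL2D u v f g : (forall n, sqint (u n)) -> (forall n, sqint (v n)) ->
  sqint f -> sqint g -> cvgL2 u f -> cvgL2 v g -> cvgL2 (u + v) (f + g).
Proof.
move=> su sv sf sg uf vg.
have lim : (fun n => 2 * ip (u n - f) (u n - f) + 2 * ip (v n - g) (v n - g))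
    @ \oo --> (0 : R).
  rewrite -[X in _ --> X](addr0 0) -{1}(mulr0 2) -{2}(mulr0 2).
  by apply: cvgD; apply: cvgM => //; exact: cvg_cst.
apply: (squeeze_cvgr _ (cvg_cst _) lim); apply: nearW => n.
rewrite ip_ge0/= (_ : _ - _ = (u n - f) + (v n - g)); last first.
  by rewrite -[(u + v) n]/(u n + v n) addrACA opprD.
by apply: ip_triangle; exact: sqintB.
Qed.

Lemma cvgL2Z u f a : (forall n, sqint (u n)) -> sqint f ->
  cvgL2 u f -> cvgL2 (fun n => a *: u n) (a *: f).
Proof.
move=> su sf uf; rewrite /cvgL2.
rewrite (_ : (fun n => _) = fun n => a ^+ 2 * ip (u n - f) (u n - f)).
  by rewrite -[X in _ --> X](mulr0 (a ^+ 2)); apply: cvgM => //; exact: cvg_cst.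
apply/funext => n; have s := sqintB (su n) sf.
by rewrite -scalerBr ipZl ?ipZr ?mulrA//; exact: sqintZ.
Qed.

Lemma cvgL2_cst f : cvgL2 (fun=> f) f.
Proof.
rewrite /cvgL2 (_ : (fun n => _) = cst 0); first exact: cvg_cst.
by apply/funext => n /=; rewrite subrr ip0l.
Qed.

Lemma cvgL2_nsq u f : (forall n, sqint (u n)) -> sqint f ->
  cvgL2 u f -> (fun n => ip (u n) (u n)) @ \oo --> ip f f.
Proof.
move=> su sf uf.
rewrite (_ : (fun n => _) = fun n =>
  ip (u n - f) (u n - f) + (2 * ip (u n) f - ip f f)); last first.
  by apply/funext => n; rewrite ipBB//; ring.
rewrite -[X in _ --> X]add0r; apply: cvgD => //.
rewrite [X in _ --> X](_ : ip f f = 2 * ip f f - ip f f); last by ring.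
apply: cvgB; last exact: cvg_cst.
by apply: cvgM; [exact: cvg_cst|exact: cvgL2_ip].
Qed.

Lemma sum_half_powers_le2 n : \sum_(0 <= k < n) 2^-1 ^+ k <= 2 :> R.
Proof.
have := @geometric_seriesE R 1 2^-1; rewrite /series/=.
move=> /(_ _)/funeqP/(_ n)/=; under eq_bigr do rewrite mul1r.
have n1 : 2^-1 != 1 :> R by rewrite invr_eq1 (eqr_nat _ 2 1).
move=> -> //; rewrite mul1r.
have q0 : 0 <= 2^-1 ^+ n :> R by apply: exprn_ge0; rewrite invr_ge0.
rewrite (_ : 1 - 2^-1 = 2^-1 :> R); last by field.
by rewrite invrK; nra.
Qed.

(** Because |x| <= (2^k x^2 + 2^-k) / 2. *)
Lemma cvg_series_weighted_squares (x : R ^nat) (M : R) :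
  (forall n, \sum_(0 <= k < n) 2 ^+ k * x k ^+ 2 <= M) -> cvgn (series x).
Proof.
move=> xM; apply: normed_cvg.
apply: nondecreasing_is_cvgn.
  by apply: nondecreasing_series => k _ _; exact: normr_ge0.
exists ((M + 2) / 2) => _ [n _ <-]; rewrite /series/=.
apply: (@le_trans _ _ (\sum_(0 <= k < n) (2 ^+ k * x k ^+ 2 + 2^-1 ^+ k) / 2)).
  apply: ler_sum => k _; rewrite ler_pdivlMr//.
  have p0 : 0 < 2 ^+ k :> R by exact: exprn_gt0.
  rewrite -(real_normK (num_real (x k))) exprVn -subr_ge0.
  rewrite (_ : _ - _ = (2 ^+ k)^-1 * (2 ^+ k * `|x k| - 1) ^+ 2).
    by rewrite mulr_ge0 ?sqr_ge0// invr_ge0 ltW.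
  by field; rewrite gt_eqF.
rewrite -mulr_suml ler_pM2r ?invr_gt0// big_split/= lerD//.
exact: sum_half_powers_le2.
Qed.

Lemma integral_sqr_ip f : sqint f ->
  (\int[mu]_(x in D) (f x ^+ 2)%:E = (ip f f)%:E)%E.
Proof.
move=> sf; rewrite fineK; last first.
  by apply: integrable_fin_num => //; exact: sqint_mul.
by apply: eq_integral => x _; rewrite expr2.
Qed.

Lemma sqint_integral_le f (e : R) : measurable_fun D f ->
  (\int[mu]_(x in D) (f x ^+ 2)%:E <= e%:E)%E -> sqint f /\ ip f f <= e.
Proof.
move=> mf le; have sf : sqint f.
  split => //; apply/integrableP; split.
    by apply/measurable_EFinP; exact: measurable_funX.
  apply: le_lt_trans (ltry e); apply: le_trans le.
  apply: eq_imp_le.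
  by apply: eq_integral => x _ /=; rewrite ger0_norm ?sqr_ge0.
by split => //; move: le; rewrite integral_sqr_ip// lee_fin.
Qed.

(** Fatou's lemma, in the form in which it shows that a pointwise limit of a
    Cauchy sequence is also its limit in the mean. *)
Lemma sqint_pointwise_lim (w : nat -> T -> R) f (e : R) :
  (forall k, sqint (w k)) -> (forall k, ip (w k) (w k) <= e) ->
  (forall x, D x -> w ^~ x @ \oo --> f x) -> sqint f /\ ip f f <= e.
Proof.
move=> sw we wf.
have mf : measurable_fun D f.
  by apply: measurable_fun_cvg wf => k; exact: sqint_meas.
apply: sqint_integral_le => //.
have := @fatou _ _ _ mu D mD (fun k x => (w k x ^+ 2)%:E).
move=> /(_ _ _)/le_trans; move/(_ _) => F.
rewrite (_ : (\int[mu]_(x in D) _)%E =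
  (\int[mu]_(x in D) limn_einf (fun k => (w k x ^+ 2)%:E))%E); last first.
  apply: eq_integral => x /[!inE] Dx; rewrite limn_einf_lim.
  apply/esym/cvg_lim => //; apply: cvg_einfs.
  apply: cvg_EFin; first exact: nearW.
  rewrite [X in X @ _](_ : _ = fun k => w k x * w k x).
    by rewrite expr2; apply: cvgM; exact: wf.
  by apply/funext => k /=; rewrite expr2.
apply: F.
- move=> k; apply/measurable_EFinP; apply: measurable_funX.
  exact: sqint_meas (sw k).
- by move=> k x _; rewrite lee_fin sqr_ge0.
rewrite limn_einf_lim; apply: lime_le; first exact: is_cvg_einfs.
apply: nearW => k; apply: (@le_trans _ _ (\int[mu]_(x in D) (w k x ^+ 2)%:E)%E).
  by apply: ereal_inf_lbound; exists k => //=.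
by rewrite integral_sqr_ip// lee_fin.
Qed.

(** Riesz-Fischer: along a subsequence whose increments have squared norms at
    most 4^-k the series of 2^k |increment|^2 is integrable, hence finite almost
    everywhere, so the subsequence converges pointwise almost everywhere. *)
Lemma L2_complete u : (forall n, sqint (u n)) ->
  (forall e : R, 0 < e -> exists N, forall n k, (N <= n)%N -> (N <= k)%N ->
    ip (u n - u k) (u n - u k) <= e) ->
  exists2 f, sqint f & cvgL2 u f.
Proof.
move=> su cu.
have /choice[N HN] : forall k : nat, exists N : nat, forall n l,
    (N <= n)%N -> (N <= l)%N -> ip (u n - u l) (u n - u l) <= 4^-1 ^+ k.
  by move=> k; apply: cu; apply: exprn_gt0; rewrite invr_gt0.
pose phi k := (\sum_(i < k.+1) (N i).+1)%N.
have phiN k : (N k <= phi k)%N by rewrite /phi big_ord_recr/= -addSnnS leq_addl.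
have phik k : (k <= phi k)%N.
  elim: k => // k ih; have -> : phi k.+1 = (phi k + (N k.+1).+1)%N.
    by rewrite /phi big_ord_recr.
  by rewrite addnS ltnS (leq_trans ih)// leq_addr.
have phi_nd k l : (k <= l)%N -> (phi k <= phi l)%N.
  move=> kl; rewrite /phi -!(big_mkord xpredT (fun i => (N i).+1)).
  by rewrite [leqRHS](@big_cat_nat _ _ _ k.+1)//= leq_addr.
pose dl k := u (phi k.+1) - u (phi k).
have sdl k : sqint (dl k) by apply: sqintB.
have dle k : ip (dl k) (dl k) <= 4^-1 ^+ k.
  by apply: HN => //; apply: leq_trans (phiN k) _; exact: phi_nd.
pose h k x : \bar R := (2 ^+ k * dl k x ^+ 2)%:E.
have mh k : measurable_fun D (h k).
  apply/measurable_EFinP; apply: measurable_funM; first exact: measurable_cst.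
  by apply: measurable_funX; exact: sqint_meas.
have h0 k x : D x -> (0 <= h k x)%E.
  by move=> _; rewrite lee_fin mulr_ge0 ?sqr_ge0 ?exprn_ge0.
have ih k : (\int[mu]_(x in D) h k x <= (2^-1 ^+ k)%:E)%E.
  rewrite /h; under eq_integral do rewrite EFinM.
  rewrite ge0_integralZl_EFin//; last 2 first.
  - by move=> x _; rewrite lee_fin sqr_ge0.
  - by apply/measurable_EFinP; apply: measurable_funX; exact: sqint_meas.
  rewrite integral_sqr_ip// -EFinM lee_fin.
  apply: (@le_trans _ _ (2 ^+ k * 4^-1 ^+ k)).
    by rewrite ler_wpM2l// exprn_ge0.
  rewrite -exprMn (_ : 2 * 4^-1 = 2^-1 :> R)//; by field.
pose S x : \bar R := (\sum_(k <oo) h k x)%E.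
have iS : mu.-integrable D S.
  apply/integrableP; split.
    rewrite /S; apply: (@ge0_emeasurable_sum _ _ _ D h xpredT) => //.
    by move=> k x Dx _; exact: h0.
  rewrite (_ : (\int[mu]_(x in D) `|S x|)%E = (\int[mu]_(x in D) S x)%E); last first.
    apply: eq_integral => x /[!inE] Dx; rewrite gee0_abs//.
    by apply: nneseries_ge0 => k _ _; exact: h0.
  rewrite integral_nneseries//.
  apply: (@le_lt_trans _ _ (\sum_(k <oo) (2^-1 ^+ k)%:E)%E).
    apply: lee_nneseries => k _; last exact: ih.
    by move=> _; apply: integral_ge0 => x; exact: h0.
  apply: (@le_lt_trans _ _ 2%:E); last exact: ltry.
  apply: lime_le; first by apply: is_cvg_nneseries => k _ _; rewrite lee_fin exprn_ge0.
  by apply: nearW => n; rewrite sumEFin lee_fin sum_half_powers_le2.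
have [Nl [mN N0 subN]] := integrable_ae mD iS.
have cx x : D x -> ~ Nl x -> cvgn (fun k => u (phi k) x).
  move=> Dx Nx.
  have Sfin : S x \is a fin_num.
    by apply: contrapT => nf; apply: Nx; apply: subN => /= /(_ Dx).
  have : cvgn (series (fun k => dl k x)).
    apply: (@cvg_series_weighted_squares _ (fine (S x))) => n.
    rewrite -lee_fin fineK// -sumEFin.
    by apply: nneseries_lim_ge => k _ _; exact: h0.
  have -> : (fun k => dl k x) = telescope (fun k => u (phi k) x) by [].
  move=> c; have -> : (fun k => u (phi k) x) =
      (fun k => u (phi 0%N) x + series (telescope (fun k => u (phi k) x)) k).
    by apply/funext => k; rewrite [LHS](eq_sum_telescope (fun k => u (phi k) x)).
  by apply: is_cvgD => //; exact: is_cvg_cst.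
pose g k := u (phi k) \_ (~` Nl).
have mg k : measurable_fun D (g k).
  apply/measurable_restrict => //; first exact: measurableC.
  by apply: measurable_funS (sqint_meas (su (phi k))) => // x [].
have ug k : ae_eq mu D (u (phi k)) (g k).
  exists Nl; split => // x /= nx; apply: contrapT => Nx; apply: nx => Dx.
  by rewrite /g patchE mem_set.
have sg k : sqint (g k) by apply: ae_sqint (ug k) (su (phi k)).
pose f x := limn (g ^~ x).
have gf x : D x -> g ^~ x @ \oo --> f x.
  move=> Dx; have [Nx|Nx] := pselect (Nl x).
    have g0 : g ^~ x = cst 0.
      by apply/funext => k; rewrite /g patchE memNset//= => /(_ Nx).
    by rewrite /f g0 lim_cst//; exact: cvg_cst.
  rewrite /f (_ : g ^~ x = fun k => u (phi k) x); first exact: cx.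
  by apply/funext => k; rewrite /g patchE mem_set.
have key n (e : R) K : (forall k, (K <= k)%N -> ip (u n - u k) (u n - u k) <= e) ->
    sqint (u n - f) /\ ip (u n - f) (u n - f) <= e.
  move=> He; apply: (@sqint_pointwise_lim (fun k => u n - g (k + K)%N)).
  - by move=> k; exact: sqintB.
  - move=> k; rewrite (_ : ip _ _ = ip (u n - u (phi (k + K)%N)) (u n - u (phi (k + K)%N))).
      by apply: He; apply: leq_trans (leq_addl k K) (phik _).
    have ae : ae_eq mu D (u n - g (k + K)%N) (u n - u (phi (k + K)%N)).
      by apply: filterS (ug (k + K)%N) => x /[apply] E; rewrite !fctE E.
    by apply: eq_ip => //; apply: sqint_meas; exact: sqintB.
  - move=> x Dx; apply: cvgB; first exact: cvg_cst.
    by have := gf x Dx; rewrite -(cvg_shiftn K).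
have sf : sqint f.
  have [N1 HN1] := cu 1 ltr01.
  have [s _] := key N1 1 N1 (fun k => HN1 _ _ (leqnn _)).
  rewrite (_ : f = u N1 - (u N1 - f)); first exact: sqintB.
  by rewrite opprB addrC subrK.
exists f => //; apply/cvgrPdist_le => e e0.
have [N1 HN1] := cu e e0.
exists N1 => // n /= n1; rewrite sub0r normrN ger0_norm ?ip_ge0//.
by have [_] := key n e N1 (fun k => HN1 _ _ n1).
Qed.

Lemma eq_cvgL2 u v f g : (forall n x, D x ->
    (v n x - g x) ^+ 2 = (u n x - f x) ^+ 2) -> cvgL2 u f -> cvgL2 v g.
Proof.
move=> uv; rewrite /cvgL2 (_ : (fun n => ip (u n - f) _) =
  fun n => ip (v n - g) (v n - g))//.
by apply/funext => n; apply: eq_Rintegral => x /[!inE] Dx; rewrite -!expr2 uv.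
Qed.

Lemma Rintegral_dominated u f g :
  (forall n, measurable_fun D (u n)) -> measurable_fun D f ->
  mu.-integrable D (EFin \o g) ->
  (forall n x, D x -> `|u n x| <= g x) ->
  {ae mu, forall x, D x -> u ^~ x @ \oo --> f x} ->
  (fun n => \int[mu]_(x in D) u n x) @ \oo --> \int[mu]_(x in D) f x.
Proof.
move=> mu_ mf ig ug uf.
have uf' : {ae mu, forall x, D x -> (fun n => (u n x)%:E) @ \oo --> (f x)%:E}.
  apply: filterS uf => x /[apply] uf; apply: cvg_EFin => //; exact: nearW.
have ug' : {ae mu, forall x n, D x -> (`|(u n x)%:E| <= (g x)%:E)%E}.
  by apply: aeW => x n Dx; rewrite lee_fin ug.
have [i_f _ c] := dominated_convergence mD
  (fun n => (measurable_EFinP _ _).2 (mu_ n)) ((measurable_EFinP _ _).2 mf)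
  uf' ig ug'.
apply: fine_cvg; rewrite fineK//; exact: integrable_fin_num.
Qed.

(** The squares |u n - f|^2 are dominated by 4 g^2. *)
Lemma cvgL2_dominated u f g :
  (forall n, measurable_fun D (u n)) -> measurable_fun D f -> sqint g ->
  (forall n x, D x -> `|u n x| <= g x) ->
  (forall x, D x -> u ^~ x @ \oo --> f x) ->
  [/\ forall n, sqint (u n), sqint f & cvgL2 u f].
Proof.
move=> mu_ mf sg ug uf.
have su n : sqint (u n) by apply: le_sqint (ug n) sg.
have fg x : D x -> `|f x| <= g x.
  move=> Dx; have /cvg_norm fx := uf x Dx.
  rewrite -(cvg_lim _ fx)//; apply: limr_le; first by apply/cvg_ex; exists `|f x|.
  by apply: nearW => n; exact: ug.
have sf : sqint f by apply: le_sqint fg sg.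
split => //; rewrite /cvgL2 (_ : 0 = \int[mu]_(x in D) (cst 0 x)); last first.
  by rewrite /Rintegral/= integral0.
apply: (@Rintegral_dominated _ _ (fun x => 4 * g x ^+ 2)).
- by move=> n; apply: measurable_funM; exact: measurable_funB.
- exact: measurable_cst.
- apply: eq_integrable (integrableZl mD 4 sg.2) => //.
- move=> n x Dx; rewrite normrM -expr2.
  have ux := ug n x Dx; have fx := fg x Dx.
  have : `|(u n - f) x| <= 2 * g x.
    by apply: (le_trans (ler_normB _ _)); rewrite mulr2n mulrDl !mul1r lerD.
  by move=> le; rewrite (_ : 4 * _ = (2 * g x) ^+ 2) ?lerXn2r ?nnegrE//;
    [exact: le_trans le|ring].
- apply: aeW => x Dx; rewrite /= -[X in _ --> X](mulr0 0).
  have c : (u n - f) x @[n --> \oo] --> 0.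
    rewrite -[X in _ --> X](subrr (f x)).
    by apply: cvgB; [exact: uf|exact: cvg_cst].
  exact: cvgM.
Qed.

Lemma cvgL2_Cauchy u f : (forall n, sqint (u n)) -> sqint f -> cvgL2 u f ->
  forall e : R, 0 < e -> exists N, forall n k, (N <= n)%N -> (N <= k)%N ->
    ip (u n - u k) (u n - u k) <= e.
Proof.
move=> su sf uf e e0.
have e4 : 0 < e / 4 by rewrite divr_gt0.
have /cvgrPdist_le/(_ _ e4)[N _ HN] := uf.
exists N => n k Nn Nk; rewrite (_ : u n - u k = (u n - f) + (f - u k)); last first.
  by rewrite addrA subrK.
apply: (le_trans (ip_triangle _ _)) => //; try exact: sqintB.
have -> : ip (f - u k) (f - u k) = ip (u k - f) (u k - f).
  by apply: eq_Rintegral => x _; rewrite !fctE; ring.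
have := HN n Nn; have := HN k Nk.
rewrite /= !sub0r !normrN !ger0_norm ?ip_ge0//; lra.
Qed.

Section projection.
Variable S : set (T -> R).
Hypothesis S_sqint : forall s, S s -> sqint s.
Hypothesis S0 : S 0.
Hypothesis S_lin : forall a s t, S s -> S t -> S (a *: s + t).

(** The point of the closure of [S] nearest to [f]: by the parallelogram law a
    minimizing sequence is Cauchy, and minimality makes f - p orthogonal to S. *)
Lemma L2_projection f : sqint f -> exists p u,
  [/\ sqint p, forall n, S (u n), cvgL2 u p &
      forall s, S s -> ip (f - p) s = 0].
Proof.
move=> sf.
pose E := [set ip (f - s) (f - s) | s in S].
have E0 : E !=set0 by exists (ip (f - 0) (f - 0)), 0.
have lbE : lbound E 0 by move=> _ [s _ <-]; exact: ip_ge0.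
have infE : has_inf E by split => //; exists 0.
pose del := inf E.
have del_le s : S s -> del <= ip (f - s) (f - s).
  by move=> Ss; apply: ge_inf; [exists 0|exists s].
have /choice[u Hu] : forall n : nat, exists s, S s /\
    ip (f - s) (f - s) < del + n.+1%:R^-1.
  move=> n; have n0 : 0 < n.+1%:R^-1 :> R by rewrite invr_gt0.
  by have [_ [s Ss <-] lt] := inf_adherent n0 infE; exists s.
have Su n : S (u n) by have [] := Hu n.
have su n := S_sqint (Su n).
have ule n := (Hu n).2.
have cu (e : R) : 0 < e -> exists N, forall n k, (N <= n)%N -> (N <= k)%N ->
    ip (u n - u k) (u n - u k) <= e.
  move=> e0; have e4 : 0 < e / 4 by rewrite divr_gt0.
  have [N _ HN] := near_infty_natSinv_lt (PosNum e4).
  exists N => n k Nn Nk.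
  have /= hn := HN n Nn; have /= hk := HN k Nk.
  have Sm : S (2^-1 *: (u n + u k)).
    have := S_lin 2^-1 (S_lin 1 (Su n) (Su k)) S0.
    by rewrite scale1r addr0.
  have := del_le _ Sm.
  have sx : sqint (f - u n) by exact: sqintB.
  have sy : sqint (f - u k) by exact: sqintB.
  have -> : f - 2^-1 *: (u n + u k) = 2^-1 *: ((f - u n) + (f - u k)).
    by apply/funext => x; rewrite !fctE/= /GRing.scale/=; field.
  have -> : u n - u k = (f - u k) - (f - u n).
    by apply/funext => x; rewrite !fctE; ring.
  rewrite ipZl ?ipZr//; try exact: sqintD; last by apply: sqintZ => //; exact: sqintD.
  rewrite (ipDD sx sy) (ipBB sy sx) (ipC (f - u k) (f - u n)).
  have hx : ip (f - u n) (f - u n) <= del + e / 4.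
    by apply: ltW; apply: lt_trans (ule n) _; rewrite ltrD2l.
  have hy : ip (f - u k) (f - u k) <= del + e / 4.
    by apply: ltW; apply: lt_trans (ule k) _; rewrite ltrD2l.
  by move: hx hy; move: (ip _ _) (ip _ _) (ip _ _) => x y z; lra.
have [p sp up] := L2_complete su cu.
exists p, u; split => // s Ss.
have ss := S_sqint Ss.
have sr := sqintB sf sp.
pose b := ip (f - p) s; pose c := ip s s.
have quad t : 0 <= - 2 * t * b + t ^+ 2 * c.
  have lim : (fun n => ip (f - u n) (f - u n)) @ \oo --> ip (f - p) (f - p).
    apply: cvgL2_nsq => //; first by move=> n; exact: sqintB.
    by apply: eq_cvgL2 up => n x _; rewrite !fctE; ring.
  have limt : (fun n => ip ((f - u n) - t *: s) ((f - u n) - t *: s)) @ \oo -->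
      ip ((f - p) - t *: s) ((f - p) - t *: s).
    have st := sqintZ t ss.
    apply: cvgL2_nsq => //; [|exact: sqintB|].
      by move=> n; apply: sqintB => //; exact: sqintB.
    by apply: eq_cvgL2 up => n x _; rewrite !fctE; ring.
  have le1 : ip (f - p) (f - p) <= del.
    rewrite -(cvg_lim _ lim)//.
    have lim2 : (fun n => del + n.+1%:R^-1) @ \oo --> del.
      rewrite -[X in _ --> X]addr0; apply: cvgD; first exact: cvg_cst.
      exact: cvg_harmonic.
    rewrite -[leRHS](cvg_lim _ lim2)//; apply: ler_lim.
    - by apply/cvg_ex; exists (ip (f - p) (f - p)).
    - by apply/cvg_ex; exists del.
    - by apply: nearW => n; exact: ltW.
  have le2 : del <= ip ((f - p) - t *: s) ((f - p) - t *: s).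
    rewrite -[leRHS](cvg_lim _ limt)//; apply: limr_ge.
      by apply/cvg_ex; eexists; exact: limt.
    apply: nearW => n; rewrite -addrA -opprD; apply: del_le.
    by rewrite addrC; exact: S_lin.
  move: le2; rewrite ipBB//; last exact: sqintZ.
  rewrite ipZr// ipZr//; last exact: sqintZ.
  rewrite ipZl// -/b -/c; move: le1; lra.
apply: contrapT => /eqP b0; rewrite -/b in b0.
have c0 : 0 <= c by exact: ip_ge0.
have := quad (b / (c + 1)).
have -> : - 2 * (b / (c + 1)) * b + (b / (c + 1)) ^+ 2 * c =
    - (b ^+ 2 * (c + 2) / (c + 1) ^+ 2).
  by field; rewrite gt_eqF// ltr_wpDl.
have c1 : 0 < c + 1 by exact: ltr_wpDl.
have c2 : 0 < c + 2 by exact: ltr_wpDl.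
suff pos : 0 < b ^+ 2 * (c + 2) / (c + 1) ^+ 2 by rewrite oppr_ge0 leNgt pos.
by rewrite divr_gt0 ?exprn_gt0// mulr_gt0// exprn_even_gt0.
Qed.

Lemma L2_dense : (forall w, sqint w -> (forall s, S s -> ip w s = 0) ->
    ae_eq mu D w (cst 0)) ->
  forall f, sqint f -> exists2 u, forall n, S (u n) & cvgL2 u f.
Proof.
move=> S_perp f sf; have [p [u [sp Su up fp]]] := L2_projection sf.
exists u => //.
have sfp := sqintB sf sp.
have fp0 := S_perp _ sfp fp.
rewrite /cvgL2 (_ : (fun n => _) = fun n => ip (u n - p) (u n - p))//.
apply/funext => n.
have su := S_sqint (Su n).
have ae : ae_eq mu D (u n - f) (u n - p).
  apply: filterS fp0 => x /[apply] /eqP; rewrite !fctE subr_eq0 => /eqP ->//.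
by apply: eq_ip => //; apply: (sqint_meas); exact: sqintB.
Qed.

End projection.

End L2_space.

(** * Integration on the half-line *)

Section half_line_L2.
Context {R : realType}.
Local Notation mu := (@Defs.mu R).
Local Notation HL := (@half_line R).

Section half_line_integral.
Implicit Types (f g h F : R -> R) (a b c x y : R).

Lemma half_lineE x : HL x = (0 < x) :> Prop.
Proof. by rewrite /half_line/= in_itv/= andbT. Qed.

Lemma measurable_half_line : measurable (HL : set (measurableTypeR R)).
Proof. exact: measurable_itv. Qed.

(** Compact intervals, on which the fundamental theorem of calculus applies. *)
Definition exhaustion n : set R := `[n.+1%:R^-1, n.+1%:R].

Lemma measurable_exhaustion n : measurable (exhaustion n).
Proof. exact: measurable_itv. Qed.

Lemma exhaustion_half_line n : exhaustion n `<=` HL.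
Proof.
move=> x; rewrite /exhaustion half_lineE/= in_itv/= => /andP[+ _].
by apply: lt_le_trans; rewrite invr_gt0.
Qed.

Lemma exhaustion_eventually x : 0 < x -> \forall n \near \oo, exhaustion n x.
Proof.
move=> x0.
have [N1 _ H1] := near_infty_natSinv_lt (PosNum x0).
have xV : 0 < x^-1 by rewrite invr_gt0.
have [N2 _ H2] := near_infty_natSinv_lt (PosNum xV).
exists (maxn N1 N2) => // n /=; rewrite geq_max => /andP[n1 n2].
rewrite /exhaustion/= in_itv/= (ltW (H1 _ n1))/=.
by have /ltW := H2 _ n2; rewrite /= lef_pV2 ?posrE.
Qed.

Lemma exhaustion_nondecreasing : nondecreasing_seq exhaustion.
Proof.
move=> n k nk; apply/subsetPset => x; rewrite /exhaustion/= !in_itv/=.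
move=> /andP[lx xr]; apply/andP; split.
  by apply: le_trans lx; rewrite lef_pV2 ?posrE// ler_nat ltnS.
by apply: le_trans xr _; rewrite ler_nat ltnS.
Qed.

Lemma exhaustion_cover : \bigcup_n exhaustion n = HL.
Proof.
apply/seteqP; split => [x [n _]|x]; first exact: exhaustion_half_line.
by rewrite half_lineE => /exhaustion_eventually[N _ /(_ N (leqnn N))]; exists N.
Qed.

Lemma ge0_integral_half_line_lim f : measurable_fun HL f ->
  (forall x, 0 < x -> 0 <= f x) ->
  (fun n => \int[mu]_(x in exhaustion n) (f x)%:E)%E @ \oo -->
    (\int[mu]_(x in HL) (f x)%:E)%E.
Proof.
move=> mf f0; rewrite -exhaustion_cover.
apply: ge0_nondecreasing_set_cvg_integral.
- exact: exhaustion_nondecreasing.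
- exact: measurable_exhaustion.
- move=> i; apply/measurable_EFinP; apply: measurable_funS mf => //.
    exact: measurable_half_line.
  exact: exhaustion_half_line.
- by move=> i x /exhaustion_half_line; rewrite half_lineE lee_fin => /f0.
Qed.

Lemma Rintegral_half_line_lim f : mu.-integrable HL (EFin \o f) ->
  (fun n => \int[mu]_(x in exhaustion n) f x) @ \oo -->
    \int[mu]_(x in HL) f x.
Proof.
move=> i_f.
have mf : measurable_fun HL f by apply/measurable_EFinP; exact: measurable_int i_f.
rewrite (_ : (fun n => _) =
    fun n => \int[mu]_(x in HL) (f \_ (exhaustion n)) x); last first.
  apply/funext => n; rewrite -Rintegral_mkcondr setIidr//.
  exact: exhaustion_half_line.
apply: (@Rintegral_dominated _ _ _ mu HL measurable_half_line _ f (fun x => `|f x|)).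
- move=> n; apply/measurable_restrict => //.
  + exact: measurable_exhaustion.
  + exact: measurable_half_line.
  + by apply: measurable_funS mf; [exact: measurable_half_line|move=> x []].
- by [].
- exact: integrable_norm.
- move=> n x _; rewrite patchE; case: ifPn => _ //.
  by rewrite normr0.
- apply: aeW => x; rewrite half_lineE => /exhaustion_eventually x0.
  apply: cvg_near_cst; apply: filterS x0 => n nx.
  by rewrite patchE mem_set.
Qed.

Lemma half_line_continuous_measurable f :
  (forall x, 0 < x -> {for x, continuous f}) -> measurable_fun HL f.
Proof.
move=> cf; apply: open_continuous_measurable_fun.
  exact: interval_open.
by move=> x; rewrite inE half_lineE; exact: cf.
Qed.

Lemma exhaustion_FTC F f n :
  (forall x, 0 < x -> is_derive x 1 F (f x)) ->
  (forall x, 0 < x -> {for x, continuous f}) ->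
  (\int[mu]_(x in exhaustion n) (f x)%:E =
    (F n.+1%:R - F n.+1%:R^-1)%:E)%E.
Proof.
move=> dF cf.
have n0 : 0 < n.+1%:R^-1 :> R by rewrite invr_gt0.
have cF x : 0 < x -> {for x, continuous F}.
  move=> x0; apply: differentiable_continuous; apply/derivable1_diffP.
  by have [] := dF x x0.
have [n1|n1] := ltP (n.+1%:R^-1 : R) n.+1%:R; last first.
  have e : n = 0%N.
    move: n1; case: n {n0} => // n; rewrite leNgt => /negP[].
    by rewrite (@lt_le_trans _ _ 1) ?invf_lt1// ?ltr1n// ler1n.
  rewrite /exhaustion e invr1 subrr set_itv1 integral_set1//.
rewrite EFinD EFinN; apply: continuous_FTC2 => //.
- apply: continuous_in_subspaceT => x; rewrite inE/= in_itv/= => /andP[nx _].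
  by apply: cf; exact: lt_le_trans nx.
- split.
  + move=> x; rewrite in_itv/= => /andP[nx _].
    by have [] := dF x (lt_trans n0 nx).
  + exact/cvg_at_right_filter/cF.
  + exact/cvg_at_left_filter/cF.
- move=> x; rewrite in_itv/= => /andP[nx _].
  by have [_ <-] := dF x (lt_trans n0 nx); rewrite derive1E.
Qed.

(** All integrations by parts are done in this form, with the boundary terms
    collected in F. *)
Lemma Rintegral_half_line_derive0 F f : mu.-integrable HL (EFin \o f) ->
  (forall x, 0 < x -> is_derive x 1 F (f x)) ->
  (forall x, 0 < x -> {for x, continuous f}) ->
  (fun n => F n.+1%:R - F n.+1%:R^-1) @ \oo --> (0 : R) ->
  \int[mu]_(x in HL) f x = 0.
Proof.
move=> i_f dF cf F0; have := Rintegral_half_line_lim i_f.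
rewrite (_ : (fun n => _) = fun n => F n.+1%:R - F n.+1%:R^-1).
  by move=> /cvg_lim <-//; apply/cvg_lim.
by apply/funext => n; rewrite /Rintegral (exhaustion_FTC n dF cf).
Qed.

(** The integrals over the exhausting compact intervals are increments of F. *)
Lemma integrable_bounded_primitive F f (M : R) :
  (forall x, 0 < x -> 0 <= f x) ->
  (forall x, 0 < x -> is_derive x 1 F (f x)) ->
  (forall x, 0 < x -> {for x, continuous f}) ->
  (forall x, 0 < x -> 0 <= F x <= M) ->
  mu.-integrable HL (EFin \o f).
Proof.
move=> f0 dF cf FM.
have mf := half_line_continuous_measurable cf.
apply/integrableP; split; first exact/measurable_EFinP.
rewrite (_ : (\int[mu]_(x in HL) _)%E = (\int[mu]_(x in HL) (f x)%:E)%E); last first.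
  apply: eq_integral => x; rewrite inE half_lineE => x0 /=.
  by rewrite ger0_norm// f0.
apply: (@le_lt_trans _ _ M%:E); last exact: ltry.
have := ge0_integral_half_line_lim mf f0 => c.
rewrite -(cvg_lim _ c)//; apply: lime_le; first by apply/cvg_ex; eexists; exact: c.
apply: nearW => n; rewrite (exhaustion_FTC n dF cf) lee_fin.
have /andP[_ r1] := FM n.+1%:R (ltr0Sn _ _).
have n0 : 0 < n.+1%:R^-1 :> R by rewrite invr_gt0.
by have /andP[r2 _] := FM _ n0; rewrite lerBlDr (le_trans r1)// lerDl.
Qed.

(** A locally integrable function all of whose primitives from 0 vanish is the
    almost everywhere derivative of 0. *)
Lemma ae_eq0_primitive f : measurable_fun HL f ->
  (forall y, mu.-integrable `]0, y] (EFin \o f)) ->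
  (forall y, 0 < y -> \int[mu]_(x in `]0, y]) f x = 0) ->
  ae_eq mu HL f (cst 0).
Proof.
move=> mf i_f f0.
pose g := f \_ HL.
have gE x : 0 < x -> g x = f x by move=> x0; rewrite /g patchE mem_set// half_lineE.
have ig y : mu.-integrable `]0, y] (EFin \o g).
  apply: eq_integrable (i_f y) => // x; rewrite inE/= in_itv/= => /andP[x0 _].
  by rewrite /= gE.
have mg : measurable_fun setT g.
  by apply/(measurable_restrictT f measurable_half_line).
have lg : locally_integrable setT g.
  split => //; first exact: openT.
  move=> K _ cK.
  have [M [_ KM]] := compact_bounded cK.
  have KM1 x : K x -> `|x| <= M + 1 by move=> Kx; apply: (KM (M + 1)) => //; rewrite ltrDl.
  have /integrableP[_] := i_f (M + 1).
  apply: le_lt_trans.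
  apply: (@le_trans _ _ (\int[mu]_(x in `]-oo, (M + 1)%R]) `|g x|%:E)%E).
    apply: ge0_subset_integral => //.
    - exact: compact_measurable.
    - by apply/measurable_EFinP; apply: measurableT_comp => //; exact: measurable_funTS.
    - by move=> x /KM1; rewrite /= in_itv/=; apply: le_trans; exact: ler_norm.
  rewrite integral_mkcond [leRHS]integral_mkcond; apply: eq_imp_le; apply: eq_integral => x _; rewrite !patchE/=.
  have [x0|x0] := ltP 0 x.
    by rewrite gE// !mem_setE/= !in_itv/= x0.
  rewrite [in RHS]memNset; last by rewrite /= in_itv/= ltNge x0.
  by case: ifPn => // _; rewrite /g patchE memNset ?normr0// half_lineE ltNge x0.
have := @FTC1 _ g (BRight 0) ig lg.
apply: filterS; first exact: (ae_filter_ringOfSetsType mu).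
move=> x /= H; rewrite half_lineE => x0.
have [|_] := H; first by rewrite lte_fin.
rewrite gE// => <-.
rewrite derive1E (@near_eq_derive _ _ _ _ (cst 0)) ?derive_cst//.
near=> y.
rewrite -[RHS](f0 y); last by near: y; exact: lt_nbhsr.
by apply: eq_Rintegral => t; rewrite inE/= in_itv/= => /andP[t0 _]; rewrite gE.
Unshelve. all: by end_near. Qed.

End half_line_integral.

Local Notation mH := measurable_half_line.
Local Notation sqint := (@sqint _ _ _ mu HL).
Local Notation ip := (@ip _ _ _ mu HL).
Local Notation cvgL2 := (@cvgL2 _ _ _ mu HL).

(** * Changes of variable *)

Section half_line_substitution.
Implicit Types (f g h F G : R -> R) (a b c x y : R).

(** F is an increasing bijection of the half-line. The intervals of the
    exhaustion are carried to intervals that exhaust the half-line as well,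
    and between these the substitution rule on compact intervals applies. *)
Lemma ge0_integral_half_line_subst F f G :
  (forall x, 0 < x -> 0 < F x) ->
  (forall x y, 0 < x -> x < y -> F x < F y) ->
  (forall x, 0 < x -> is_derive x 1 F (f x)) ->
  (forall x, 0 < x -> {for x, continuous f}) ->
  (forall x, 0 < x -> 0 <= f x) ->
  (forall y, 0 < y -> exists2 x, 0 < x & F x <= y) ->
  (forall y, exists2 x, 0 < x & y <= F x) ->
  (forall x, 0 < x -> {for x, continuous G}) ->
  (forall x, 0 < x -> 0 <= G x) ->
  (\int[mu]_(x in HL) (G x)%:E = \int[mu]_(x in HL) (G (F x) * f x)%:E)%E.
Proof.
move=> F0 Finc dF cf f0 Fsmall Flarge cG G0.
have Fle x y : 0 < x -> x <= y -> F x <= F y.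
  by move=> x0; rewrite le_eqVlt => /predU1P[->//|xy]; exact/ltW/Finc.
have cF x : 0 < x -> {for x, continuous F}.
  move=> x0; apply: differentiable_continuous; apply/derivable1_diffP.
  by have [] := dF x x0.
have n0 n : 0 < n.+1%:R^-1 :> R by rewrite invr_gt0.
pose J n : set R := `[F n.+1%:R^-1, F n.+1%:R]%classic.
have mG := half_line_continuous_measurable cG.
have J0 n : J n `<=` HL.
  move=> x; rewrite half_lineE /J/= in_itv/= => /andP[+ _].
  by apply: lt_le_trans; exact: F0.
have Jcover : \bigcup_n J n = HL.
  apply/seteqP; split => [x [n _]|y]; first exact: J0.
  rewrite half_lineE => y0.
  have [x1 x10 Fx1] := Fsmall y y0; have [x2 x20 Fx2] := Flarge y.
  have [N1 _ H1] := exhaustion_eventually x10.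
  have [N2 _ H2] := exhaustion_eventually x20.
  exists (maxn N1 N2) => //; rewrite /J/= in_itv/=.
  have := H1 (maxn N1 N2) (leq_maxl _ _); rewrite /exhaustion/= in_itv/= => /andP[h1 _].
  have := H2 (maxn N1 N2) (leq_maxr _ _); rewrite /exhaustion/= in_itv/= => /andP[_ h2].
  by rewrite (le_trans (Fle _ _ _ h1))//= (le_trans Fx2)// Fle.
have Jnd : nondecreasing_seq J.
  move=> n k nk; apply/subsetPset => x; rewrite /J/= !in_itv/= => /andP[lx xr].
  apply/andP; split.
    by apply: le_trans lx; apply: Fle => //; rewrite lef_pV2 ?posrE// ler_nat ltnS.
  by apply: le_trans xr _; apply: Fle => //; rewrite ler_nat ltnS.
have lim1 : (fun n => \int[mu]_(x in J n) (G x)%:E)%E @ \oo -->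
    (\int[mu]_(x in HL) (G x)%:E)%E.
  rewrite -{1}Jcover; apply: ge0_nondecreasing_set_cvg_integral => //.
  - by move=> i; exact: measurable_itv.
  - move=> i; apply/measurable_EFinP; apply: measurable_funS mG => //.
    exact: measurable_half_line.
  - by move=> i x /J0; rewrite half_lineE lee_fin => /G0.
have cGF x : 0 < x -> {for x, continuous (fun x => G (F x) * f x)}.
  move=> x0; apply: continuousM; last exact: cf.
  apply: continuous_comp; first exact: cF.
  by apply: cG; exact: F0.
have GF0 x : 0 < x -> 0 <= G (F x) * f x.
  by move=> x0; rewrite mulr_ge0 ?f0// G0// F0.
have lim2 := ge0_integral_half_line_lim (half_line_continuous_measurable cGF) GF0.
suff e : (fun n => \int[mu]_(x in J n) (G x)%:E)%E =
    (fun n => \int[mu]_(x in exhaustion n) (G (F x) * f x)%:E)%E.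
  by move: lim1; rewrite e => lim1; exact: (cvg_unique _ lim1 lim2).
apply/funext => n.
have [n1|n1] := ltP (n.+1%:R^-1 : R) n.+1%:R; last first.
  have e : n = 0%N.
    move: n1; case: n => // n; rewrite leNgt => /negP[].
    by rewrite (@lt_le_trans _ _ 1) ?invf_lt1// ?ltr1n// ler1n.
  by rewrite /exhaustion /J e invr1 !set_itv1 !integral_set1.
have dE x : 0 < x -> derive1 F x = f x.
  by move=> x0; rewrite derive1E; have [_ ->] := dF x x0.
have cdE x : 0 < x -> {for x, continuous (derive1 F)}.
  move=> x0; have := cf x x0; rewrite /prop_for /continuous_at dE//.
  apply: cvg_trans; apply: near_eq_cvg; near=> y.
  by rewrite dE//; near: y; exact: lt_nbhsr.
rewrite (@integration_by_substitution_increasing R F G)//.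
- apply: eq_integral => x; rewrite inE/= in_itv/= => /andP[nx _].
  by rewrite fctE dE//; exact: lt_le_trans nx.
- exact: ltW.
- move=> x y; rewrite !in_itv/= => /andP[nx _] _; apply: Finc.
  exact: lt_le_trans nx.
- move=> x; rewrite in_itv/= => /andP[nx _]; apply: cdE; exact: lt_trans nx.
- apply: cvgP; apply: cvg_at_right_filter; exact: cdE.
- apply: cvgP; apply: cvg_at_left_filter; exact: cdE.
- split.
  + by move=> x; rewrite in_itv/= => /andP[nx _]; have [] := dF x (lt_trans (n0 n) nx).
  + exact/cvg_at_right_filter/cF.
  + exact/cvg_at_left_filter/cF.
- apply: continuous_in_subspaceT => x; rewrite inE/= in_itv/= => /andP[nx _].
  by apply: cG; exact: lt_le_trans (F0 _ _) nx.
Unshelve. all: by end_near. Qed.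

(** The pushforward of c times Lebesgue measure by x |-> c x gives ]a, b] the mass
    b - a, so it is Lebesgue measure. *)
Lemma ge0_integral_half_line_scale c f : 0 < c -> measurable_fun HL f ->
  (forall x, 0 < x -> 0 <= f x) ->
  (\int[mu]_(x in HL) (f x)%:E = c%:E * \int[mu]_(x in HL) (f (c * x)%R)%:E)%E.
Proof.
move=> c0 mf f0.
have mc : measurable_fun setT (fun x : measurableTypeR R => c * x : measurableTypeR R).
  by apply: measurable_funM => //.
pose nu : {measure set (measurableTypeR R) -> \bar R} :=
  mscale (NngNum (ltW c0)) (pushforward mu (fun x : measurableTypeR R => c * x : measurableTypeR R)).
have munu (A : set (measurableTypeR R)) : measurable A -> lebesgue_measure A = nu mc A.
  move=> mA; apply: lebesgue_measure_unique => // _ [[a b] _ <-].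
  rewrite /nu/= /mscale/= /pushforward/=.
  have -> : [eta *%R c] @^-1` `]a, b] = `]a / c, b / c]%classic.
    by apply/seteqP; split => x /=; rewrite !in_itv/= ltr_pdivrMr// ler_pdivlMr// mulrC.
  rewrite /Defs.mu !lebesgue_measure_itv/= !lte_fin ltr_pM2r ?invr_gt0//.
  case: ifPn => _; last by rewrite mule0.
  by rewrite -!EFinB -EFinM; congr EFin; field; rewrite gt_eqF.
rewrite (@eq_measure_integral _ _ _ _ (nu mc)); last first.
  by move=> A mA _; rewrite -munu.
rewrite /nu ge0_integral_mscale//; last 3 first.
- exact: measurable_half_line.
- exact/measurable_EFinP.
- by move=> x; rewrite half_lineE lee_fin; exact: f0.
congr (_ * _)%E.
rewrite ge0_integral_pushforward//; last 3 first.
- exact: measurable_half_line.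
- exact/measurable_EFinP.
- by move=> x; rewrite inE half_lineE lee_fin; exact: f0.
rewrite (_ : _ @^-1` _ = HL)//.
by apply/funext => x; rewrite [LHS](half_lineE (c * x)) half_lineE pmulr_rgt0.
Qed.

Lemma measurable_half_line_scale c f : 0 < c -> measurable_fun HL f ->
  measurable_fun HL (fun x => f (c * x)).
Proof.
move=> c0 mf; apply: (@measurable_comp _ _ _ _ _ _ HL) => //.
- exact: measurable_half_line.
- by move=> _ [x + <-]; rewrite !half_lineE pmulr_rgt0.
Qed.

Lemma integrable_half_line_scale c f : 0 < c -> mu.-integrable HL (EFin \o f) ->
  mu.-integrable HL (EFin \o (fun x => f (c * x))).
Proof.
move=> c0 i_f.
have mf : measurable_fun HL f by apply/measurable_EFinP; exact: measurable_int i_f.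
apply/integrableP; split.
  by apply/measurable_EFinP; exact: measurable_half_line_scale.
have /integrableP[_] := i_f.
have := @ge0_integral_half_line_scale c (fun x => `|f x|) c0.
rewrite /comp/= => ->//; last by apply: measurableT_comp.
by move=> h; rewrite -(@lte_pmul2l _ c%:E)// ?lte_fin// mulry gtr0_sg// mul1e.
Qed.

Lemma Rintegral_half_line_scale c f : 0 < c -> mu.-integrable HL (EFin \o f) ->
  \int[mu]_(x in HL) f x = c * \int[mu]_(x in HL) f (c * x).
Proof.
move=> c0 i_f.
have ge0 g : mu.-integrable HL (EFin \o g) -> (forall x, 0 < x -> 0 <= g x) ->
    \int[mu]_(x in HL) g x = c * \int[mu]_(x in HL) g (c * x).
  move=> ig g0; rewrite /Rintegral (ge0_integral_half_line_scale c0)//.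
    rewrite fineM//; apply: integrable_fin_num => //; last exact: integrable_half_line_scale.
    exact: measurable_half_line.
  by apply/measurable_EFinP; exact: measurable_int ig.
have mf : measurable_fun HL f by apply/measurable_EFinP; exact: measurable_int i_f.
have mH := measurable_half_line.
pose p x := Num.max (f x) 0; pose q x := Num.max (- f x) 0.
have fpq x : f x = p x - q x by rewrite /p /q /Num.max; do 2!case: ifP => ?; lra.
have ip : mu.-integrable HL (EFin \o p).
  apply: (@le_integrable_real _ _ _ mu HL mH _ (fun x => `|f x|)) => [|x _ /=|]; last exact: integrable_norm.
    exact: measurable_maxr.
  by rewrite /p ger0_norm ?le_max ?lexx ?orbT// ge_max ler_norm normr_ge0.
have iq : mu.-integrable HL (EFin \o q).
  apply: (@le_integrable_real _ _ _ mu HL mH _ (fun x => `|f x|)) => [|x _ /=|]; last exact: integrable_norm.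
    by apply: measurable_maxr => //; exact: measurableT_comp.
  by rewrite /q ger0_norm ?le_max ?lexx ?orbT// ge_max -normrN ler_norm normr_ge0.
have -> : f = fun x => p x - q x by exact/funext.
rewrite RintegralB// (ge0 p)// ?(ge0 q)//; last 2 first.
- by move=> x _; rewrite le_max lexx orbT.
- by move=> x _; rewrite le_max lexx orbT.
by rewrite RintegralB ?mulrBr//; exact: integrable_half_line_scale.
Qed.

End half_line_substitution.

(** * Rules of differentiation *)

Section derivative_rules.
Implicit Types (f g : R -> R) (a b c p x y : R).

(** Derivatives are computed by composing the rules below; the value that they
    produce is brought into the desired form only at the end. *)
Lemma der_eq f a b x : is_derive x 1 f a -> a = b -> is_derive x 1 f b.
Proof. by move=> ? <-. Qed.

Lemma der_cst c x : is_derive x 1 (fun=> c) 0.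
Proof. exact: is_derive_cst. Qed.

Lemma der_id x : is_derive x 1 (fun y : R => y) 1.
Proof. exact: is_derive_id. Qed.

Lemma derD f g a b x : is_derive x 1 f a -> is_derive x 1 g b ->
  is_derive x 1 (fun y => f y + g y) (a + b).
Proof. exact: is_deriveD. Qed.

Lemma derN f a x : is_derive x 1 f a -> is_derive x 1 (fun y => - f y) (- a).
Proof. exact: is_deriveN. Qed.

Lemma derB f g a b x : is_derive x 1 f a -> is_derive x 1 g b ->
  is_derive x 1 (fun y => f y - g y) (a - b).
Proof. exact: is_deriveB. Qed.

Lemma derM f g a b x : is_derive x 1 f a -> is_derive x 1 g b ->
  is_derive x 1 (fun y => f y * g y) (a * g x + f x * b).
Proof.
move=> df dg; apply: (der_eq (is_deriveM df dg)).
by rewrite /GRing.scale/= addrC (mulrC (g x)).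
Qed.

Lemma derZ f a c x : is_derive x 1 f a -> is_derive x 1 (fun y => c * f y) (c * a).
Proof.
by move=> df; apply: (der_eq (derM (der_cst c x) df)); rewrite mul0r add0r.
Qed.

Lemma der_comp f g a b x : is_derive (g x) 1 f a -> is_derive x 1 g b ->
  is_derive x 1 (fun y => f (g y)) (a * b).
Proof. by move=> df dg; have := is_derive1_comp df dg; rewrite mulrC. Qed.

Lemma der_exp f a x : is_derive x 1 f a ->
  is_derive x 1 (fun y => expR (f y)) (expR (f x) * a).
Proof. by move=> df; apply: (der_comp (is_derive_expR _) df). Qed.

Lemma der_powR f a p x : 0 < f x -> is_derive x 1 f a ->
  is_derive x 1 (fun y => f y `^ p) (p * f x `^ (p - 1) * a).
Proof. by move=> f0 df; apply: (der_comp (is_derive1_powR p f0) df). Qed.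

Lemma der_inv f a x : f x != 0 -> is_derive x 1 f a ->
  is_derive x 1 (fun y => (f y)^-1) (- a / f x ^+ 2).
Proof.
move=> f0 df; apply: (der_eq (is_deriveV f0 df)).
by rewrite /GRing.scale/= mulrC mulNr mulrN.
Qed.

Lemma der_sqr f a x : is_derive x 1 f a ->
  is_derive x 1 (fun y => f y ^+ 2) (2 * f x * a).
Proof. by move=> df; apply: (der_eq (derM df df)); ring. Qed.

Lemma der_near f g a x : is_derive x 1 f a -> (\forall y \near x, f y = g y) ->
  is_derive x 1 g a.
Proof. by move=> df fg; apply: near_eq_is_derive fg df; rewrite oner_eq0. Qed.

Lemma der_continuous f a x : is_derive x 1 f a -> {for x, continuous f}.
Proof.
by move=> [df _]; apply: differentiable_continuous; exact/derivable1_diffP.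
Qed.

Lemma der_derive1 f a x : is_derive x 1 f a -> derive1 f x = a.
Proof. by move=> [_ <-]; rewrite derive1E. Qed.

Lemma derivable_der f x : derivable f x 1 -> is_derive x 1 f (derive1 f x).
Proof. by move=> df; apply: DeriveDef => //; rewrite derive1E. Qed.

End derivative_rules.

(** * Powers times Gaussians, and the Gamma function *)

Section power_gaussians.
Implicit Types (f g h F G : R -> R) (a b c p q s x y : R).

Definition power_gaussian p b x : R := x `^ p * expR (- (b * x ^+ 2)).
Local Notation pg := power_gaussian.

Lemma power_gaussian_ge0 p b x : 0 <= pg p b x.
Proof. by rewrite mulr_ge0 ?powR_ge0// expR_ge0. Qed.

Lemma power_gaussian_gt0 p b x : 0 < x -> 0 < pg p b x.
Proof. by move=> x0; rewrite mulr_gt0 ?powR_gt0// expR_gt0. Qed.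

Lemma powRD_gt0 x p q : 0 < x -> x `^ (p + q) = x `^ p * x `^ q.
Proof. by move=> x0; rewrite powRD//; apply/implyP => _; rewrite gt_eqF. Qed.

Lemma power_gaussianM p q b c x : 0 < x ->
  pg p b x * pg q c x = pg (p + q) (b + c) x.
Proof.
by move=> x0; rewrite /pg powRD_gt0// mulrACA -expRD -opprD -mulrDl.
Qed.

Lemma power_gaussianX p n b x : 0 < x ->
  x ^+ n * pg p b x = pg (p + n%:R) b x.
Proof.
by move=> x0; rewrite /pg powRD_gt0// powR_mulrn 1?ltW// mulrA (mulrC (x ^+ n)).
Qed.

Lemma is_derive_power_gaussian p b x : 0 < x ->
  is_derive x 1 (pg p b) (p * pg (p - 1) b x - 2 * b * pg (p + 1) b x).
Proof.
move=> x0.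
apply: (der_eq (derM (der_powR p x0 (der_id x))
  (der_exp (derN (derZ b (der_sqr (der_id x))))))).
by rewrite /pg (powRD_gt0 p 1 x0) powRr1 ?ltW//; ring.
Qed.

Lemma continuous_power_gaussian p b x : 0 < x -> {for x, continuous (pg p b)}.
Proof.
by move=> x0; exact: der_continuous (is_derive_power_gaussian p b x0).
Qed.

Lemma measurable_power_gaussian p b : measurable_fun HL (pg p b).
Proof.
by apply: half_line_continuous_measurable => x; exact: continuous_power_gaussian.
Qed.

(** Because 1 + x <= exp x; it remains to complete the square in q x - b x^2. *)
Lemma powR1D_gaussian_bounded q b : 0 <= q -> 0 < b ->
  exists2 K, 0 < K & forall x, 0 < x -> (1 + x) `^ q * expR (- (b * x ^+ 2)) <= K.
Proof.
move=> q0 b0; exists (expR (q ^+ 2 / (4 * b))); first exact: expR_gt0.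
move=> x x0.
have x1 : 0 <= 1 + x by rewrite addr_ge0 ?ltW.
apply: (@le_trans _ _ (expR (q * x) * expR (- (b * x ^+ 2)))).
  rewrite ler_wpM2r ?expR_ge0//.
  rewrite (_ : expR (q * x) = expR x `^ q); last by rewrite -expRM mulrC.
  by rewrite ge0_ler_powR ?nnegrE ?expR_ge0// expR_ge1Dx.
rewrite -expRD ler_expR -subr_ge0.
rewrite (_ : _ - _ = (q / 2 - b * x) ^+ 2 / b).
  by rewrite divr_ge0 ?sqr_ge0 ?ltW.
by field; rewrite gt_eqF.
Qed.

Lemma power_gaussian_bounded q b : 0 <= q -> 0 < b ->
  exists2 K, 0 < K & forall x, 0 < x -> pg q b x <= K.
Proof.
move=> q0 b0; have [K K0 HK] := powR1D_gaussian_bounded q0 b0.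
exists K => // x x0; apply: le_trans (HK x x0).
rewrite ler_wpM2r ?expR_ge0// ge0_ler_powR ?nnegrE ?(ltW x0)//.
  by rewrite addr_ge0 ?(ltW x0).
by rewrite lerDr.
Qed.

(** x^p (1 + x)^(-p - 2) has the bounded primitive (x / (1 + x))^(p + 1) / (p + 1). *)
Lemma integrable_power_gaussian p b : -1 < p -> 0 < b ->
  mu.-integrable HL (EFin \o pg p b).
Proof.
move=> p1 b0.
have p10 : 0 < p + 1 by lra.
have p20 : 0 <= p + 2 by lra.
have [K K0 HK] := powR1D_gaussian_bounded p20 b0.
pose r x : R := x / (1 + x).
have r0 x : 0 < x -> 0 < r x by move=> x0; rewrite divr_gt0// addr_gt0.
pose f x : R := K * ((p + 1) * r x `^ p * (1 + x) ^- 2).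
have dr x : 0 < x -> is_derive x 1 r ((1 + x) ^- 2).
  move=> x0; have x1 : 1 + x != 0 by rewrite gt_eqF// addr_gt0.
  apply: (der_eq (derM (der_id x) (der_inv x1 (derD (der_cst 1 x) (der_id x))))).
  by field.
have dF x : 0 < x -> is_derive x 1 (fun y => K * r y `^ (p + 1)) (f x).
  move=> x0; apply: (der_eq (derZ K (der_powR _ (r0 x x0) (dr x x0)))).
  by rewrite addrK.
have cf x : 0 < x -> {for x, continuous f}.
  move=> x0; have x1 : 1 + x != 0 by rewrite gt_eqF// addr_gt0.
  have x12 : (1 + x) ^+ 2 != 0 by rewrite expf_neq0.
  apply: der_continuous (derZ K (derM (derZ (p + 1)
    (der_powR p (r0 x x0) (dr x x0))) (@der_inv (fun y => (1 + y) ^+ 2) _ _ x12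
    (der_sqr (derD (der_cst 1 x) (der_id x)))))).
have i_f : mu.-integrable HL (EFin \o f).
  apply: (integrable_bounded_primitive _ dF cf (M := K)).
    move=> x x0; rewrite /f !mulr_ge0 ?powR_ge0 ?invr_ge0 ?exprn_ge0 ?ltW//.
    by rewrite addr_gt0.
  move=> x x0; rewrite mulr_ge0 ?powR_ge0 ?(ltW K0)//= -[leRHS]mulr1 ler_pM2l//.
  rewrite -[leRHS](congr1 (@^~ (p + 1)) (@powR1 R)) ge0_ler_powR ?nnegrE ?(ltW p10) ?(ltW (r0 x x0))//.
  by rewrite /r ler_pdivrMr ?addr_gt0// mul1r lerDr.
apply: (@le_integrable_real _ _ _ mu HL mH _ (fun x => (p + 1)^-1 * f x)).
- exact: measurable_power_gaussian.
- move=> x; rewrite half_lineE => x0; rewrite ger0_norm ?power_gaussian_ge0//.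
  have x1 : 0 < 1 + x by rewrite addr_gt0.
  apply: (@le_trans _ _ (r x `^ p * (1 + x) ^- 2 * K)); last first.
    rewrite /f (_ : (p + 1)^-1 * _ = r x `^ p * (1 + x) ^- 2 * K)//.
    by field; rewrite !gt_eqF.
  apply: le_trans (ler_wpM2l _ (HK x x0)); last first.
    by rewrite mulr_ge0 ?powR_ge0// invr_ge0 exprn_ge0// ltW.
  rewrite [leRHS]mulrA /pg ler_wpM2r ?expR_ge0//; apply: eq_imp_le.
  rewrite -{1}(@divfK _ (1 + x) _ x) ?gt_eqF// powRM ?(ltW (r0 _ _)) ?(ltW x1)//.
  rewrite -/(r x) powRD_gt0// powR_mulrn ?(ltW x1)//; field; rewrite gt_eqF//.
- exact: (integrableZl mH _ i_f).
Qed.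

Lemma sqint_power_gaussian p b : - 2^-1 < p -> 0 < b -> sqint (pg p b).
Proof.
move=> p0 b0; split; first exact: measurable_power_gaussian.
apply: eq_integrable (@integrable_power_gaussian (p + p) (b + b) _ _) => //.
- exact: mH.
- by move=> x; rewrite inE half_lineE => x0 /=; rewrite -power_gaussianM// expr2.
- lra.
- by rewrite addr_gt0.
Qed.

Lemma integrableZl_real c f : mu.-integrable HL (EFin \o f) ->
  mu.-integrable HL (EFin \o (fun x => c * f x)).
Proof.
by move=> i_f; apply: (@eq_integrable _ _ _ _ _ mH _ _ _ (integrableZl mH c i_f)).
Qed.

Lemma eq_integrable_half_line f g : (forall x, 0 < x -> f x = g x) ->
  mu.-integrable HL (EFin \o f) -> mu.-integrable HL (EFin \o g).
Proof.
move=> fg; apply: (eq_integrable mH) => x; rewrite inE half_lineE => x0.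
by rewrite /= fg.
Qed.

Definition moment p b : R := \int[mu]_(x in HL) pg p b x.

(** Integrate the derivative of x^(p + 1) exp (- b x^2) over the half-line. *)
Lemma moment_recursion p b : -1 < p -> 0 < b ->
  moment (p + 2) b = (p + 1) / (2 * b) * moment p b.
Proof.
move=> p1 b0.
have p10 : 0 < p + 1 by lra.
have p2 : -1 < p + 2 by lra.
have ip := integrable_power_gaussian p1 b0.
have ip2 := integrable_power_gaussian p2 b0.
suff : \int[mu]_(x in HL) ((p + 1) * pg p b x - (2 * b) * pg (p + 2) b x) = 0.
  rewrite RintegralB//; [|exact: mH|exact: integrableZl_real|exact: integrableZl_real].
  rewrite !RintegralZl//; try exact: mH.
  rewrite -!/(moment _ _) => /eqP; rewrite subr_eq0 => /eqP e.
  have b2 : 2 * b != 0 by rewrite mulf_neq0// gt_eqF.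
  by apply: (mulfI b2); rewrite -e; field; rewrite gt_eqF.
apply: (@Rintegral_half_line_derive0 (pg (p + 1) b)).
- exact: (integrableB mH (integrableZl_real (p + 1) ip)
    (integrableZl_real (2 * b) ip2)).
- move=> x x0; apply: (der_eq (is_derive_power_gaussian (p + 1) b x0)).
  by rewrite addrK -addrA.
- by move=> x x0; apply: continuousB; apply: continuousM;
    (exact: cvg_cst || exact: continuous_power_gaussian).
- rewrite -[X in _ --> X](subr0 0); apply: cvgB.
    have q0 : 0 <= p + 1 + 1 by lra.
    have [K K0 HK] := power_gaussian_bounded q0 b0.
    have lim : (fun n => K * n.+1%:R^-1) @ \oo --> (0 : R).
      by rewrite -[X in _ --> X](mulr0 K); apply: cvgM; [exact: cvg_cst|exact: cvg_harmonic].
    apply: (squeeze_cvgr _ (cvg_cst _) lim); apply: nearW => n.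
    rewrite power_gaussian_ge0/= ler_pdivlMr// mulrC -[X in X * _]expr1.
    by rewrite power_gaussianX// HK.
  have lim : (fun n => n.+1%:R^-1 `^ (p + 1)) @ \oo --> (0 : R).
    have /cvg_at_rightP := powR_cvg0 p10.
    by apply; split; [move=> n; rewrite invr_gt0|exact: cvg_harmonic].
  apply: (squeeze_cvgr _ (cvg_cst _) lim); apply: nearW => n.
  rewrite power_gaussian_ge0/= -[leRHS]mulr1 ler_wpM2l ?powR_ge0//.
  by rewrite -[leRHS]expR0 ler_expR oppr_le0 mulr_ge0 ?sqr_ge0// ltW.
Qed.

(** The substitution t = b x^2. *)
Lemma integral_Gamma_subst s b : 0 < s -> 0 < b ->
  (\int[mu]_(t in HL) (t `^ (s - 1) * expR (- t))%:E =
   \int[mu]_(x in HL) (2 * b `^ s * pg (2 * s - 1) b x)%:E)%E.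
Proof.
move=> s0 b0.
have cG x : 0 < x -> {for x, continuous (fun t : R => t `^ (s - 1) * expR (- t))}.
  by move=> x0; apply: der_continuous (derM (der_powR _ x0 (der_id x)) (der_exp (derN (der_id x)))).
have dF x : 0 < x -> is_derive x 1 (fun y : R => b * y ^+ 2) (2 * b * x).
  by move=> _; apply: (der_eq (derZ b (der_sqr (der_id x)))); ring.
have cf x : 0 < x -> {for x, continuous (fun x : R => 2 * b * x)}.
  by move=> _; apply: der_continuous (derZ _ (der_id x)).
rewrite (ge0_integral_half_line_subst _ _ dF cf _ _ _ cG).
- apply: eq_integral => x; rewrite inE half_lineE => x0; congr EFin.
  rewrite powRM ?sqr_ge0 ?(ltW b0)// /pg -(@powR_mulrn _ x 2) ?(ltW x0)// -powRrM.
  have -> : b `^ s = b `^ (s - 1) * b by rewrite -{3}(powRr1 (ltW b0)) -powRD_gt0// subrK.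
  have -> : 2 * s - 1 = 2%:R * (s - 1) + 1 by ring.
  rewrite powR_mulrn ?(ltW x0)//.
  by rewrite (powRD_gt0 _ 1 x0) powRr1 ?(ltW x0)//; ring.
- by move=> x x0; rewrite mulr_gt0// exprn_gt0.
- by move=> x y x0 xy; rewrite ltr_pM2l// ltrXn2r ?(ltW x0).
- by move=> x x0; rewrite !mulr_ge0 ?ltW.
- move=> y y0; exists (Num.sqrt (y / b)); first by rewrite sqrtr_gt0 divr_gt0.
  have e : Num.sqrt (y / b) ^+ 2 = y / b by rewrite sqr_sqrtr// divr_ge0 ?ltW.
  by rewrite e mulrC divfK ?gt_eqF.
- move=> y; exists (Num.sqrt ((`|y| + 1) / b)).
    by rewrite sqrtr_gt0 divr_gt0// ltr_wpDl.
  rewrite sqr_sqrtr ?divr_ge0 ?addr_ge0 ?(ltW b0)// mulrC divfK ?gt_eqF//.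
  by rewrite (le_trans (ler_norm _))// lerDl.
- by move=> x x0; rewrite mulr_ge0 ?powR_ge0 ?expR_ge0.
Qed.

Lemma Gamma_moment s b : 0 < s -> 0 < b ->
  Gamma s = 2 * b `^ s * moment (2 * s - 1) b.
Proof.
move=> s0 b0.
rewrite /Gamma /moment -RintegralZl; last 2 first.
- exact: mH.
- by apply: integrable_power_gaussian => //; lra.
by congr fine; exact: integral_Gamma_subst.
Qed.

(** Already the interval [1, 2] contributes this much, whatever the exponent.
    This bounds the coefficients of the Bessel series. *)
Lemma Gamma_lower_bound s : 0 < s -> expR (-2) / 2 <= Gamma s.
Proof.
move=> s0.
have s1 : -1 < 2 * s - 1 by lra.
have /integrableP[_] := integrableZl_real (2 * 1 `^ s) (integrable_power_gaussian s1 ltr01).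
rewrite (_ : (\int[mu]_(x in HL) _)%E =
    (\int[mu]_(t in HL) (t `^ (s - 1) * expR (- t))%:E)%E); last first.
  rewrite (integral_Gamma_subst s0 ltr01); apply: eq_integral => x _ /=.
  by rewrite ger0_norm// !mulr_ge0 ?powR_ge0 ?expR_ge0.
move=> fin.
rewrite -lee_fin /Gamma fineK; last first.
  by rewrite ge0_fin_numE//; apply: integral_ge0 => x _; rewrite lee_fin mulr_ge0 ?powR_ge0 ?expR_ge0.
apply: (@le_trans _ _ (\int[mu]_(t in `[1%R, 2%R]) (t `^ (s - 1) * expR (- t))%:E)%E); last first.
  apply: ge0_subset_integral.
  - exact: measurable_itv.
  - exact: mH.
  - apply/measurable_EFinP; apply: half_line_continuous_measurable => x x0.
    exact: der_continuous (derM (der_powR _ x0 (der_id x)) (der_exp (derN (der_id x)))).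
  - by move=> x _; rewrite lee_fin mulr_ge0 ?powR_ge0 ?expR_ge0.
  - by move=> x; rewrite half_lineE/= in_itv/= => /andP[x1 _]; exact: lt_le_trans x1.
apply: (@le_trans _ _ (\int[mu]_(t in `[1%R, 2%R]) (expR (-2) / 2)%:E)%E).
  rewrite integral_cst/=; last exact: measurable_itv.
  rewrite /Defs.mu lebesgue_measure_itv/= lte_fin ltr1n/= -EFinB -EFinM lee_fin.
  by rewrite (_ : 2 - 1 = 1 :> R) ?mulr1//; ring.
apply: ge0_le_integral => //.
- apply/measurable_EFinP; apply: (@measurable_funS _ _ _ _ HL).
  + exact: mH.
  + by move=> x; rewrite half_lineE/= in_itv/= => /andP[x1 _]; exact: lt_le_trans x1.
  + apply: half_line_continuous_measurable => x x0.
    exact: der_continuous (derM (der_powR _ x0 (der_id x)) (der_exp (derN (der_id x)))).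
move=> x /=; rewrite in_itv/= => /andP[x1 x2]; rewrite lee_fin mulrC.
have x0 : 0 < x by exact: lt_le_trans x1.
rewrite ler_pM ?expR_ge0 ?invr_ge0// ?ler_expR ?lerN2//.
apply: (@le_trans _ _ (x `^ (-1))).
  by rewrite powR_inv1 ?(ltW x0)// lef_pV2 ?posrE.
by apply: ler_powR => //; lra.
Qed.

End power_gaussians.

Local Notation pg := power_gaussian.

(** * Functions orthogonal to all Gaussians *)

Section gaussian_completeness.
Implicit Types (f g h w : R -> R) (a b c p q s t x y : R).

Lemma bernoulli_ge q n : 0 <= q <= 1 -> 1 - n%:R * q <= (1 - q) ^+ n.
Proof.
move=> /andP[q0 q1]; elim: n => [|n ih]; first by rewrite mul0r subr0 expr0.
rewrite exprS.
apply: (le_trans _ (ler_wpM2l _ ih)); last by rewrite subr_ge0.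
rewrite -natr1; have n0 : 0 <= n%:R :> R by []; nra.
Qed.

Lemma gaussian_power_le1 t x : 0 <= t -> 0 <= expR (- (t * x ^+ 2)) <= 1.
Proof.
by move=> t0; rewrite expR_ge0 -[leRHS]expR0 ler_expR oppr_le0 mulr_ge0 ?sqr_ge0.
Qed.

(** 1 - (1 - q^n)^(2^n) with q = exp (- s x^2) is a combination of Gaussians which
    converges to the indicator of q > 1/2. *)
Lemma cvg_gaussian_step s x : 0 < s ->
  (fun n => 1 - (1 - expR (- ((n%:R * s) * x ^+ 2))) ^+ (2 ^ n)) @ \oo -->
  (if x ^+ 2 < ln 2 / s then 1 else 0 : R) \/ x ^+ 2 = ln 2 / s.
Proof.
move=> s0.
have [->|ne] := eqVneq (x ^+ 2) (ln 2 / s); first by right.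
left.
pose E := expR (- (s * x ^+ 2)).
have En n : expR (- ((n%:R * s) * x ^+ 2)) = E ^+ n.
  by rewrite -expRM_natl; congr expR; ring.
have E01 : 0 <= E <= 1 by apply: gaussian_power_le1; exact: ltW.
have En01 n : 0 <= E ^+ n <= 1.
  by case/andP: E01 => e0 e1; rewrite exprn_ge0//= exprn_ile1.
rewrite (_ : (fun n => _) = fun n => 1 - (1 - E ^+ n) ^+ (2 ^ n)); last first.
  by apply/funext => n; rewrite En.
have pos2 n : 0 < (2 ^ n)%:R :> R by rewrite ltr0n expn_gt0.
case: ifPn => lt.
- have E2 : 1 < 2 * E.
    have -> : 2 = expR (ln 2) :> R by rewrite lnK ?posrE.
    by rewrite /E -expRD expR_gt1 subr_gt0 mulrC -ltr_pdivlMr.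
  rewrite -[X in _ --> X](subr0 1); apply: cvgB; first exact: cvg_cst.
  have lim : (fun n => ((2 * E) ^+ n)^-1) @ \oo --> (0 : R).
    rewrite (_ : (fun n => _) = fun n => (2 * E)^-1 ^+ n).
      have E20 : 0 < 2 * E by exact: lt_trans E2.
      by apply: cvg_expr; rewrite ger0_norm ?invr_ge0 ?(ltW E20)// invf_lt1.
    by apply/funext => n; rewrite exprVn.
  apply: (squeeze_cvgr _ (cvg_cst _) lim); apply: nearW => n.
  have /andP[e0 e1] := En01 n.
  rewrite exprn_ge0 ?subr_ge0//=.
  apply: (@le_trans _ _ (expR (- E ^+ n) ^+ (2 ^ n))).
    by rewrite lerXn2r ?nnegrE ?subr_ge0 ?expR_ge0// expR_ge1Dx.
  rewrite -expRM_natl mulrN expRN natrX -exprMn lef_pV2 ?posrE ?expR_gt0//.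
    by apply: le_trans (expR_ge1Dx _); rewrite lerDr.
  by rewrite exprn_gt0// (lt_trans _ E2).
- have E2 : 2 * E < 1.
    have -> : 2 = expR (ln 2) :> R by rewrite lnK ?posrE.
    rewrite /E -expRD expR_lt1 subr_lt0 mulrC -ltr_pdivrMr//.
    by rewrite lt_neqAle eq_sym ne/= leNgt.
  have lim : (fun n => (2 * E) ^+ n) @ \oo --> (0 : R).
    by apply: cvg_expr; rewrite ger0_norm// mulr_ge0// (andP E01).1.
  apply: (squeeze_cvgr _ (cvg_cst _) lim); apply: nearW => n.
  have /andP[e0 e1] := En01 n.
  rewrite subr_ge0 exprn_ile1 ?subr_ge0// ?lerBlDr ?lerDl//=.
  by have := bernoulli_ge (2 ^ n) (En01 n); rewrite natrX -exprMn; lra.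
Qed.

Lemma gaussian_step_bounds s x n : 0 < s ->
  `|1 - (1 - expR (- ((n%:R * s) * x ^+ 2))) ^+ (2 ^ n)| <= 1.
Proof.
move=> s0; have n0 : 0 <= n%:R * s by rewrite mulr_ge0// ltW.
have /andP[e0 e1] := gaussian_power_le1 x n0.
rewrite ger0_norm; first by rewrite lerBlDr lerDl exprn_ge0// subr_ge0.
by rewrite subr_ge0 exprn_ile1 ?subr_ge0// lerBlDr lerDl.
Qed.

Lemma integrable_mul_bounded w f : mu.-integrable HL (EFin \o w) ->
  measurable_fun HL f -> (forall x, 0 < x -> `|f x| <= 1) ->
  mu.-integrable HL (EFin \o (fun x => w x * f x)).
Proof.
move=> iw mf f1.
apply: (@le_integrable_real _ _ _ mu HL mH _ (fun x => `|w x|)).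
- apply: measurable_funM => //; apply/measurable_EFinP; exact: measurable_int iw.
- by move=> x; rewrite half_lineE => x0; rewrite normrM ler_piMr// f1.
- exact: integrable_norm.
Qed.

Lemma measurable_gaussian_factor t : measurable_fun HL (fun x => expR (- (t * x ^+ 2))).
Proof.
apply: half_line_continuous_measurable => x _.
exact: der_continuous (der_exp (derN (derZ t (der_sqr (der_id x))))).
Qed.

(** The combinations of Gaussians in [cvg_gaussian_step] stay bounded by 1 and
    converge to the indicator of an interval ]0, y], so w has integral 0
    over each of these intervals. *)
Lemma gaussian_moments_eq0 w : mu.-integrable HL (EFin \o w) ->
  (forall s, 0 <= s -> \int[mu]_(x in HL) (w x * expR (- (s * x ^+ 2))) = 0) ->
  ae_eq mu HL w (cst 0).
Proof.
move=> iw w0.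
have mw : measurable_fun HL w by apply/measurable_EFinP; exact: measurable_int iw.
have ig t f : 0 <= t -> mu.-integrable HL (EFin \o f) ->
    mu.-integrable HL (EFin \o (fun x => f x * expR (- (t * x ^+ 2)))).
  move=> t0 i_f; apply: integrable_mul_bounded => //.
    exact: measurable_gaussian_factor.
  move=> x _; have /andP[e0 e1] := gaussian_power_le1 x t0.
  by rewrite ger0_norm.
have mstep r N : measurable_fun HL (fun x => (1 - expR (- (r * x ^+ 2))) ^+ N).
  apply: measurable_funX; apply: measurable_funB; first exact: measurable_cst.
  exact: measurable_gaussian_factor.
have step_le1 r N x : 0 <= r -> `|(1 - expR (- (r * x ^+ 2))) ^+ N| <= 1.
  move=> r0; have /andP[e0 e1] := gaussian_power_le1 x r0.
  by rewrite ger0_norm ?exprn_ge0 ?exprn_ile1 ?subr_ge0// lerBlDr lerDl.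
have poly0 r N : 0 <= r -> forall t, 0 <= t ->
    \int[mu]_(x in HL) (w x * (1 - expR (- (r * x ^+ 2))) ^+ N * expR (- (t * x ^+ 2))) = 0.
  move=> r0; elim: N => [|N ih] t t0.
    rewrite -[RHS](w0 t t0); apply: eq_Rintegral => x _; rewrite expr0 mulr1//.
  rewrite -[RHS](subr0 0) -{1}(ih t t0) -(ih (r + t)) ?addr_ge0//.
  have iwN := integrable_mul_bounded iw (mstep r N) (fun x _ => step_le1 r N x r0).
  rewrite -RintegralB; [|exact: mH|exact: ig|by apply: ig => //; rewrite addr_ge0].
  apply: eq_Rintegral => x _.
  by rewrite mulrDl opprD expRD exprS; ring.
apply: ae_eq0_primitive => // [y|y y0].
  apply: integrableS iw => //; first exact: mH.
  by move=> x; rewrite half_lineE/= in_itv/= => /andP[].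
have l2 : 0 < ln 2 :> R by rewrite ln_gt0// ltr1n.
pose s := ln 2 / y ^+ 2.
have s0 : 0 < s by rewrite divr_gt0// exprn_gt0.
pose u n x := 1 - (1 - expR (- ((n%:R * s) * x ^+ 2))) ^+ (2 ^ n).
have u0 n : \int[mu]_(x in HL) (w x * u n x) = 0.
  have r0 : 0 <= n%:R * s by rewrite mulr_ge0// ltW.
  transitivity (\int[mu]_(x in HL) (w x * expR (- (0 * x ^+ 2)) -
      w x * (1 - expR (- ((n%:R * s) * x ^+ 2))) ^+ (2 ^ n) * expR (- (0 * x ^+ 2)))).
    by apply: eq_Rintegral => x _; rewrite /u mul0r oppr0 expR0; ring.
  rewrite RintegralB; [|exact: mH|exact: ig|apply: ig => //].
    by rewrite w0// poly0// subr0.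
  by apply: integrable_mul_bounded => // x _; exact: step_le1.
have : (fun n => \int[mu]_(x in HL) (w x * u n x)) @ \oo -->
    \int[mu]_(x in HL) (w \_ `]0, y]) x.
  apply: (@Rintegral_dominated _ _ _ mu HL mH _ _ (fun x => `|w x|)).
  - move=> n; apply: measurable_funM => //; apply: measurable_funB => //.
    exact: mstep.
  - apply/measurable_restrict => //; first exact: mH.
    by apply: measurable_funS mw; [exact: mH|move=> x []].
  - exact: integrable_norm.
  - by move=> n x _; rewrite normrM ler_piMr// gaussian_step_bounds.
  - exists [set y]; split; [exact: measurable_set1|exact: lebesgue_measure_set1|].
    move=> x /= nx; apply: contrapT => xy; apply: nx; rewrite half_lineE => x0.
    have e2 : ln 2 / s = y ^+ 2 by rewrite /s invf_div mulrC divfK// gt_eqF.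
    have [lim|] := cvg_gaussian_step x s0; last first.
      rewrite e2 => /eqP; rewrite eqrXn2 ?(ltW x0) ?(ltW y0)// => /eqP ?.
      by exfalso; exact: xy.
    rewrite (_ : (w \_ _) x = w x * (if x ^+ 2 < ln 2 / s then 1 else 0)).
      by apply: cvgM => //; exact: cvg_cst.
    rewrite e2 ltr_pXn2r ?nnegrE ?(ltW x0) ?(ltW y0)// patchE.
    rewrite mem_setE/= in_itv/= x0/= le_eqVlt.
    have /eqP/negbTE -> : x <> y by [].
    by rewrite orFb; case: ifPn => _; rewrite ?mulr1 ?mulr0.
rewrite (_ : (fun n => _) = cst 0); last exact/funext.
move=> /cvg_lim; rewrite lim_cst// => /(_ (@Rhausdorff R)) h.
rewrite [RHS]h -Rintegral_mkcondr setIidr//.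
by move=> x; rewrite half_lineE/= in_itv/= => /andP[].
Qed.

(** Exponents from b0 on suffice, since b0 can be absorbed into the function. *)
Lemma power_gaussian_moments_eq0 p b0 h : measurable_fun HL h ->
  mu.-integrable HL (EFin \o (fun x => pg p b0 x * h x)) ->
  (forall b, b0 <= b -> \int[mu]_(x in HL) (pg p b x * h x) = 0) ->
  ae_eq mu HL h (cst 0).
Proof.
move=> mh ih h0; have := gaussian_moments_eq0 ih.
have H s : 0 <= s -> \int[mu]_(x in HL) (pg p b0 x * h x * expR (- (s * x ^+ 2))) = 0.
  move=> s0; rewrite -[RHS](h0 (b0 + s)) ?lerDl//.
  by apply: eq_Rintegral => x _; rewrite /pg mulrDl opprD expRD; ring.
move=> /(_ H); apply: filterS => x Hx x0; have := Hx x0.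
move: x0; rewrite half_lineE => x0 /eqP; rewrite mulf_eq0 gt_eqF ?power_gaussian_gt0//=.
by move=> /eqP.
Qed.

End gaussian_completeness.

(** * The transform determined by Gaussians *)

Section order.
Variable m : R.
Hypothesis hm : -1 < m.

Section gaussian_transform.
Implicit Types (f g h s t : R -> R) (u v : nat -> R -> R) (a b c p q x y : R).

Definition gauss a : R -> R := pg (2^-1 + m) (a / 2).

(** The Hankel transform of [gauss a] in closed form. *)
Definition gauss_hat a : R -> R := a `^ (- (m + 1)) *: gauss a^-1.

(** The graph of the transform, defined by duality with the Gaussians so that it
    is closed and functional from the start. *)
Definition weak_hankel f g :=
  [/\ sqint f, sqint g & forall a, 0 < a -> ip (gauss_hat a) f = ip (gauss a) g].

Lemma sqint_gauss a : 0 < a -> sqint (gauss a).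
Proof.
by move=> a0; apply: sqint_power_gaussian; rewrite ?divr_gt0//; move: hm; lra.
Qed.

Lemma sqint_gauss_hat a : 0 < a -> sqint (gauss_hat a).
Proof. by move=> a0; apply: (sqintZ mH); apply: sqint_gauss; rewrite invr_gt0. Qed.

(** Meant for h not known to be square integrable, whose pairings with Gaussians
    converge only for large parameters. *)
Lemma gauss_eq0 h : measurable_fun HL h -> forall a0,
  mu.-integrable HL (EFin \o (fun x => gauss a0 x * h x)) ->
  (forall a, a0 <= a -> ip (gauss a) h = 0) -> ae_eq mu HL h (cst 0).
Proof.
move=> mh a0 ih h0.
apply: (power_gaussian_moments_eq0 mh ih) => b ab.
have := h0 (2 * b); rewrite /ip /gauss (_ : 2 * b / 2 = b); last by field.
by apply; lra.
Qed.

Lemma sqint_gauss_eq0 h : sqint h ->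
  (forall a, 0 < a -> ip (gauss a) h = 0) -> ae_eq mu HL h (cst 0).
Proof.
move=> sh h0; apply: (@gauss_eq0 h (sqint_meas sh) 1).
  exact: (sqint_mul mH (sqint_gauss ltr01) sh).
by move=> a a1; apply: h0; exact: lt_le_trans a1.
Qed.

Lemma sqint_gauss_inj f g : sqint f -> sqint g ->
  (forall a, 0 < a -> ip (gauss a) f = ip (gauss a) g) -> ae_eq mu HL f g.
Proof.
move=> sf sg fg.
have : ae_eq mu HL (f - g) (cst 0).
  apply: sqint_gauss_eq0 => [|a a0]; first exact: (sqintB mH).
  by rewrite (ipBr mH) ?fg ?subrr//; exact: sqint_gauss.
by apply: filterS => x /[apply] /eqP; rewrite !fctE subr_eq0 => /eqP.
Qed.

Lemma m1_gt0 : 0 < m + 1. Proof. by move: hm; lra. Qed.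

Lemma momentE b : 0 < b ->
  moment (2 * m + 1) b = Gamma (m + 1) / 2 * b `^ (- (m + 1)).
Proof.
move=> b0; rewrite (Gamma_moment m1_gt0 b0) powRN.
rewrite (_ : 2 * (m + 1) - 1 = 2 * m + 1); last by ring.
have : b `^ (m + 1) != 0 by rewrite gt_eqF// powR_gt0.
by move=> ?; field.
Qed.

Lemma ip_gauss a b : ip (gauss a) (gauss b) = moment (2 * m + 1) ((a + b) / 2).
Proof.
apply: eq_Rintegral => x; rewrite inE half_lineE => x0.
by rewrite /gauss power_gaussianM//; congr (pg _ _ x); field.
Qed.

Lemma gauss_hatK a : 0 < a -> gauss a = a `^ (- (m + 1)) *: gauss_hat a^-1.
Proof.
move=> a0; rewrite /gauss_hat invrK scalerA -powRM ?invr_ge0 ?ltW//.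
by rewrite divff ?gt_eqF// powR1 scale1r.
Qed.

(** The pairing of [gauss_hat a] with [gauss b] is a constant times a^-(m + 1)
    (a^-1 + b)^-(m + 1) = (1 + a b)^-(m + 1), which is symmetric in a and b. *)
Lemma weak_hankel_gauss b : 0 < b -> weak_hankel (gauss b) (gauss_hat b).
Proof.
move=> b0; split; [exact: sqint_gauss|exact: sqint_gauss_hat|move=> a a0].
have aV : 0 < a^-1 by rewrite invr_gt0.
have bV : 0 < b^-1 by rewrite invr_gt0.
have sa := sqint_gauss a0; have sb := sqint_gauss b0.
have saV := sqint_gauss aV; have sbV := sqint_gauss bV.
rewrite /gauss_hat (ipZl mH _ saV sb) (ipZr mH _ sbV sa) !ip_gauss.
rewrite !momentE ?divr_gt0 ?addr_gt0//.
rewrite !(mulrCA _ (Gamma _ / 2)) -!powRM ?divr_ge0 ?addr_ge0 ?ltW//.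
by congr (_ * _ `^ _); field; rewrite !gt_eqF.
Qed.

(** Because [gauss a] is a multiple of [gauss_hat a^-1]. *)
Lemma weak_hankel_sym f g : weak_hankel f g -> weak_hankel g f.
Proof.
move=> [sf sg fg]; split => // a a0.
have aV : 0 < a^-1 by rewrite invr_gt0.
rewrite {1}/gauss_hat (ipZl mH)//; last exact: sqint_gauss.
rewrite -fg// -(ipZl mH) -?gauss_hatK//; exact: sqint_gauss_hat.
Qed.

Lemma weak_hankel_lin c f g f' g' : weak_hankel f g -> weak_hankel f' g' ->
  weak_hankel (c *: f + f') (c *: g + g').
Proof.
move=> [sf sg fg] [sf' sg' fg']; split.
- by apply: (sqintD mH) => //; exact: (sqintZ mH).
- by apply: (sqintD mH) => //; exact: (sqintZ mH).
move=> a a0; have sa := sqint_gauss a0; have sha := sqint_gauss_hat a0.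
rewrite !(ipDr mH)//; try exact: (sqintZ mH).
by rewrite !(ipZr mH)// fg// fg'.
Qed.

Lemma weak_hankel0 : weak_hankel 0 0.
Proof.
split; [exact: sqint0|exact: sqint0|move=> a _].
by rewrite !ip0r.
Qed.

Lemma weak_hankelB f g f' g' : weak_hankel f g -> weak_hankel f' g' ->
  weak_hankel (f - f') (g - g').
Proof.
move=> fg fg'; have := weak_hankel_lin (-1) fg' fg.
by rewrite !scaleN1r !(addrC (- _)).
Qed.

Lemma weak_hankel_unique f g g' : weak_hankel f g -> weak_hankel f g' ->
  ae_eq mu HL g g'.
Proof.
move=> [sf sg fg] [_ sg' fg']; apply: sqint_gauss_inj => // a a0.
by rewrite -fg// -fg'.
Qed.

Lemma weak_hankel_ae f f' g g' : sqint f' -> sqint g' ->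
  ae_eq mu HL f f' -> ae_eq mu HL g g' -> weak_hankel f g -> weak_hankel f' g'.
Proof.
move=> sf' sg' ff' gg' [sf sg fg]; split => // a a0.
rewrite -(ip_ae_r mH sf sf' (sqint_gauss_hat a0) ff') fg//.
exact: (ip_ae_r mH sg sg' (sqint_gauss a0) gg').
Qed.

Lemma weak_hankel_closed u v f g : (forall n, weak_hankel (u n) (v n)) ->
  sqint f -> sqint g -> cvgL2 u f -> cvgL2 v g -> weak_hankel f g.
Proof.
move=> uv sf sg uf vg; split => // a a0.
have su n : sqint (u n) by have [] := uv n.
have sv n : sqint (v n) by have [] := uv n.
have sa := sqint_gauss a0; have sha := sqint_gauss_hat a0.
have l1 := cvgL2_ip mH su sf sha uf; have l2 := cvgL2_ip mH sv sg sa vg.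
rewrite [LHS]ipC [RHS]ipC; apply: (cvg_unique _ l1) => //.
rewrite (_ : (fun n => _) = fun n => ip (v n) (gauss a))//.
apply/funext => n; have [_ _] := uv n.
by move=> H; rewrite [LHS]ipC [RHS]ipC; exact: H.
Qed.

(** A relation rather than a set, since a combination and its transform have to
    be built with the same coefficients. *)
Inductive gauss_span : (R -> R) -> (R -> R) -> Prop :=
| gauss_span0 : gauss_span 0 0
| gauss_span_add c a s t : 0 < a -> gauss_span s t ->
    gauss_span (c *: gauss a + s) (c *: gauss_hat a + t).

Lemma gauss_span_lin c s t s' t' : gauss_span s t -> gauss_span s' t' ->
  gauss_span (c *: s + s') (c *: t + t').
Proof.
move=> st st'; elim: st => [|b a s0 t0 a0 _ ih]; first by rewrite !scaler0 !add0r.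
have E (f g h : R -> R) : c *: (b *: f + g) + h = (c * b) *: f + (c *: g + h).
  by rewrite scalerDr scalerA addrA.
by rewrite !E; exact: gauss_span_add.
Qed.

Lemma gauss_span_hankel s t : gauss_span s t -> weak_hankel s t.
Proof.
elim=> [|c a s0 t0 a0 _ ih]; first exact: weak_hankel0.
by apply: weak_hankel_lin => //; exact: weak_hankel_gauss.
Qed.

Lemma gauss_span_adjoint s t f g : gauss_span s t -> weak_hankel f g ->
  ip t f = ip s g.
Proof.
move=> st fg; have [sf sg H] := fg.
elim: st => [|c a s0 t0 a0 st0 ih]; first by rewrite !ip0l.
have [ss0 sst0 _] := gauss_span_hankel st0.
have sa := sqint_gauss a0; have sha := sqint_gauss_hat a0.
rewrite !(ipDl mH)//; try exact: (sqintZ mH).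
by rewrite (ipZl mH c sha sf) (ipZl mH c sa sg) ih H.
Qed.

Lemma gauss_span_dense f : sqint f ->
  exists2 u, forall n, exists t, gauss_span (u n) t & cvgL2 u f.
Proof.
apply: (L2_dense mH (S := fun s => exists t, gauss_span s t)).
- by move=> s [t /gauss_span_hankel[]].
- by exists 0; exact: gauss_span0.
- by move=> c s s' [t st] [t' st']; exists (c *: t + t'); exact: gauss_span_lin.
move=> w sw w0; apply: sqint_gauss_eq0 => // a a0.
rewrite ipC; apply: w0; exists (1 *: gauss_hat a + 0).
by rewrite -[gauss a]addr0 -[gauss a]scale1r; apply: gauss_span_add => //; exact: gauss_span0.
Qed.

(** A combination of Gaussians has the same norm as its transform, so an
    approximation of f by such combinations is carried to a Cauchy sequence. *)
Lemma weak_hankel_total_isometry f : sqint f ->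
  exists2 g, weak_hankel f g & ip g g = ip f f.
Proof.
move=> sf; have [u /choice[v uv] uf] := gauss_span_dense sf.
have wuv n := gauss_span_hankel (uv n).
have su n : sqint (u n) by have [] := wuv n.
have sv n : sqint (v n) by have [] := wuv n.
have iso n k : ip (v n - v k) (v n - v k) = ip (u n - u k) (u n - u k).
  have st : gauss_span (u n - u k) (v n - v k).
    have := gauss_span_lin (-1) (uv k) (uv n).
    by rewrite !scaleN1r !(addrC (- _)).
  exact: (gauss_span_adjoint st (weak_hankel_sym (gauss_span_hankel st))).
have [g sg vg] : exists2 g, sqint g & cvgL2 v g.
  apply: (L2_complete mH sv) => e e0.
  have [N HN] := cvgL2_Cauchy mH su sf uf e0.
  by exists N => n k Nn Nk; rewrite iso; exact: HN.
have fg := weak_hankel_closed wuv sf sg uf vg.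
exists g => //.
have l1 := cvgL2_ip mH sv sg sg vg; have l2 := cvgL2_ip mH su sf sf uf.
apply: (cvg_unique _ l1) => //.
rewrite (_ : (fun n => _) = fun n => ip (u n) f)//.
by apply/funext => n; exact: (gauss_span_adjoint (uv n) (weak_hankel_sym fg)).
Qed.

Lemma weak_hankel_total f : sqint f -> exists g, weak_hankel f g.
Proof. by move=> /weak_hankel_total_isometry[g]; exists g. Qed.

Lemma weak_hankel_norm f g : weak_hankel f g -> ip g g = ip f f.
Proof.
move=> fg; have [sf sg _] := fg.
have [g' fg' <-] := weak_hankel_total_isometry sf.
have [_ sg' _] := fg'.
have ae := weak_hankel_unique fg fg'.
by rewrite (ip_ae_l mH sg sg' sg ae) (ip_ae_r mH sg sg' sg' ae).
Qed.

(** Polarization of the isometry. *)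
Lemma weak_hankel_ip f g f' g' : weak_hankel f g -> weak_hankel f' g' ->
  ip g g' = ip f f'.
Proof.
move=> fg fg'; have [sf sg _] := fg; have [sf' sg' _] := fg'.
have := weak_hankel_norm (weak_hankelB fg fg').
rewrite !(ipBB mH)// (weak_hankel_norm fg) (weak_hankel_norm fg').
lra.
Qed.

End gaussian_transform.

(** * The Bessel kernel *)

Section bessel_kernel.
Implicit Types (f g h s t : R -> R) (a b c p q x y z k : R).

Lemma series_exp_coeff_le x n : 0 <= x -> series (exp_coeff x) n <= expR x.
Proof.
move=> x0; apply: nondecreasing_cvgn_le; last exact: is_cvg_series_exp_coeff.
by apply: nondecreasing_series => k _ _; exact: exp_coeff_ge0.
Qed.

Definition bessel_coeff n : R := (-1) ^+ n / (n`!%:R * Gamma (m + n%:R + 1)).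

Definition bessel_term z n : R := bessel_coeff n * (z / 2) `^ ((2 * n)%:R + m).

Definition hankel_kernel z : R := besselJ m z * Num.sqrt z.

Lemma Gamma_pos n : 0 < Gamma (m + n%:R + 1).
Proof.
apply: lt_le_trans (Gamma_lower_bound _); first by rewrite divr_gt0 ?expR_gt0.
have n0 : 0 <= n%:R :> R by []; move: hm; lra.
Qed.

Lemma norm_bessel_coeff n : `|bessel_coeff n| <= 2 * expR 2 / n`!%:R.
Proof.
have G0 := Gamma_pos n.
have f0 : 0 < n`!%:R :> R by rewrite ltr0n fact_gt0.
rewrite /bessel_coeff normrM normrX normrN1 expr1n mul1r.
have P0 : 0 < n`!%:R * Gamma (m + n%:R + 1) by rewrite mulr_gt0.
rewrite ger0_norm ?invr_ge0 ?(ltW P0)// invfM mulrC ler_pM2r ?invr_gt0//.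
rewrite -[leRHS]invrK lef_pV2 ?posrE ?invr_gt0 ?mulr_gt0 ?expR_gt0//.
rewrite invfM -expRN mulrC; apply: Gamma_lower_bound.
have n0 : 0 <= n%:R :> R by []; move: hm; lra.
Qed.

Lemma norm_bessel_term z n : 0 < z ->
  `|bessel_term z n| <= 2 * expR 2 * (z / 2) `^ m * exp_coeff (z ^+ 2 / 4) n.
Proof.
move=> z0; have z20 : 0 < z / 2 by rewrite divr_gt0.
rewrite /bessel_term normrM (ger0_norm (powR_ge0 _ _)) (powRD_gt0 _ _ z20).
rewrite powR_mulrn ?(ltW z20)// exprM /exp_coeff/=.
rewrite (_ : (z / 2) ^+ 2 = z ^+ 2 / 4); last by field.
have f0 : n`!%:R != 0 :> R by rewrite gt_eqF// ltr0n fact_gt0.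
rewrite [leRHS](_ : _ = 2 * expR 2 / n`!%:R * ((z ^+ 2 / 4) ^+ n * (z / 2) `^ m)).
  rewrite ler_wpM2r ?norm_bessel_coeff// mulr_ge0 ?powR_ge0// exprn_ge0//.
  by rewrite divr_ge0 ?sqr_ge0.
by field.
Qed.

Lemma norm_bessel_partial_sum z n : 0 < z ->
  `|series (bessel_term z) n| <= 2 * expR 2 * (z / 2) `^ m * expR (z ^+ 2 / 4).
Proof.
move=> z0; apply: (le_trans (ler_norm_sum _ _ _)).
apply: (@le_trans _ _ (2 * expR 2 * (z / 2) `^ m * series (exp_coeff (z ^+ 2 / 4)) n)).
  rewrite /series/= mulr_sumr; apply: ler_sum => i _; exact: norm_bessel_term.
rewrite ler_wpM2l ?mulr_ge0 ?expR_ge0 ?powR_ge0//.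
by apply: series_exp_coeff_le; rewrite divr_ge0 ?sqr_ge0.
Qed.

Lemma cvg_bessel z : 0 < z -> series (bessel_term z) @ \oo --> besselJ m z.
Proof.
move=> z0; have -> : besselJ m z = limn (series (bessel_term z)) by [].
suff : cvgn (series (bessel_term z)) by [].
apply: normed_cvg.
apply: (@series_le_cvg _ _ (fun n => 2 * expR 2 * (z / 2) `^ m * exp_coeff (z ^+ 2 / 4) n)).
- by move=> n; exact: normr_ge0.
- by move=> n; apply: le_trans (norm_bessel_term n z0).
- by move=> n; exact: norm_bessel_term.
- rewrite (_ : series _ = fun n => 2 * expR 2 * (z / 2) `^ m * series (exp_coeff (z ^+ 2 / 4)) n).
    by apply: is_cvgM; [exact: is_cvg_cst|exact: is_cvg_series_exp_coeff].
  by apply/funext => n; rewrite /series/= mulr_sumr.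
Qed.

Definition kernel_bound : R := 2 * expR 2 * 2 `^ (- m).

Definition kernel_partial_sum n z : R := series (bessel_term z) n * Num.sqrt z.

(** The bound on the coefficients ignores the growth of Gamma, so the majorant
    grows like exp (z^2 / 4), and the kernel will be integrated only against
    Gaussians of large parameter. *)
Lemma norm_kernel_partial_sum n z : 0 < z ->
  `|kernel_partial_sum n z| <= kernel_bound * (z `^ (2^-1 + m) * expR (z ^+ 2 / 4)).
Proof.
move=> z0; rewrite /kernel_partial_sum normrM (ger0_norm (sqrtr_ge0 _)).
apply: (le_trans (ler_wpM2r (sqrtr_ge0 _) (norm_bessel_partial_sum n z0))).
rewrite -powR12_sqrt ?(ltW z0)// (powRD_gt0 _ _ z0) /kernel_bound.
rewrite powRM ?(ltW z0) ?invr_ge0// (_ : 2^-1 `^ m = 2 `^ (- m)); last first.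
  by rewrite -powR_inv1// -powRrM mulN1r.
by rewrite le_eqVlt; apply/orP; left; apply/eqP; ring.
Qed.

Lemma cvg_kernel_partial_sum z : 0 < z ->
  kernel_partial_sum ^~ z @ \oo --> hankel_kernel z.
Proof. by move=> z0; apply: cvgM; [exact: cvg_bessel|exact: cvg_cst]. Qed.

Lemma norm_hankel_kernel z : 0 < z ->
  `|hankel_kernel z| <= kernel_bound * (z `^ (2^-1 + m) * expR (z ^+ 2 / 4)).
Proof.
move=> z0.
have c : (fun n => `|kernel_partial_sum n z|) @ \oo --> `|hankel_kernel z|.
  by apply: cvg_norm; exact: cvg_kernel_partial_sum.
rewrite -(cvg_lim _ c)//; apply: limr_le; first by apply/cvg_ex; eexists; exact: c.
by apply: nearW => n; exact: norm_kernel_partial_sum.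
Qed.

Lemma measurable_kernel_partial_sum n : measurable_fun HL (kernel_partial_sum n).
Proof.
have ms : measurable_fun HL (fun z => series (bessel_term z) n).
  rewrite /series/=; apply: measurable_sum => i.
  apply: measurable_funM; first exact: measurable_cst.
  apply: measurable_funTS.
  apply: (measurableT_comp (measurable_powR ((2 * i)%:R + m))).
  by apply: measurable_funM => //; exact: measurable_cst.
apply: measurable_funM => //.
apply: half_line_continuous_measurable => z _; exact: sqrt_continuous.
Qed.

Lemma measurable_hankel_kernel : measurable_fun HL hankel_kernel.
Proof.
apply: (measurable_fun_cvg (h := kernel_partial_sum)).
  exact: measurable_kernel_partial_sum.
by move=> z; rewrite half_lineE; exact: cvg_kernel_partial_sum.
Qed.

Lemma sqrt_powR_kernel n x y : 0 < x -> 0 < y ->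
  (y * x / 2) `^ ((2 * n)%:R + m) * Num.sqrt (y * x) * x `^ (2^-1 + m) =
  2 `^ (- m) * 4^-1 ^+ n * y ^+ (2 * n) * y `^ (2^-1 + m) * x `^ (2 * (m + n%:R) + 1).
Proof.
move=> x0 y0; have yx0 : 0 < y * x by rewrite mulr_gt0.
have h0 : 0 < y * x / 2 by rewrite divr_gt0.
rewrite (powRD_gt0 _ _ h0) powR_mulrn ?(ltW h0)// -powR12_sqrt ?(ltW yx0)//.
have -> : (y * x / 2) `^ m = y `^ m * x `^ m * 2 `^ (- m).
  rewrite !powRM ?(ltW x0) ?(ltW y0) ?(ltW yx0) ?invr_ge0//.
  by rewrite (_ : 2^-1 `^ m = 2 `^ (- m))// -powR_inv1// -powRrM mulN1r.
have -> : 2 * (m + n%:R) + 1 = m + (2 * n)%:R + (2^-1 + (2^-1 + m)) :> R.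
  by rewrite natrM; field.
rewrite !(powRD_gt0 _ _ x0) !(powRD_gt0 _ _ y0) powR_mulrn ?(ltW x0)//.
rewrite powRM ?(ltW x0) ?(ltW y0)// !exprMn.
have -> : 2^-1 ^+ (2 * n) = 4^-1 ^+ n :> R.
  by rewrite exprM; congr (_ ^+ n); field.
by ring.
Qed.

Definition kernel_term_coeff y n : R := bessel_coeff n *
  (2 `^ (- m) * 4^-1 ^+ n * y ^+ (2 * n) * y `^ (2^-1 + m)).

Lemma kernel_termE n a x y : 0 < x -> 0 < y ->
  bessel_term (y * x) n * Num.sqrt (y * x) * gauss a x =
  kernel_term_coeff y n * pg (2 * (m + n%:R) + 1) (a / 2) x.
Proof.
move=> x0 y0; rewrite /bessel_term /gauss /power_gaussian /kernel_term_coeff.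
rewrite -(mulrA (bessel_coeff n)) -mulrA (mulrA (_ * Num.sqrt _)).
by rewrite sqrt_powR_kernel//; ring.
Qed.

Lemma integrable_kernel_term n a y : 0 < a -> 0 < y ->
  mu.-integrable HL (EFin \o
    (fun x => bessel_term (y * x) n * Num.sqrt (y * x) * gauss a x)).
Proof.
move=> a0 y0.
apply: (@eq_integrable_half_line (fun x =>
    kernel_term_coeff y n * pg (2 * (m + n%:R) + 1) (a / 2) x)).
  by move=> x x0; rewrite kernel_termE.
apply: integrableZl_real; apply: integrable_power_gaussian; last by rewrite divr_gt0.
have n0 : 0 <= n%:R :> R by []; move: hm; lra.
Qed.

(** Term by term: the Gamma factor of the n-th coefficient is cancelled by the
    n-th Gaussian moment. *)
Lemma integral_kernel_term n a y : 0 < a -> 0 < y ->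
  \int[mu]_(x in HL) (bessel_term (y * x) n * Num.sqrt (y * x) * gauss a x) =
  a `^ (- (m + 1)) * y `^ (2^-1 + m) * exp_coeff (- (a^-1 / 2 * y ^+ 2)) n.
Proof.
move=> a0 y0.
have f0 : n`!%:R != 0 :> R by rewrite gt_eqF// ltr0n fact_gt0.
have n0 : 0 <= n%:R :> R by [].
have p1 : -1 < 2 * (m + n%:R) + 1 by move: hm; lra.
have a20 : 0 < a / 2 by rewrite divr_gt0.
transitivity (\int[mu]_(x in HL)
    (kernel_term_coeff y n * pg (2 * (m + n%:R) + 1) (a / 2) x)).
  by apply: eq_Rintegral => x; rewrite inE half_lineE => x0; rewrite kernel_termE.
rewrite /kernel_term_coeff.
rewrite RintegralZl; [|exact: mH|exact: integrable_power_gaussian].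
have s0 : 0 < m + n%:R + 1 by move: hm; lra.
have := Gamma_moment s0 a20; rewrite /moment.
have -> : 2 * (m + n%:R + 1) - 1 = 2 * (m + n%:R) + 1 by ring.
set M := (\int[mu]_(x in HL) _) => GE.
have Gn0 : Gamma (m + n%:R + 1) != 0 by rewrite gt_eqF// Gamma_pos.
rewrite /bessel_coeff /exp_coeff/=.
have pa : (a / 2) `^ (m + n%:R + 1) = a `^ (m + 1) * a ^+ n * 2 `^ (- m) * 2^-1 ^+ n / 2.
  rewrite (_ : m + n%:R + 1 = m + 1 + n%:R); last by ring.
  rewrite powRM ?(ltW a0) ?invr_ge0// (powRD_gt0 _ _ a0) powR_mulrn ?(ltW a0)//.
  rewrite !powRD_gt0 ?invr_gt0// powR_mulrn ?invr_ge0//.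
  rewrite !powRr1 ?invr_ge0 ?(ltW a0)// (_ : 2^-1 `^ m = 2 `^ (- m)); first by ring.
  by rewrite -powR_inv1// -powRrM mulN1r.
have pan : (a / 2) `^ (m + n%:R + 1) != 0 by rewrite gt_eqF// powR_gt0.
have -> : M = Gamma (m + n%:R + 1) / (2 * (a / 2) `^ (m + n%:R + 1)).
  by rewrite GE; field.
have pe : (- (a^-1 / 2 * y ^+ 2)) ^+ n =
    (-1) ^+ n * (a ^+ n)^-1 * 2^-1 ^+ n * y ^+ (2 * n).
  rewrite (_ : - (a^-1 / 2 * y ^+ 2) = -1 * a^-1 * 2^-1 * y ^+ 2); last by ring.
  by rewrite exprM; move: (y ^+ 2) => Y; rewrite !exprMn [a^-1 ^+ n]exprVn.
rewrite pa pe (powRN a).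
have am : a `^ (m + 1) != 0 by rewrite gt_eqF// powR_gt0.
have an : a ^+ n != 0 by rewrite expf_neq0// gt_eqF.
have m2 : 2 `^ (- m) != 0 :> R by rewrite gt_eqF// powR_gt0.
have n2 : 2^-1 ^+ n != 0 :> R by rewrite expf_neq0.
have e4 : 4^-1 ^+ n = 2^-1 ^+ n * 2^-1 ^+ n :> R.
  by rewrite -exprMn; congr (_ ^+ n); field.
rewrite e4; set h := 2^-1 ^+ n.
field.
by rewrite Gn0 f0 am an m2 n2.
Qed.

(** Weber's first exponential integral. *)
Lemma integral_kernel_gauss a y : 0 < y -> y ^+ 2 / 2 < a ->
  \int[mu]_(x in HL) (hankel_kernel (y * x) * gauss a x) = gauss_hat a y.
Proof.
move=> y0 ya; have a0 : 0 < a by apply: le_lt_trans ya; rewrite divr_ge0 ?sqr_ge0.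
pose b := (a / 2 - y ^+ 2 / 4).
have b0 : 0 < b by rewrite /b; lra.
have p1 : -1 < (2^-1 + m) + (2^-1 + m) by move: hm; lra.
have lim : (fun n => \int[mu]_(x in HL) (kernel_partial_sum n (y * x) * gauss a x)) @ \oo -->
    \int[mu]_(x in HL) (hankel_kernel (y * x) * gauss a x).
  apply: (@Rintegral_dominated _ _ _ mu HL mH _ _ (fun x =>
    (kernel_bound * y `^ (2^-1 + m)) * pg ((2^-1 + m) + (2^-1 + m)) b x)).
  - move=> n; apply: measurable_funM; last exact: measurable_power_gaussian.
    apply: measurable_half_line_scale => //; exact: measurable_kernel_partial_sum.
  - apply: measurable_funM; last exact: measurable_power_gaussian.
    apply: measurable_half_line_scale => //; exact: measurable_hankel_kernel.
  - exact: integrableZl_real (integrable_power_gaussian p1 b0).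
  - move=> n x; rewrite half_lineE => x0; have yx0 : 0 < y * x by rewrite mulr_gt0.
    rewrite normrM (ger0_norm (power_gaussian_ge0 _ _ _)).
    apply: (le_trans (ler_wpM2r (power_gaussian_ge0 _ _ _) (norm_kernel_partial_sum n yx0))).
    apply: eq_imp_le.
    rewrite /gauss /power_gaussian (powRD_gt0 (2^-1 + m) (2^-1 + m) x0) powRM ?(ltW x0) ?(ltW y0)//.
    rewrite (_ : expR (- (b * x ^+ 2)) = expR ((y * x) ^+ 2 / 4) * expR (- (a / 2 * x ^+ 2))).
      by ring.
    by rewrite -expRD; congr expR; rewrite /b; field.
  - apply: aeW => x; rewrite half_lineE => x0; apply: cvgM; last exact: cvg_cst.
    by apply: cvg_kernel_partial_sum; rewrite mulr_gt0.
have sum n : mu.-integrable HL (EFin \o (fun x => kernel_partial_sum n (y * x) * gauss a x)) /\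
    \int[mu]_(x in HL) (kernel_partial_sum n (y * x) * gauss a x) =
    a `^ (- (m + 1)) * y `^ (2^-1 + m) * series (exp_coeff (- (a^-1 / 2 * y ^+ 2))) n.
  elim: n => [|n [ih1 ih2]].
    have E x : kernel_partial_sum 0 (y * x) * gauss a x = 0.
      by rewrite /kernel_partial_sum /series/= big_geq// !mul0r.
    split; first by apply: (eq_integrable_half_line (f := cst 0)) => //; exact: integrable0.
    under eq_Rintegral do rewrite E.
    by rewrite /Rintegral integral0 /series/= big_geq// mulr0.
  have E x : kernel_partial_sum n.+1 (y * x) * gauss a x =
      kernel_partial_sum n (y * x) * gauss a x +
      bessel_term (y * x) n * Num.sqrt (y * x) * gauss a x.
    by rewrite /kernel_partial_sum /series/= big_nat_recr//= mulrDl mulrDl.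
  have it := integrable_kernel_term n a0 y0.
  split.
    apply: (eq_integrable_half_line (f := fun x => kernel_partial_sum n (y * x) * gauss a x +
      bessel_term (y * x) n * Num.sqrt (y * x) * gauss a x)) => //.
    exact: (integrableD mH ih1 it).
  under eq_Rintegral do rewrite E.
  rewrite RintegralD//; last exact: mH.
  by rewrite ih2 integral_kernel_term// /series/= big_nat_recr//= mulrDr.
have lim2 : (fun n => \int[mu]_(x in HL) (kernel_partial_sum n (y * x) * gauss a x)) @ \oo -->
    gauss_hat a y.
  rewrite (_ : gauss_hat a y = a `^ (- (m + 1)) * y `^ (2^-1 + m) *
    expR (- (a^-1 / 2 * y ^+ 2))); last by rewrite -mulrA.
  rewrite (_ : (fun n => _) = fun n => a `^ (- (m + 1)) * y `^ (2^-1 + m) *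
    series (exp_coeff (- (a^-1 / 2 * y ^+ 2))) n).
    by apply: cvgM; [exact: cvg_cst|exact: is_cvg_series_exp_coeff].
  by apply/funext => n; have [] := sum n.
exact: (cvg_unique _ lim lim2).
Qed.

End bessel_kernel.

(** * The Hankel integral of bounded functions with bounded support *)

Section hankel_integral_real.
Implicit Types (f g h phi : R -> R) (a b c p q x y z k : R).

Definition rhankel phi k : R := \int[mu]_(x in HL) (hankel_kernel (k * x) * phi x).

Variables (phi : R -> R) (B K : R).
Hypothesis mphi : measurable_fun HL phi.
Hypothesis B0 : 0 < B.
Hypothesis phiK : forall x, 0 < x -> `|phi x| <= K.
Hypothesis phi0 : forall x, B < x -> phi x = 0.

Let K0 : 0 <= K.
Proof. by apply: le_trans (phiK ltr01). Qed.

Let s0 : -1 < 2^-1 + m. Proof. by move: hm; lra. Qed.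

Lemma bounded_support_gaussian x : 0 < x -> `|phi x| <= K * expR (B ^+ 2) * expR (- (1 * x ^+ 2)).
Proof.
move=> x0; have [xB|xB] := leP x B; last first.
  by rewrite phi0// normr0 !mulr_ge0// expR_ge0.
apply: (le_trans (phiK x0)); rewrite -mulrA -expRD -{1}[K]mulr1 ler_wpM2l//.
by rewrite -[leLHS]expR0 ler_expR mul1r subr_ge0 lerXn2r ?nnegrE ?(ltW x0) ?(ltW B0).
Qed.

Lemma sqint_bounded_support : sqint phi.
Proof.
have h0 : - 2^-1 < 0 :> R by lra.
apply: (le_sqint mH (g := (K * expR (B ^+ 2)) *: pg 0 1)) => //.
- move=> x; rewrite half_lineE => x0; apply: (le_trans (bounded_support_gaussian x0)).
  by rewrite [leRHS](_ : _ = K * expR (B ^+ 2) * pg 0 1 x)// /power_gaussian powRr0 (mul1r (expR _)).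
- by apply: (sqintZ mH); exact: sqint_power_gaussian.
Qed.

Section fubini.
Variable a : R.
Hypothesis aB : B ^+ 2 / 2 < a.

Let G (z : R * R) : R := gauss a z.1 * (hankel_kernel (z.1 * z.2) * phi z.2).
Let F : measurableTypeR R * measurableTypeR R -> \bar R := (EFin \o G) \_ (HL `*` HL).

Let mHH : measurable (HL `*` HL : set (measurableTypeR R * measurableTypeR R)).
Proof. by apply: measurableX; exact: mH. Qed.

Let measurable_comp_quadrant (f : R -> R) (r : measurableTypeR R * measurableTypeR R -> R) :
  measurable_fun HL f -> measurable_fun setT r ->
  (forall w : measurableTypeR R * measurableTypeR R,
    0 < w.1 :> R -> 0 < w.2 :> R -> 0 < r w) ->
  measurable_fun (HL `*` HL) (f \o r).
Proof.
move=> mf mr r0; apply: (@measurable_comp _ _ _ _ _ _ HL) => //.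
- exact: mH.
- by move=> _ [z [/= + +] <-]; rewrite !half_lineE => z1 z2; exact: r0.
- exact: measurable_funTS.
Qed.

Let mG : measurable_fun (HL `*` HL : set (measurableTypeR R * measurableTypeR R)) G.
Proof.
have m1 : measurable_fun setT (fst : measurableTypeR R * measurableTypeR R -> R).
  exact: measurable_fst.
have m2 : measurable_fun setT (snd : measurableTypeR R * measurableTypeR R -> R).
  exact: measurable_snd.
apply: measurable_funM.
  by apply: (measurable_comp_quadrant (measurable_power_gaussian _ _) m1).
apply: measurable_funM.
  apply: (measurable_comp_quadrant (measurable_hankel_kernel)
    (r := fun w => w.1 * w.2)); first exact: measurable_funM.
  by move=> w w1 w2; rewrite mulr_gt0.
exact: (measurable_comp_quadrant mphi m2).
Qed.

Let mF : measurable_fun setT F.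
Proof.
by apply/(measurable_restrictT (EFin \o G) mHH); exact/measurable_EFinP.
Qed.

Let C := kernel_bound * K * expR (B ^+ 2).
Let b := a / 2 - B ^+ 2 / 4.

Let b0 : 0 < b. Proof. by rewrite /b; move: aB; lra. Qed.

Let G_le k x : 0 < k -> 0 < x ->
  `|G (k, x)| <= C * (pg ((2^-1 + m) + (2^-1 + m)) b k * pg (2^-1 + m) 1 x).
Proof.
move=> k0 x0; rewrite /G/=.
have kx0 : 0 < k * x by rewrite mulr_gt0.
have kb0 : 0 <= kernel_bound by rewrite !mulr_ge0 ?expR_ge0 ?powR_ge0.
have [xB|xB] := leP x B; last first.
  rewrite phi0// !mulr0 normr0; apply: mulr_ge0.
    by rewrite /C; apply: mulr_ge0; [exact: mulr_ge0|exact: expR_ge0].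
  by apply: mulr_ge0; exact: power_gaussian_ge0.
rewrite (normrM (gauss a k)) (normrM (hankel_kernel (k * x))).
rewrite (ger0_norm (power_gaussian_ge0 _ _ _ : 0 <= gauss a k)).
apply: (@le_trans _ _ (gauss a k * ((kernel_bound *
  ((k * x) `^ (2^-1 + m) * expR (k ^+ 2 * B ^+ 2 / 4))) *
  (K * expR (B ^+ 2) * expR (- (1 * x ^+ 2)))))).
  rewrite ler_wpM2l ?power_gaussian_ge0// ler_pM ?normr_ge0//.
    apply: (le_trans (norm_hankel_kernel kx0)); rewrite ler_wpM2l//.
    rewrite ler_wpM2l ?powR_ge0// ler_expR ler_pM2r ?invr_gt0//.
    by rewrite exprMn ler_wpM2l ?sqr_ge0// lerXn2r ?nnegrE ?(ltW x0) ?(ltW B0).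
  exact: bounded_support_gaussian.
apply: eq_imp_le.
rewrite /gauss /power_gaussian (powRD_gt0 (2^-1 + m) (2^-1 + m) k0) powRM ?(ltW x0) ?(ltW k0)//.
have -> : expR (- (b * k ^+ 2)) = expR (k ^+ 2 * B ^+ 2 / 4) * expR (- (a / 2 * k ^+ 2)).
  by rewrite -expRD; congr expR; rewrite /b; field.
by rewrite /C; ring.
Qed.

Let FE k x : F (k, x) = if (0 < k) && (0 < x) then (G (k, x))%:E else 0%E.
Proof.
rewrite /F patchE; have [k0|k0] := ltP 0 k; have [x0|x0] := ltP 0 x => /=.
- by rewrite mem_set//=; split; rewrite half_lineE.
- by rewrite memNset//= => -[_]; rewrite half_lineE ltNge x0.
- by rewrite memNset//= => -[]; rewrite half_lineE ltNge k0.
- by rewrite memNset//= => -[]; rewrite half_lineE ltNge k0.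
Qed.

Let P k := C * pg ((2^-1 + m) + (2^-1 + m)) b k.
Let Q := pg (2^-1 + m) 1.

Let P0 k : 0 <= P k.
Proof.
rewrite /P; apply: mulr_ge0; last exact: power_gaussian_ge0.
rewrite /C; apply: mulr_ge0; last exact: expR_ge0.
by apply: mulr_ge0 => //; rewrite !mulr_ge0 ?expR_ge0 ?powR_ge0.
Qed.

Let Q0 x : 0 <= Q x. Proof. exact: power_gaussian_ge0. Qed.

Let iP : mu.-integrable HL (EFin \o P).
Proof.
apply: integrableZl_real; apply: integrable_power_gaussian => //.
by move: hm; lra.
Qed.

Let iQ : mu.-integrable HL (EFin \o Q).
Proof. exact: integrable_power_gaussian. Qed.

Let G_leM k x : 0 < k -> 0 < x -> `|G (k, x)| <= P k * Q x.
Proof. by move=> k0 x0; rewrite /P -mulrA; exact: G_le. Qed.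

Let leb : {sigma_finite_measure set (measurableTypeR R) -> \bar R} := lebesgue_measure.

Let iF : (leb \x leb)%E.-integrable setT F.
Proof.
apply/(@integrable12ltyP _ _ _ _ _ leb leb F mF).
pose J := (\int[mu]_(x in HL) (Q x)%:E)%E.
have Jfin : J \is a fin_num by apply: integrable_fin_num => //; exact: mH.
have J0 : (0 <= J)%E by apply: integral_ge0 => x _; rewrite lee_fin.
apply: (@le_lt_trans _ _ (\int[mu]_(k in HL) ((P k)%:E * J))%E); last first.
  rewrite ge0_integralZr//.
  - rewrite lte_mul_pinfty//.
    + by apply: integral_ge0 => x _; rewrite lee_fin.
    + by apply: integrable_fin_num => //; exact: mH.
    + by rewrite -ge0_fin_numE.
  - exact: mH.
  - exact: measurable_int iP.
  - by move=> x _; rewrite lee_fin.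
rewrite [leRHS]integral_mkcond; apply: ge0_le_integral => //.
- by move=> x _; exact: integral_ge0.
- apply: (measurable_fun_fubini_tonelli_F (abse \o F)) => //=.
  exact: measurableT_comp.
- apply/(measurable_restrictT _ mH); apply: emeasurable_funM; last exact: measurable_cst.
  exact: measurable_int iP.
move=> k _; rewrite patchE; case: ifPn; last first.
  move=> /negP; rewrite inE half_lineE => /negP/negbTE k0.
  rewrite (eq_integral (cst 0%E)); first by rewrite integral0.
  by move=> x _; rewrite FE k0/= normr0.
rewrite inE half_lineE => k0.
rewrite -ge0_integralZl_EFin//; last 3 first.
- exact: mH.
- by move=> x _; rewrite lee_fin.
- exact: measurable_int iQ.
rewrite [leRHS]integral_mkcond; apply: ge0_le_integral => //.
- apply: measurableT_comp => //; exact: (measurableT_comp mF).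
- by apply/(measurable_restrictT _ mH); apply: emeasurable_funM; [exact: measurable_cst|exact: measurable_int iQ].
move=> x _; rewrite FE k0/= patchE; have [x0|x0] := ltP 0 x.
  by rewrite mem_set ?half_lineE// lee_fin; exact: G_leM.
by rewrite abse0; case: ifPn => // _; rewrite mule_ge0// lee_fin.
Qed.

Let iG1 k : 0 < k -> mu.-integrable HL (EFin \o (fun x => G (k, x))).
Proof.
move=> k0; apply: (@le_integrable_real _ _ _ mu HL mH _ (fun x => P k * Q x)).
- rewrite /G/=; apply: measurable_funM; first exact: measurable_cst.
  apply: measurable_funM => //; apply: measurable_half_line_scale => //.
  exact: measurable_hankel_kernel.
- by move=> x; rewrite half_lineE => x0; exact: G_leM.
- exact: integrableZl_real.
Qed.

Let iG2 x : 0 < x -> mu.-integrable HL (EFin \o (fun k => G (k, x))).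
Proof.
move=> x0; apply: (@le_integrable_real _ _ _ mu HL mH _ (fun k => Q x * P k)).
- rewrite /G/=; apply: measurable_funM; first exact: measurable_power_gaussian.
  apply: measurable_funM; last exact: measurable_cst.
  rewrite (_ : (fun k => _) = (fun k => hankel_kernel (x * k))).
    apply: measurable_half_line_scale => //; exact: measurable_hankel_kernel.
  by apply/funext => k; rewrite mulrC.
- by move=> k; rewrite half_lineE => k0; rewrite mulrC; exact: G_leM.
- exact: integrableZl_real.
Qed.

Let section1 k : (\int[lebesgue_measure]_x F (k, x))%E =
  (((fun k => gauss a k * rhankel phi k) \_ HL) k)%:E.
Proof.
rewrite patchE; case: ifPn; last first.
  move=> /negP; rewrite inE half_lineE => /negP/negbTE k0.
  by rewrite (eq_integral (cst 0%E)) ?integral0// => x _; rewrite FE k0.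
rewrite inE half_lineE => k0.
transitivity (\int[mu]_(x in HL) (G (k, x))%:E)%E.
  rewrite [RHS]integral_mkcond; apply: eq_integral => x _.
  rewrite FE k0/= patchE; have [x0|x0] := ltP 0 x.
    by rewrite mem_set// half_lineE.
  by rewrite memNset// half_lineE ltNge x0.
rewrite -[LHS]fineK; last by apply: integrable_fin_num => //; [exact: mH|exact: iG1].
congr EFin; rewrite /rhankel -RintegralZl//; first exact: mH.
apply: (@eq_integrable_half_line (fun x => (gauss a k)^-1 * G (k, x))).
  by move=> x x0; rewrite /G mulKf// gt_eqF// power_gaussian_gt0.
by apply: integrableZl_real; exact: iG1.
Qed.

Let section2 x : (\int[lebesgue_measure]_k F (k, x))%E =
  (((fun x => gauss_hat a x * phi x) \_ HL) x)%:E.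
Proof.
rewrite patchE; case: ifPn; last first.
  move=> /negP; rewrite inE half_lineE => /negP/negbTE x0.
  by rewrite (eq_integral (cst 0%E)) ?integral0// => k _; rewrite FE x0 andbF.
rewrite inE half_lineE => x0.
transitivity (\int[mu]_(k in HL) (G (k, x))%:E)%E.
  rewrite [RHS]integral_mkcond; apply: eq_integral => k _.
  rewrite FE x0/= patchE andbT; have [k0|k0] := ltP 0 k.
    by rewrite mem_set// half_lineE.
  by rewrite memNset// half_lineE ltNge k0.
have [p0|p0] := eqVneq (phi x) 0.
  rewrite p0 mulr0 (eq_integral (cst 0%E)) ?integral0// => k _.
  by rewrite /G/= p0 !mulr0.
have xB : x <= B by rewrite leNgt; apply/negP => /phi0 /eqP; exact/negP.
rewrite -[LHS]fineK; last by apply: integrable_fin_num => //; [exact: mH|exact: iG2].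
congr EFin; rewrite -(integral_kernel_gauss x0); last first.
  apply: le_lt_trans aB; rewrite ler_pM2r ?invr_gt0//.
  by rewrite lerXn2r ?nnegrE ?(ltW x0) ?(ltW B0).
rewrite mulrC -RintegralZl//; last 2 first.
- exact: mH.
- apply: (@eq_integrable_half_line (fun k => (phi x)^-1 * G (k, x))).
    by move=> k k0; rewrite /G/= (mulrC k); field.
  by apply: integrableZl_real; exact: iG2.
by apply: eq_Rintegral => k _; rewrite /G/= (mulrC k); ring.
Qed.

(** Fubini's theorem and Weber's integral. On the support of phi the kernel is
    bounded by a multiple of exp (k^2 B^2 / 4), which [gauss a] outweighs. *)
Lemma rhankel_gauss :
  mu.-integrable HL (EFin \o (fun k => gauss a k * rhankel phi k)) /\
  ip (gauss a) (rhankel phi) = ip (gauss_hat a) phi.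
Proof.
split.
  apply/(integrable_mkcond _ mH).
  apply: (eq_integrable measurableT _ _ _ (integrable_fubini_F iF)).
  by move=> k _; rewrite (restrict_EFin (fun k => gauss a k * rhankel phi k)); exact: section1.
congr fine; rewrite [LHS]integral_mkcond [RHS]integral_mkcond.
transitivity (\int[leb]_k \int[leb]_x F (k, x))%E.
  apply: (@eq_integral _ _ _ leb) => k _.
  rewrite (restrict_EFin (fun k => gauss a k * rhankel phi k)).
  exact/esym/section1.
rewrite (Fubini iF); apply: (@eq_integral _ _ _ leb) => x _.
rewrite (restrict_EFin (fun x => gauss_hat a x * phi x)).
exact/section2.
Qed.

End fubini.

Lemma measurable_rhankel : measurable_fun HL (rhankel phi).
Proof.
have B20 : 0 < B ^+ 2 by rewrite exprn_gt0.
have aB : B ^+ 2 / 2 < B ^+ 2 by move: (B ^+ 2) B20 => c c0; lra.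
have [ig _] := rhankel_gauss aB.
have mg : measurable_fun HL (fun k => gauss (B ^+ 2) k * rhankel phi k).
  by apply/measurable_EFinP; exact: measurable_int ig.
apply: (@eq_measurable_fun _ _ _ _ HL
    (fun k => (gauss (B ^+ 2) k)^-1 * (gauss (B ^+ 2) k * rhankel phi k))).
  by move=> k; rewrite inE half_lineE => k0; rewrite mulKf// gt_eqF// power_gaussian_gt0.
apply: measurable_funM => //; apply: half_line_continuous_measurable => k k0.
by apply: (continuousV); [rewrite gt_eqF// power_gaussian_gt0|exact: continuous_power_gaussian].
Qed.

(** The bound on the kernel does not show that the integral transform is square
    integrable. But phi has a transform psi in the sense of [weak_hankel],
    and psi pairs with all Gaussians of large parameter as the integral
    transform does, so the two agree. *)
Lemma weak_hankel_rhankel : weak_hankel phi (rhankel phi).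
Proof.
have sphi := sqint_bounded_support.
have [psi Vpsi] := weak_hankel_total sphi.
have [_ spsi H] := Vpsi.
pose a0 := B ^+ 2.
have a00 : 0 < a0 by rewrite exprn_gt0.
have aB : B ^+ 2 / 2 < a0 by rewrite -/a0; move: (a0) a00 => c c0; lra.
have ig a : a0 <= a -> mu.-integrable HL (EFin \o (fun k => gauss a k * rhankel phi k)).
  by move=> aa; have [] := @rhankel_gauss a (lt_le_trans aB aa).
have igp a : a0 <= a -> mu.-integrable HL (EFin \o (fun k => gauss a k * psi k)).
  move=> aa; apply: (sqint_mul mH) => //; apply: sqint_gauss => //.
  exact: lt_le_trans aa.
have : ae_eq mu HL (fun k => psi k - rhankel phi k) (cst 0).
  apply: (@gauss_eq0 _ _ a0).
  - by apply: measurable_funB; [exact: sqint_meas spsi|exact: measurable_rhankel].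
  - apply: (@eq_integrable_half_line (fun k => gauss a0 k * psi k - gauss a0 k * rhankel phi k)).
      by move=> k _; rewrite mulrBr.
    exact: (integrableB mH (igp _ (lexx _)) (ig _ (lexx _))).
  - move=> a aa; rewrite /ip.
    rewrite (_ : (fun k => _) = fun k => gauss a k * psi k - gauss a k * rhankel phi k); last first.
      by apply/funext => k; rewrite mulrBr.
    rewrite RintegralB; [|exact: mH|exact: igp|exact: ig].
    have [_ e] := @rhankel_gauss a (lt_le_trans aB aa).
    by rewrite -!/(ip _ _) e H ?subrr//; exact: lt_le_trans aa.
move=> ae0.
have ae : ae_eq mu HL psi (rhankel phi).
  by apply: filterS ae0 => k /[apply] /eqP; rewrite subr_eq0 => /eqP.
have srp := ae_sqint mH measurable_rhankel ae spsi.
exact: (weak_hankel_ae sphi srp (aeW mu (fun x _ => erefl)) ae Vpsi).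
Qed.

End hankel_integral_real.

(** * Smooth functions and test functions *)

Section smooth_half_line.
Implicit Types (f g h w phi : R -> R) (a b c p q x y z : R) (n k : nat).

Definition rsmooth f := forall n x, 0 < x -> derivable (derive1n n f) x 1.

(** Having k derivatives on the half-line, in the form that makes the closure
    properties below inductions on k. *)
Fixpoint cdiff k f : Prop :=
  if k is k'.+1 then (forall x, 0 < x -> derivable f x 1) /\ cdiff k' (derive1 f)
  else True.

Lemma cdiff_ext k f g : (forall x, 0 < x -> f x = g x) -> cdiff k f -> cdiff k g.
Proof.
elim: k f g => // k ih f g fg [df d1f].
have near0 x : 0 < x -> \forall y \near x, f y = g y.
  by move=> x0; near=> y; apply: fg; near: y; exact: lt_nbhsr.
split=> [x x0|].
  by have [] := der_near (derivable_der (df x x0)) (near0 x x0).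
apply: ih d1f => x x0.
by rewrite -(der_derive1 (der_near (derivable_der (df x x0)) (near0 x x0))).
Unshelve. all: by end_near. Qed.

Lemma cdiffS k f g : (forall x, 0 < x -> is_derive x 1 f (g x)) ->
  cdiff k g -> cdiff k.+1 f.
Proof.
move=> df dg; split=> [x x0|]; first by have [] := df x x0.
by apply: cdiff_ext dg => x x0; rewrite (der_derive1 (df x x0)).
Qed.

Lemma cdiff_derive k f x : cdiff k.+1 f -> 0 < x -> is_derive x 1 f (derive1 f x).
Proof. by move=> [df _] x0; exact: derivable_der (df x x0). Qed.

Lemma cdiffW k f : cdiff k.+1 f -> cdiff k f.
Proof.
elim: k f => // k ih f df.
have d x : 0 < x -> is_derive x 1 f (derive1 f x) by exact: cdiff_derive df.
by apply: (cdiffS d); apply: ih; case: df.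
Qed.

Lemma cdiff_cst k c : cdiff k (fun=> c).
Proof.
elim: k c => // k ih c.
have d x : 0 < x -> is_derive x 1 (fun=> c : R) 0 by move=> _; exact: der_cst.
exact: (cdiffS d (ih 0)).
Qed.

Lemma cdiff_id k : cdiff k (fun x => x).
Proof.
case: k => // k.
have d x : 0 < x -> is_derive x 1 (fun y : R => y) 1 by move=> _; exact: der_id.
exact: (cdiffS d (cdiff_cst k 1)).
Qed.

Lemma cdiffD k f g : cdiff k f -> cdiff k g -> cdiff k (fun x => f x + g x).
Proof.
elim: k f g => // k ih f g df dg.
have d x : 0 < x -> is_derive x 1 (fun y => f y + g y) (derive1 f x + derive1 g x).
  by move=> x0; exact: (derD (cdiff_derive df x0) (cdiff_derive dg x0)).
exact: (cdiffS d (ih _ _ df.2 dg.2)).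
Qed.

Lemma cdiffM k f g : cdiff k f -> cdiff k g -> cdiff k (fun x => f x * g x).
Proof.
elim: k f g => // k ih f g df dg.
have d x : 0 < x ->
    is_derive x 1 (fun y => f y * g y) (derive1 f x * g x + f x * derive1 g x).
  by move=> x0; exact: (derM (cdiff_derive df x0) (cdiff_derive dg x0)).
exact: (cdiffS d (cdiffD (ih _ _ df.2 (cdiffW dg)) (ih _ _ (cdiffW df) dg.2))).
Qed.

Lemma cdiff_comp k f w : (forall x, 0 < x -> 0 < w x) -> cdiff k f -> cdiff k w ->
  cdiff k (fun x => f (w x)).
Proof.
move=> w0; elim: k f => // k ih f df dw.
have d x : 0 < x -> is_derive x 1 (fun y => f (w y)) (derive1 f (w x) * derive1 w x).
  by move=> x0; exact: (der_comp (cdiff_derive df (w0 x x0)) (cdiff_derive dw x0)).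
exact: (cdiffS d (cdiffM (ih _ df.2 (cdiffW dw)) dw.2)).
Qed.

Lemma cdiff_powR k p : cdiff k (fun x => x `^ p).
Proof.
elim: k p => // k ih p.
have d x : 0 < x -> is_derive x 1 (fun y => y `^ p) (p * x `^ (p - 1)).
  by move=> x0; exact: is_derive1_powR.
exact: (cdiffS d (cdiffM (cdiff_cst k p) (ih (p - 1)))).
Qed.

Lemma cdiff_exp k f : cdiff k f -> cdiff k (fun x => expR (f x)).
Proof.
elim: k => // k ih df.
have d x : 0 < x -> is_derive x 1 (fun y => expR (f y)) (expR (f x) * derive1 f x).
  by move=> x0; exact: (der_exp (cdiff_derive df x0)).
exact: (cdiffS d (cdiffM (ih (cdiffW df)) df.2)).
Qed.

Lemma rsmoothP f : rsmooth f <-> forall k, cdiff k f.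
Proof.
split.
  move=> sf k; elim: k f sf => // k ih f sf; split; first exact: (sf 0%N).
  by apply: ih => n x x0; rewrite -derive1Sn; exact: sf.
move=> df n; elim: n f df => [|n ih] f df x x0; first by have [/(_ x x0)] := df 1%N.
rewrite derive1Sn; apply: ih => // k; by have [] := df k.+1.
Qed.

Lemma rsmooth_cst c : rsmooth (fun=> c).
Proof. by apply/rsmoothP => k; exact: cdiff_cst. Qed.

Lemma rsmoothD f g : rsmooth f -> rsmooth g -> rsmooth (fun x => f x + g x).
Proof. by move=> /rsmoothP sf /rsmoothP sg; apply/rsmoothP => k; exact: cdiffD. Qed.

Lemma rsmoothM f g : rsmooth f -> rsmooth g -> rsmooth (fun x => f x * g x).
Proof. by move=> /rsmoothP sf /rsmoothP sg; apply/rsmoothP => k; exact: cdiffM. Qed.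

Lemma rsmoothZ c f : rsmooth f -> rsmooth (fun x => c * f x).
Proof.
by move=> sf; exact (@rsmoothM (fun=> c) f (@rsmooth_cst c) sf).
Qed.

Lemma rsmooth_ext f g : (forall x, 0 < x -> f x = g x) -> rsmooth f -> rsmooth g.
Proof. by move=> fg /rsmoothP sf; apply/rsmoothP => k; exact: cdiff_ext (sf k). Qed.

Lemma rsmooth_derive1 f : rsmooth f -> rsmooth (derive1 f).
Proof. by move=> sf n x x0; rewrite -derive1Sn; exact: sf. Qed.

Lemma rsmooth_der f x : rsmooth f -> 0 < x -> is_derive x 1 f (derive1 f x).
Proof. by move=> sf x0; exact: derivable_der (sf 0%N x x0). Qed.

Lemma rsmooth_continuous f x : rsmooth f -> 0 < x -> {for x, continuous f}.
Proof. by move=> sf x0; exact: der_continuous (rsmooth_der sf x0). Qed.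

Lemma rsmooth_measurable f : rsmooth f -> measurable_fun HL f.
Proof.
by move=> sf; apply: half_line_continuous_measurable => x; exact: rsmooth_continuous.
Qed.

Lemma rsmooth_power_gaussian p b : rsmooth (pg p b).
Proof.
apply/rsmoothP => k; apply: cdiffM; first exact: cdiff_powR.
apply: cdiff_exp; apply: (@cdiff_ext k (fun x => - b * (x * x))).
  by move=> x _; rewrite expr2 mulNr.
apply: cdiffM; first exact: cdiff_cst.
by apply: cdiffM; exact: cdiff_id.
Qed.

Lemma derive1n2E f f1 f2 x : (forall x, 0 < x -> is_derive x 1 f (f1 x)) ->
  0 < x -> is_derive x 1 f1 (f2 x) -> derive1n 2 f x = f2 x.
Proof.
move=> d1 x0 d2; rewrite derive1Sn; apply: der_derive1.
apply: (der_near d2); near=> y; rewrite (der_derive1 (d1 y _))//.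
by near: y; exact: lt_nbhsr.
Unshelve. all: by end_near. Qed.

Lemma derive1n2_smooth f x : derive1n 2 f x = derive1 (derive1 f) x.
Proof. by rewrite derive1Sn. Qed.

Lemma continuous_bounded_on a b f : 0 < a ->
  (forall x, 0 < x -> {for x, continuous f}) ->
  exists2 K, 0 <= K & forall x, a <= x <= b -> `|f x| <= K.
Proof.
move=> a0 cf; have [ab|ba] := leP a b; last first.
  exists 0 => // x /andP[ax xb]; have := lt_le_trans ba (le_trans ax xb).
  by rewrite ltxx.
have cw : {within `[a, b], continuous (fun x => `|f x|)}.
  apply: continuous_in_subspaceT => x; rewrite inE/= in_itv/= => /andP[ax _].
  apply: continuous_comp; first by apply: cf; exact: lt_le_trans ax.
  exact: norm_continuous.
have [c _ Hc] := EVT_max ab cw.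
by exists `|f c| => // x xab; apply: Hc; rewrite in_itv.
Qed.

Definition rtest phi := rsmooth phi /\
  exists a b, 0 < a /\ (forall x, 0 < x -> x < a \/ b < x -> phi x = 0).

Lemma rtest_bounded phi : rtest phi -> exists B K, [/\ 0 < B,
  forall x, 0 < x -> `|phi x| <= K & forall x, B < x -> phi x = 0].
Proof.
move=> [sphi [a [b [a0 ab]]]].
have [K K0 HK] := continuous_bounded_on b a0 (fun x => rsmooth_continuous sphi).
exists (`|b| + 1), K; split => [|x x0|x bx].
- by rewrite ltr_wpDl.
- have [xa|ax] := ltP x a; first by rewrite ab ?normr0//; left.
  have [bx|xb] := ltP b x; first by rewrite ab ?normr0//; right.
  by apply: HK; rewrite ax.
- apply: ab; first by apply: lt_trans bx; rewrite ltr_wpDl.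
  by right; apply: le_lt_trans bx; rewrite (le_trans (ler_norm b))// lerDl.
Qed.

Lemma rtest_sqint phi : rtest phi -> sqint phi.
Proof.
move=> tphi; have [B [K [B0 HK HB]]] := rtest_bounded tphi.
exact: (sqint_bounded_support (rsmooth_measurable tphi.1) B0 HK HB).
Qed.

Lemma rtest0 : rtest (0 : R -> R).
Proof. by split; [exact: rsmooth_cst|exists 1, 1; split]. Qed.

Lemma rtest_lin c phi psi : rtest phi -> rtest psi -> rtest (c *: phi + psi).
Proof.
move=> [sphi [a [b [a0 ab]]]] [spsi [a' [b' [a0' ab']]]]; split.
  exact (@rsmoothD (fun x => c * phi x) psi (rsmoothZ (c := c) sphi) spsi).
exists (Num.min a a'), (Num.max b b'); split; first by rewrite lt_min a0.
move=> x x0 H; rewrite [LHS](_ : _ = c * phi x + psi x)// ab// ?ab'//.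
- by rewrite mulr0 addr0.
- by case: H; rewrite ?lt_min ?gt_max => /andP[? ?]; [left|right].
- by case: H; rewrite ?lt_min ?gt_max => /andP[? ?]; [left|right].
Qed.

Lemma rtestM phi f : rtest phi -> rsmooth f -> rtest (fun x => phi x * f x).
Proof.
move=> [sphi [a [b [a0 ab]]]] sf; split; first exact: rsmoothM.
by exists a, b; split => // x x0 H; rewrite ab// mul0r.
Qed.

Lemma rtest_derive1 phi : rtest phi -> rtest (derive1 phi).
Proof.
move=> [sphi [a [b [a0 ab]]]]; split; first exact: rsmooth_derive1.
exists a, b; split => // x x0 H.
apply: der_derive1; apply: (der_near (der_cst 0 x)).
case: H => H.
  near=> y; rewrite ab//; first by near: y; exact: lt_nbhsr.
  by left; near: y; exact: lt_nbhsl.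
near=> y; rewrite ab//; first by near: y; exact: lt_nbhsr.
by right; near: y; exact: lt_nbhsr.
Unshelve. all: by end_near. Qed.

Lemma rtest_near_infinity phi : rtest phi -> \forall n \near \oo, phi n.+1%:R = 0.
Proof.
move=> [_ [a [b [a0 ab]]]].
exists (Num.truncn `|b|).+1 => // n /= bn; apply: ab => //; right.
apply: (le_lt_trans (ler_norm b)).
by apply: (lt_le_trans (truncnS_gt _)); rewrite ler_nat; apply: leq_trans bn _.
Qed.

Lemma rtest_near_zero phi : rtest phi -> \forall n \near \oo, phi n.+1%:R^-1 = 0.
Proof.
move=> [_ [a [b [a0 ab]]]].
have := near_infty_natSinv_lt (PosNum a0); apply: filterS => n na.
by apply: ab; [rewrite invr_gt0|left].
Qed.

End smooth_half_line.

(** * The Bessel operator on smooth functions *)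

Section bessel_operator_tests.
Implicit Types (f g h w phi psi : R -> R) (a b c p q x y z : R) (n k : nat).

Definition rL f x : R := - derive1n 2 f x + (m ^+ 2 - 4^-1) * x ^- 2 * f x.

Lemma rLE f x : rL f x = - derive1 (derive1 f) x + (m ^+ 2 - 4^-1) * x ^- 2 * f x.
Proof. by rewrite /rL derive1n2_smooth. Qed.

Lemma rsmooth_rL f : rsmooth f -> rsmooth (rL f).
Proof.
move=> sf.
apply: (@rsmooth_ext (fun x => -1 * derive1 (derive1 f) x +
    (m ^+ 2 - 4^-1) * x `^ (-2) * f x)).
  move=> x x0; rewrite rLE mulN1r (_ : x `^ (-2) = x ^- 2)//.
  by rewrite powR_invn// ltW.
apply: rsmoothD.
  exact (rsmoothZ (c := -1) (rsmooth_derive1 (rsmooth_derive1 sf))).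
have sp : rsmooth (fun x : R => x `^ (-2)) by apply/rsmoothP => k; exact: cdiff_powR.
exact (rsmoothM (rsmoothZ (c := m ^+ 2 - 4^-1) sp) sf).
Qed.

Lemma rtest_rL phi : rtest phi -> rtest (rL phi).
Proof.
move=> tphi; have [sphi [a [b [a0 ab]]]] := tphi.
have [_ [a' [b' [a0' ab']]]] := rtest_derive1 (rtest_derive1 tphi).
split; first exact: rsmooth_rL.
exists (Num.min a a'), (Num.max b b'); split; first by rewrite lt_min a0.
move=> x x0 H; rewrite rLE ab' ?ab ?mulr0 ?oppr0 ?addr0//.
- by case: H; rewrite ?lt_min ?gt_max => /andP[? ?]; [left|right].
- by case: H; rewrite ?lt_min ?gt_max => /andP[? ?]; [left|right].
Qed.

Lemma rL_lin c phi psi x : rsmooth phi -> rsmooth psi -> 0 < x ->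
  rL (c *: phi + psi) x = c * rL phi x + rL psi x.
Proof.
move=> sphi spsi x0.
have d1 y : 0 < y -> is_derive y 1 (c *: phi + psi) (c * derive1 phi y + derive1 psi y).
  by move=> y0; exact (derD (derZ c (rsmooth_der sphi y0)) (rsmooth_der spsi y0)).
have d2 : is_derive x 1 (fun y => c * derive1 phi y + derive1 psi y)
    (c * derive1 (derive1 phi) x + derive1 (derive1 psi) x).
  exact (derD (derZ c (rsmooth_der (rsmooth_derive1 sphi) x0))
    (rsmooth_der (rsmooth_derive1 spsi) x0)).
rewrite !rLE -(derive1n2_smooth (c *: phi + psi)) (derive1n2E (f2 := fun x =>
  c * derive1 (derive1 phi) x + derive1 (derive1 psi) x) d1 x0 d2).
have -> : (c *: phi + psi) x = c * phi x + psi x by [].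
by move: (derive1 _ _) (derive1 _ _) (phi x) (psi x) => ? ? ? ?; ring.
Qed.

Definition L_gauss a x : R := (2 * (m + 1) * a - a ^+ 2 * x ^+ 2) * gauss a x.

Definition gauss' a x : R :=
  (2^-1 + m) * pg (2^-1 + m - 1) (a / 2) x - a * pg (2^-1 + m + 1) (a / 2) x.

Definition gauss'' a x : R := (m ^+ 2 - 4^-1) * x ^- 2 * gauss a x - L_gauss a x.

Lemma der_gauss a x : 0 < x -> is_derive x 1 (gauss a) (gauss' a x).
Proof.
move=> x0; apply: (der_eq (is_derive_power_gaussian _ _ x0)).
by rewrite /gauss' (_ : 2 * (a / 2) = a)//; field.
Qed.

Lemma der_gauss' a x : 0 < x -> is_derive x 1 (gauss' a) (gauss'' a x).
Proof.
move=> x0; have d p := is_derive_power_gaussian p (a / 2) x0.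
apply: (der_eq (derB (derZ (2^-1 + m) (d (2^-1 + m - 1))) (derZ a (d (2^-1 + m + 1))))).
have x20 : x ^+ 2 != 0 by rewrite expf_neq0// gt_eqF.
rewrite /gauss'' /L_gauss /gauss subrK addrK.
have -> : pg (2^-1 + m - 1 - 1) (a / 2) x = x ^- 2 * pg (2^-1 + m) (a / 2) x.
  have <- : x ^+ 2 * pg (2^-1 + m - 1 - 1) (a / 2) x = pg (2^-1 + m) (a / 2) x.
    by rewrite (power_gaussianX _ 2 _ x0); congr (pg _ _ x); ring.
  by rewrite mulKf.
have -> : pg (2^-1 + m + 1 + 1) (a / 2) x = x ^+ 2 * pg (2^-1 + m) (a / 2) x.
  by rewrite (power_gaussianX _ 2 _ x0) -addrA.
by field; rewrite gt_eqF.
Qed.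

Lemma rsmooth_gauss a : rsmooth (gauss a).
Proof. exact: rsmooth_power_gaussian. Qed.

Lemma rL_gauss a x : 0 < x -> rL (gauss a) x = L_gauss a x.
Proof.
move=> x0; rewrite /rL.
rewrite (derive1n2E (f2 := gauss'' a) (fun y => @der_gauss a y) x0 (der_gauss' a x0)).
by rewrite /gauss''; ring.
Qed.

Lemma sqint_sqr_gauss a : 0 < a -> sqint (fun x => x ^+ 2 * gauss a x).
Proof.
move=> a0.
have s : sqint (pg (2^-1 + m + 2) (a / 2)).
  by apply: sqint_power_gaussian; rewrite ?divr_gt0//; move: hm; lra.
apply: (le_sqint mH _ _ s).
- apply: measurable_funM; last exact: measurable_power_gaussian.
  by apply: measurable_funX.
- move=> x; rewrite half_lineE => x0.
  by rewrite (power_gaussianX _ 2 _ x0) ger0_norm// power_gaussian_ge0.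
Qed.

Lemma sqint_L_gauss a : 0 < a -> sqint (L_gauss a).
Proof.
move=> a0.
rewrite (_ : L_gauss a = (2 * (m + 1) * a) *: gauss a -
  (a ^+ 2) *: (fun x => x ^+ 2 * gauss a x)); last first.
  apply/funext => x; rewrite [RHS](_ : _ = 2 * (m + 1) * a * gauss a x -
    a ^+ 2 * (x ^+ 2 * gauss a x))// /L_gauss; ring.
apply: (sqintB mH); apply: (sqintZ mH); first exact: sqint_gauss.
exact: sqint_sqr_gauss.
Qed.

(** Green's formula: the boundary terms of gauss a and phi vanish since phi
    has compact support in the open half-line. *)
Lemma green_gauss a phi : 0 < a -> rtest phi ->
  ip (gauss a) (rL phi) = ip (L_gauss a) phi.
Proof.
move=> a0 tphi; have sphi := tphi.1.
have i1 := sqint_mul mH (sqint_L_gauss a0) (rtest_sqint tphi).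
have i2 := sqint_mul mH (sqint_gauss a0) (rtest_sqint (rtest_rL tphi)).
apply/eqP; rewrite eq_sym -subr_eq0; apply/eqP.
rewrite /ip -RintegralB//; last exact: mH.
apply: (@Rintegral_half_line_derive0
    (fun x => gauss a x * derive1 phi x - gauss' a x * phi x)).
- exact: (integrableB mH i1 i2).
- move=> x x0.
  apply: (der_eq (derB (derM (der_gauss a x0) (rsmooth_der (rsmooth_derive1 sphi) x0))
    (derM (der_gauss' a x0) (rsmooth_der sphi x0)))).
  by rewrite rLE /gauss''; ring.
- move=> x x0; apply: continuousB; apply: continuousM.
  + have sL : rsmooth (L_gauss a).
      exact: (rsmooth_ext (fun y => @rL_gauss a y) (rsmooth_rL (@rsmooth_gauss a))).
    exact: (rsmooth_continuous sL x0).
  + exact: (rsmooth_continuous sphi x0).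
  + exact: (rsmooth_continuous (@rsmooth_gauss a) x0).
  + exact: (rsmooth_continuous (rsmooth_rL sphi) x0).
- apply: cvg_near_cst.
  near=> n.
  have -> : derive1 phi n.+1%:R = 0 by near: n; exact: rtest_near_infinity (rtest_derive1 tphi).
  have -> : derive1 phi n.+1%:R^-1 = 0 by near: n; exact: rtest_near_zero (rtest_derive1 tphi).
  have -> : phi n.+1%:R = 0 by near: n; exact: rtest_near_infinity.
  have -> : phi n.+1%:R^-1 = 0 by near: n; exact: rtest_near_zero.
  by rewrite !mulr0 !subr0.
Unshelve. all: by end_near. Qed.

End bessel_operator_tests.

(** * Cutoffs and the minimal domain *)

Section cutoff_function.

Definition rLmin (f g : R -> R) := [/\ sqint f, sqint g &
  exists u : nat -> R -> R, [/\ forall n, rtest (u n), cvgL2 u f &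
    cvgL2 (fun n => rL (u n)) g]].

Definition rcutoff (f : R -> R) := [/\ rsmooth f, forall x, 0 < x <= 1 -> f x = 1 &
  forall x, 2 <= x -> f x = 0].

Variable eta : R -> R.
Hypothesis eta_cutoff : rcutoff eta.

Let seta : rsmooth eta. Proof. by case: eta_cutoff. Qed.
Let eta1 (x : R) : 0 < x -> x <= 1 -> eta x = 1.
Proof. by case: eta_cutoff => _ H _ x0 x1; apply: H; rewrite x0. Qed.
Let eta0 (x : R) : 2 <= x -> eta x = 0.
Proof. by case: eta_cutoff => _ _; apply. Qed.

Local Notation eta' := (derive1 eta).
Local Notation eta'' := (derive1 (derive1 eta)).

Section minimal_domain.
Implicit Types (f g h w phi psi : R -> R) (a b c p q r x y z : R) (n k : nat).

Lemma cutoff_derive1_eq0 x : 0 < x -> x < 1 \/ 2 < x -> eta' x = 0 /\ eta'' x = 0.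
Proof.
have E y : 0 < y -> y < 1 \/ 2 < y -> eta' y = 0.
  move=> y0 [y1|y2]; apply: der_derive1.
    apply: (der_near (der_cst 1 y)); near=> z; rewrite eta1//.
      by near: z; exact: lt_nbhsr.
    by apply: ltW; near: z; exact: lt_nbhsl.
  apply: (der_near (der_cst 0 y)); near=> z; rewrite eta0//.
  by apply: ltW; near: z; exact: lt_nbhsr.
move=> x0 H; split; first exact: E.
apply: der_derive1; apply: (der_near (der_cst 0 x)); case: H => H.
  near=> z; rewrite E//; first by near: z; exact: lt_nbhsr.
  by left; near: z; exact: lt_nbhsl.
near=> z; rewrite E//; first by near: z; exact: lt_nbhsr.
by right; near: z; exact: lt_nbhsr.
Unshelve. all: by end_near. Qed.

Lemma cutoff_bounds : exists2 K, 1 <= K & forall x, 0 < x ->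
  [/\ `|eta x| <= K, `|x * eta' x| <= K & `|x ^+ 2 * eta'' x| <= K].
Proof.
have [K0 K00 H0] := continuous_bounded_on 2 ltr01 (fun x => @rsmooth_continuous eta x seta).
have [K1 K10 H1] := continuous_bounded_on 2 ltr01
  (fun x => @rsmooth_continuous eta' x (rsmooth_derive1 seta)).
have [K2 K20 H2] := continuous_bounded_on 2 ltr01
  (fun x => @rsmooth_continuous eta'' x (rsmooth_derive1 (rsmooth_derive1 seta))).
exists (1 + K0 + 2 * K1 + 4 * K2); first by lra.
move=> x x0; have [x1|x1] := ltP x 1.
  have [-> ->] := cutoff_derive1_eq0 x0 (or_introl x1).
  by rewrite eta1 ?(ltW x1)// !mulr0 normr0 normr1; split; lra.
have [x2|x2] := ltP 2 x.
  have [-> ->] := cutoff_derive1_eq0 x0 (or_intror x2).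
  by rewrite eta0 ?(ltW x2)// !mulr0 normr0; split; lra.
have x12 : 1 <= x <= 2 by rewrite x1.
split; first by apply: (le_trans (H0 x x12)); lra.
- rewrite normrM (ger0_norm (ltW x0)).
  apply: (@le_trans _ _ (2 * K1)); last by lra.
  by rewrite ler_pM ?(ltW x0)// H1.
- rewrite normrM (ger0_norm (sqr_ge0 _)).
  apply: (@le_trans _ _ (4 * K2)); last by lra.
  rewrite ler_pM ?sqr_ge0 ?H2// (_ : 4 = 2 ^+ 2 :> R); last by ring.
  by rewrite lerXn2r ?nnegrE ?(ltW x0).
Qed.

(** A cutoff away from 0 and infinity whose derivatives of order j are bounded
    by a multiple of x^-j that does not depend on the scales N and M. *)
Definition band N M x : R := (1 - eta (N * x)) * eta (M * x).

Definition band' N M x : R :=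
  - (N * eta' (N * x)) * eta (M * x) + (1 - eta (N * x)) * (M * eta' (M * x)).

Definition band'' N M x : R :=
  - (N * (N * eta'' (N * x))) * eta (M * x) -
  2 * (N * eta' (N * x)) * (M * eta' (M * x)) +
  (1 - eta (N * x)) * (M * (M * eta'' (M * x))).

Let der_scaled f c x : rsmooth f -> 0 < c -> 0 < x ->
  is_derive x 1 (fun y => f (c * y)) (c * derive1 f (c * x)).
Proof.
move=> sf c0 x0; have cx0 : 0 < c * x by rewrite mulr_gt0.
apply: (der_eq (der_comp (rsmooth_der sf cx0) (derZ c (der_id x)))).
by rewrite mulr1 mulrC.
Qed.

Lemma der_band N M x : 0 < N -> 0 < M -> 0 < x ->
  is_derive x 1 (band N M) (band' N M x).
Proof.
move=> N0 M0 x0.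
apply: (der_eq (derM (derB (der_cst 1 x) (der_scaled seta N0 x0))
  (der_scaled seta M0 x0))).
by rewrite sub0r.
Qed.

Lemma der_band' N M x : 0 < N -> 0 < M -> 0 < x ->
  is_derive x 1 (band' N M) (band'' N M x).
Proof.
move=> N0 M0 x0; have s1 := rsmooth_derive1 seta.
apply: (der_eq (derD
  (derM (derN (derZ N (der_scaled s1 N0 x0))) (der_scaled seta M0 x0))
  (derM (derB (der_cst 1 x) (der_scaled seta N0 x0))
    (derZ M (der_scaled s1 M0 x0))))).
rewrite /band''.
move: (eta'' (N * x)) (eta'' (M * x)) (eta' (N * x)) (eta' (M * x)) (eta (N * x)) (eta (M * x)).
move=> *; ring.
Qed.

Lemma rtest_band N M : 0 < N -> 0 < M -> rtest (band N M).
Proof.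
move=> N0 M0.
have sc c : 0 < c -> rsmooth (fun x => eta (c * x)).
  move=> c0; move/rsmoothP : seta => se; apply/rsmoothP => k.
  apply: cdiff_comp (se k) _; first by move=> x x0; rewrite mulr_gt0.
  exact: (cdiffM (cdiff_cst k c) (cdiff_id k)).
split.
  apply: rsmoothM; last exact: sc.
  apply: (@rsmooth_ext (fun x => 1 + -1 * eta (N * x))).
    by move=> x _; rewrite mulN1r.
  exact (rsmoothD (@rsmooth_cst 1) (rsmoothZ (c := -1) (sc _ N0))).
exists N^-1, (2 / M); split; first by rewrite invr_gt0.
move=> x x0 [xl|xl]; rewrite /band.
  rewrite eta1 ?subrr ?mul0r// ?mulr_gt0//.
  by rewrite mulrC -ler_pdivlMr// mul1r ltW.
by rewrite (@eta0 (M * x)) ?mulr0// mulrC -ler_pdivrMr// ltW.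
Qed.

Lemma band_center N M x : 0 < N -> 0 < M -> 0 < x -> 2 < N * x -> M * x < 1 ->
  [/\ band N M x = 1, band' N M x = 0 & band'' N M x = 0].
Proof.
move=> N0 M0 x0 big small.
have [e1 e2] := cutoff_derive1_eq0 (mulr_gt0 N0 x0) (or_intror big).
have [e3 e4] := cutoff_derive1_eq0 (mulr_gt0 M0 x0) (or_introl small).
rewrite /band /band' /band'' e1 e2 e3 e4 (eta0 (ltW big)) (eta1 (mulr_gt0 M0 x0) (ltW small)).
by split; ring.
Qed.

Lemma band_bounds : exists2 C, 0 <= C & forall N M x, 0 < N -> 0 < M -> 0 < x ->
  [/\ `|band N M x| <= C, `|x * band' N M x| <= C & `|x ^+ 2 * band'' N M x| <= C].
Proof.
have [K K1 HK] := cutoff_bounds.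
have B1 : (1 + K) * K <= 4 * (1 + K) ^+ 2 by nra.
have B2 : K * K + (1 + K) * K <= 4 * (1 + K) ^+ 2 by nra.
have B3 : (K * K + 2 * (K * K)) + (1 + K) * K <= 4 * (1 + K) ^+ 2 by nra.
exists (4 * (1 + K) ^+ 2); first by rewrite mulr_ge0// sqr_ge0.
move=> N M x N0 M0 x0.
have [a0 a1 a2] := HK _ (mulr_gt0 N0 x0); have [c0 c1 c2] := HK _ (mulr_gt0 M0 x0).
have aA : `|1 - eta (N * x)| <= 1 + K.
  by apply: (le_trans (ler_normB _ _)); rewrite normr1 lerD2l.
have prod p q P Q : `|p| <= P -> `|q| <= Q -> `|p * q| <= P * Q.
  by move=> pP qQ; rewrite normrM ler_pM.
have E1 : x * band' N M x =
    - (N * x * eta' (N * x)) * eta (M * x) +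
    (1 - eta (N * x)) * (M * x * eta' (M * x)).
  rewrite /band'; move: (eta' (N * x)) (eta' (M * x)) (eta (N * x)) (eta (M * x)).
  by move=> *; ring.
have E2 : x ^+ 2 * band'' N M x =
    - ((N * x) ^+ 2 * eta'' (N * x)) * eta (M * x) -
    2 * ((N * x * eta' (N * x)) * (M * x * eta' (M * x))) +
    (1 - eta (N * x)) * ((M * x) ^+ 2 * eta'' (M * x)).
  rewrite /band''; move: (eta'' (N * x)) (eta'' (M * x)) (eta' (N * x)) (eta' (M * x)) (eta (N * x)) (eta (M * x)).
  by move=> *; ring.
split.
- exact: (le_trans (prod _ _ _ _ aA c0)).
- rewrite E1; apply: (le_trans (ler_normD _ _)); apply: le_trans B2; apply: lerD.
    by apply: prod; [rewrite normrN; exact: a1|exact: c0].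
  exact: prod aA c1.
- rewrite E2; apply: (le_trans (ler_normD _ _)); apply: le_trans B3.
  apply: lerD; last exact: prod aA c2.
  apply: (le_trans (ler_normB _ _)); apply: lerD.
    by apply: prod; [rewrite normrN; exact: a2|exact: c0].
  by rewrite normrM ger0_norm// ler_pM2l//; exact: prod a1 c1.
Qed.

Lemma rL_band N M f x : 0 < N -> 0 < M -> rsmooth f -> 0 < x ->
  rL (fun y => band N M y * f y) x =
  band N M x * rL f x - 2 * band' N M x * derive1 f x - band'' N M x * f x.
Proof.
move=> N0 M0 sf x0; have sf' := rsmooth_derive1 sf.
have d1 y : 0 < y -> is_derive y 1 (fun y => band N M y * f y)
    (band' N M y * f y + band N M y * derive1 f y).
  by move=> y0; exact: (derM (der_band N0 M0 y0) (rsmooth_der sf y0)).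
have d2 : is_derive x 1 (fun y => band' N M y * f y + band N M y * derive1 f y)
    ((band'' N M x * f x + band' N M x * derive1 f x) +
    (band' N M x * derive1 f x + band N M x * derive1 (derive1 f) x)).
  exact: (derD (derM (der_band' N0 M0 x0) (rsmooth_der sf x0))
    (derM (der_band N0 M0 x0) (rsmooth_der sf' x0))).
rewrite /rL (derive1n2E (f2 := fun x => (band'' N M x * f x + band' N M x * derive1 f x) +
    (band' N M x * derive1 f x + band N M x * derive1 (derive1 f) x)) d1 x0 d2).
rewrite derive1n2_smooth.
move: (derive1 (derive1 f) x) (derive1 f x) (band'' N M x) (band' N M x) (band N M x) (f x).
by move=> *; ring.
Qed.

(** Commuting the operator past the cutoff costs band' f' and band'' f, which
    the hypotheses make square integrable uniformly in the scales. *)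
Lemma rLmin_weighted f g : rsmooth f -> sqint g ->
  (forall x, 0 < x -> [/\ `|f x| <= g x, `|f x| <= x ^+ 2 * g x,
    `|derive1 f x| <= x * g x & `|derive1 (derive1 f) x| <= g x]) ->
  rLmin f (rL f).
Proof.
move=> sf sg fg.
have [C C0 HC] := band_bounds.
pose N n : R := n.+1%:R; pose M n := (N n)^-1.
have N0 n : 0 < N n by [].
have M0 n : 0 < M n by rewrite invr_gt0.
pose u n x := band (N n) (M n) x * f x.
have tu n : rtest (u n) by exact: rtestM (rtest_band (N0 n) (M0 n)) sf.
have mf := rsmooth_measurable sf.
have mLf := rsmooth_measurable (rsmooth_rL sf).
have g0 x : 0 < x -> 0 <= g x.
  by move=> x0; have [h _ _ _] := fg x x0; exact: le_trans h.
have band_ev x : 0 < x -> \forall n \near \oo, [/\ band (N n) (M n) x = 1,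
    band' (N n) (M n) x = 0 & band'' (N n) (M n) x = 0].
  move=> x0; have x20 : 0 < x / 2 by rewrite divr_gt0.
  have xV0 : 0 < x^-1 by rewrite invr_gt0.
  near=> n; apply: band_center => //.
    have : M n < x / 2 by near: n; exact: (near_infty_natSinv_lt (PosNum x20)).
    by rewrite /M invf_plt ?posrE// invf_div ltr_pdivrMr.
  have : M n < x^-1 by near: n; exact: (near_infty_natSinv_lt (PosNum xV0)).
  by rewrite -ltr_pdivlMr// mul1r.
pose c := `|m ^+ 2 - 4^-1|.
have Lf x : 0 < x -> `|rL f x| <= (1 + c) * g x.
  move=> x0; have [_ h1 _ h2] := fg x x0.
  rewrite rLE (_ : (1 + c) * g x = g x + c * g x); last by rewrite mulrDl mul1r.
  apply: (le_trans (ler_normD _ _)); apply: lerD.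
    by rewrite normrN.
  rewrite normrM normrM -mulrA ler_wpM2l//.
  rewrite ger0_norm ?invr_ge0 ?exprn_ge0 ?(ltW x0)// ler_pdivrMl ?exprn_gt0//.
have [su scf cu] : [/\ forall n, sqint (u n), sqint f & cvgL2 u f].
  apply: (@cvgL2_dominated _ _ _ mu HL mH u f (C *: g)) => //.
  - by move=> n; exact: rsmooth_measurable (tu n).1.
  - exact: (sqintZ mH).
  - move=> n x; rewrite half_lineE => x0; rewrite normrM.
    have [h _ _] := HC _ _ _ (N0 n) (M0 n) x0; have [h' _ _ _] := fg x x0.
    exact: ler_pM.
  - move=> x; rewrite half_lineE => x0; apply: cvg_near_cst.
    by apply: filterS (band_ev x x0) => n [e _ _]; rewrite /u e mul1r.
have [su' scLf cLu] : [/\ forall n, sqint (rL (u n)), sqint (rL f) &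
    cvgL2 (fun n => rL (u n)) (rL f)].
  apply: (@cvgL2_dominated _ _ _ mu HL mH (fun n => rL (u n)) (rL f) ((C * (1 + c) + 3 * C) *: g)) => //.
  - by move=> n; exact: rsmooth_measurable (rtest_rL (tu n)).1.
  - exact: (sqintZ mH).
  - move=> n x; rewrite half_lineE => x0; rewrite rL_band//.
    have [h0 h1 h2] := HC _ _ _ (N0 n) (M0 n) x0; have [k0 k1 k2 k3] := fg x x0.
    rewrite [leRHS](_ : _ = (C * ((1 + c) * g x) + 2 * (C * g x)) + C * g x); last first.
      by rewrite [LHS](_ : _ = (C * (1 + c) + 3 * C) * g x)//; ring.
    have q1 : `|band (N n) (M n) x * rL f x| <= C * ((1 + c) * g x).
      by rewrite normrM ler_pM// Lf.
    have q2 : `|2 * band' (N n) (M n) x * derive1 f x| <= 2 * (C * g x).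
      rewrite -mulrA normrM ger0_norm// ler_pM2l// normrM.
      apply: (@le_trans _ _ (`|band' (N n) (M n) x| * (x * g x))); first exact: ler_wpM2l.
      rewrite mulrA ler_wpM2r ?g0//.
      by move: h1; rewrite normrM (ger0_norm (ltW x0)) mulrC.
    have q3 : `|band'' (N n) (M n) x * f x| <= C * g x.
      rewrite normrM.
      apply: (@le_trans _ _ (`|band'' (N n) (M n) x| * (x ^+ 2 * g x))); first exact: ler_wpM2l.
      rewrite mulrA ler_wpM2r ?g0//.
      by move: h2; rewrite normrM (ger0_norm (sqr_ge0 x)) mulrC.
    apply: (le_trans (ler_normB _ _)); apply: lerD => //.
    by apply: (le_trans (ler_normB _ _)); apply: lerD.
  - move=> x; rewrite half_lineE => x0; apply: cvg_near_cst.
    apply: filterS (band_ev x x0) => n [e e1 e2]; rewrite rL_band// e e1 e2.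
    by rewrite mul1r mulr0 !mul0r !subr0.
by split => //; exists u.
Unshelve. all: by end_near. Qed.

End minimal_domain.

(** * Density of the test functions *)

Section test_functions_dense.
Implicit Types (f g h w phi psi : R -> R) (a b c p q x y z : R) (n k : nat).

(** Smooth approximations of the indicator function of ]0, b]. *)
Definition step N b x : R := (1 - eta (N * x)) * eta (expR (N * (x - b))).

Lemma rsmooth_step N b : 0 < N -> rsmooth (step N b).
Proof.
move=> N0; move/rsmoothP : (seta) => se; apply/rsmoothP => k.
have lin c d : cdiff k (fun x => c * (x + d)).
  exact: (cdiffM (cdiff_cst k c) (cdiffD (cdiff_id k) (cdiff_cst k d))).
have s1 : cdiff k (fun x => eta (N * x)).
  apply: (cdiff_comp _ (se k)); first by move=> x x0; rewrite mulr_gt0.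
  exact: (cdiffM (cdiff_cst k N) (cdiff_id k)).
have s2 : cdiff k (fun x => eta (expR (N * (x - b)))).
  apply: (cdiff_comp _ (se k)); first by move=> x x0; rewrite expR_gt0.
  exact: (cdiff_exp (lin N (- b))).
apply: (cdiffM _ s2); apply: (@cdiff_ext _ (fun x => 1 + -1 * eta (N * x))).
  by move=> x _; rewrite mulN1r.
exact: (cdiffD (cdiff_cst k 1) (cdiffM (cdiff_cst k (-1)) s1)).
Qed.

Lemma step_right N b x : 0 < N -> 1 <= N * (x - b) -> step N b x = 0.
Proof.
move=> N0 h; rewrite /step (@eta0 (expR _)) ?mulr0//.
by apply: le_trans (expR_ge1Dx _); lra.
Qed.

Lemma rtest_step N b : 1 <= N -> 0 < b -> rtest (step N b).
Proof.
move=> N1 b0; have N0 : 0 < N by apply: lt_le_trans N1.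
split; first exact: rsmooth_step.
exists N^-1, (b + 1); split; first by rewrite invr_gt0.
move=> x x0 [xl|xl].
  rewrite /step eta1 ?subrr ?mul0r// ?mulr_gt0//.
  by rewrite mulrC -ler_pdivlMr// mul1r ltW.
apply: step_right => //.
have : 1 * 1 <= N * (x - b) by apply: ler_pM => //; lra.
by rewrite mul1r.
Qed.

Lemma step_left N b x : 0 < N -> 0 < x -> x <= b -> 2 <= N * x -> step N b x = 1.
Proof.
move=> N0 x0 xb big; rewrite /step eta0// eta1 ?expR_gt0//; first by rewrite subr0 mulr1.
by rewrite -[leRHS]expR0 ler_expR pmulr_rle0// subr_le0.
Qed.

Lemma step_bound : exists2 C, 0 <= C & forall N b x, 0 < N -> 0 < x -> `|step N b x| <= C.
Proof.
have [K K1 HK] := cutoff_bounds; exists ((1 + K) * K).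
  by rewrite mulr_ge0//; lra.
move=> N b x N0 x0; have [k1 _ _] := HK _ (mulr_gt0 N0 x0).
have [k2 _ _] := HK _ (expR_gt0 (N * (x - b))).
rewrite normrM ler_pM//; apply: (le_trans (ler_normB _ _)).
by rewrite normr1 lerD2l.
Qed.

(** As N grows, the step functions tend to the indicator of ]0, b] and stay
    dominated by a multiple of a Gaussian, so q has integral 0 over ]0, b]. *)
Lemma rtest_orthogonal_eq0 (q : R -> R) : sqint q -> (forall phi, rtest phi -> ip q phi = 0) ->
  ae_eq mu HL q (cst 0).
Proof.
move=> sq q0; have mq := sqint_meas sq.
have [C C0 HC] := step_bound.
have sub b : `]0, b] `<=` HL by move=> x/=; rewrite in_itv/= half_lineE => /andP[].
have mb b : measurable (`]0, b] : set (measurableTypeR R)) by exact: measurable_itv.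
have sE : sqint (pg 0 1) by apply: sqint_power_gaussian => //; lra.
(* The Gaussian exceeds a positive constant on bounded sets. *)
have dom b x : 0 < x -> x <= b -> 1 <= expR (b ^+ 2) * pg 0 1 x.
  move=> x0 xb; have -> : pg 0 1 x = expR (- x ^+ 2).
    by rewrite /power_gaussian powRr0 (mul1r (expR _)) mul1r.
  rewrite -expRD -[leLHS]expR0 ler_expR subr_ge0.
  by rewrite lerXn2r ?nnegrE ?(ltW x0)// (le_trans (ltW x0)).
have sq1 : sqint (fun x => `|q x|).
  split; first exact: measurableT_comp.
  by apply: (eq_integrable_half_line _ sq.2) => x _; rewrite real_normK ?num_real.
have idom b : mu.-integrable HL (EFin \o (fun x => C * expR ((b + 1) ^+ 2) * (`|q x| * pg 0 1 x))).
  apply: integrableZl_real; exact: (sqint_mul mH sq1 sE).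
apply: ae_eq0_primitive => //.
  move=> b; apply: (@le_integrable_real _ _ _ mu _ (mb b) q
    (fun x => expR (b ^+ 2) * (`|q x| * pg 0 1 x))).
  - exact: (measurable_funS mH (sub b) mq).
  - move=> x /=; rewrite in_itv/= => /andP[x0 xb].
    by rewrite mulrCA -[leLHS]mulr1 ler_wpM2l// dom.
  - apply: (@integrableS _ _ _ mu HL) => //; first exact: mH.
    by apply: integrableZl_real; exact: (sqint_mul mH sq1 sE).
move=> b b0.
have lim : (fun n => \int[mu]_(x in HL) (q x * step n.+1%:R b x)) @ \oo -->
    \int[mu]_(x in HL) (q \_ `]0, b]) x.
  apply: (@Rintegral_dominated _ _ _ mu HL mH _ _ _ _ _ (idom b)).
  - move=> n; apply: measurable_funM => //; apply: rsmooth_measurable.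
    exact: rsmooth_step.
  - apply/(measurable_restrict q (mb b) mH).
    exact: (measurable_funS mH (@subIsetl _ _ _) mq).
  - move=> n x; rewrite half_lineE => x0; rewrite normrM.
    rewrite [leRHS](_ : _ = `|q x| * (C * (expR ((b + 1) ^+ 2) * pg 0 1 x))); last by ring.
    have n1 : 1 <= n.+1%:R :> R by rewrite ler1n.
    have n0 : 0 < n.+1%:R :> R by [].
    have [xb|xb] := leP x (b + 1).
      rewrite ler_wpM2l// -[leLHS]mulr1 ler_pM//; first exact: HC.
      exact: dom.
    rewrite step_right ?normr0 ?mulr0//.
      apply: mulr_ge0 => //; apply: mulr_ge0 => //.
      by apply: mulr_ge0; [exact: expR_ge0|exact: power_gaussian_ge0].
    have : 1 * 1 <= n.+1%:R * (x - b) by apply: ler_pM => //; lra.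
    by rewrite mul1r.
  - apply: aeW => x; rewrite half_lineE => x0; apply: cvg_near_cst; rewrite patchE.
    have [xb|bx] := leP x b.
      have x20 : 0 < x / 2 by rewrite divr_gt0.
      rewrite mem_set/= ?in_itv/= ?x0//; near=> n.
      rewrite step_left ?mulr1//.
      have : n.+1%:R^-1 < x / 2 by near: n; exact: (near_infty_natSinv_lt (PosNum x20)).
      by rewrite invf_plt ?posrE// invf_div ltr_pdivrMr// => /ltW.
    have xb0 : 0 < x - b by rewrite subr_gt0.
    rewrite memNset/= ?in_itv/= ?x0 ?leNgt ?bx//; near=> n.
    rewrite step_right ?mulr0//.
    have : n.+1%:R^-1 < x - b by near: n; exact: (near_infty_natSinv_lt (PosNum xb0)).
    by move/ltW; rewrite -div1r ler_pdivrMr// mulrC.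
have lim0 : (fun n => \int[mu]_(x in HL) (q x * step n.+1%:R b x)) @ \oo --> (0 : R).
  rewrite (_ : (fun n => _) = cst 0); first exact: cvg_cst.
  by apply/funext => n; apply: q0; apply: rtest_step => //; rewrite ler1n.
rewrite -(setIidr (sub b)) Rintegral_mkcondr.
exact: (cvg_unique _ lim lim0).
Unshelve. all: by end_near. Qed.

Lemma rtest_dense f : sqint f -> exists2 u, forall n, rtest (u n) & cvgL2 u f.
Proof.
apply: (L2_dense mH (S := rtest)).
- exact: rtest_sqint.
- exact: rtest0.
- by move=> c s t; exact: rtest_lin.
- exact: rtest_orthogonal_eq0.
Qed.

End test_functions_dense.

(** * The behaviour of order 1/2 + m at zero *)

Section singular_profile.
Local Notation s := (2^-1 + m).
Implicit Types (f g h w phi psi : R -> R) (a b c p q x y z : R) (n k : nat).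

Definition profile x : R := eta x * x `^ s.

Lemma rsmooth_profile : rsmooth profile.
Proof. by apply: (rsmoothM seta); apply/rsmoothP => k; exact: cdiff_powR. Qed.

Section difference.
Variable a : R.
Hypothesis a0 : 0 < a.

(* The difference of the two functions is x^s rho, with rho = O(x^2) at 0. *)
Let E x : R := expR (- (a / 2 * x ^+ 2)).
Let rho x : R := E x - eta x.
Let rho' x : R := - (a * x) * E x - eta' x.
Let rho'' x : R := (a ^+ 2 * x ^+ 2 - a) * E x - eta'' x.

Let der_E x : is_derive x 1 E (- (a * x) * E x).
Proof.
apply: (der_eq (der_exp (derN (derZ (a / 2) (der_sqr (der_id x)))))).
by rewrite -/(E x); field.
Qed.

Let der_rho x : 0 < x -> is_derive x 1 rho (rho' x).
Proof. by move=> x0; exact: (derB (der_E x) (rsmooth_der seta x0)). Qed.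

Let der_rho' x : 0 < x -> is_derive x 1 rho' (rho'' x).
Proof.
move=> x0; apply: (der_eq (derB (derM (derN (derZ a (der_id x))) (der_E x))
  (rsmooth_der (rsmooth_derive1 seta) x0))).
by rewrite /rho''; move: (E x) (eta'' x) => *; ring.
Qed.

Let rho_bounds : exists2 C, 0 <= C & forall x, 0 < x ->
  [/\ `|rho x| <= C * (x ^+ 2 * E x), `|rho' x| <= C * (x * E x) &
      `|rho'' x| <= C * ((1 + x ^+ 2) * E x)].
Proof.
have [K K1 HK] := cutoff_bounds.
pose e := expR (2 * a).
have e1 : 1 <= e by rewrite -[leLHS]expR0 ler_expR; move: a0; lra.
have e0 : 0 < e by exact: expR_gt0.
have a2 : 0 <= a ^+ 2 by exact: sqr_ge0.
have ae0 : 0 <= a * e by rewrite mulr_ge0// ltW.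
have Ke0 : 0 <= K * e by rewrite mulr_ge0 ?(ltW e0)//; lra.
pose D := 1 + a + a ^+ 2 + a * e + K * e.
have split_D y z : D * ((1 + y) * z) = D * z + D * (y * z) by ring.
exists D; first by rewrite /D; move: a0; lra.
move=> x x0.
have E0 : 0 < E x by exact: expR_gt0.
have x20 : 0 < x ^+ 2 by rewrite exprn_gt0.
have Ee y : x <= 2 -> 0 <= y -> y <= y * (e * E x).
  move=> x2 y0; rewrite -[leLHS]mulr1 ler_wpM2l// -expRD -[leLHS]expR0 ler_expR.
  have : a * x ^+ 2 <= a * 4.
    rewrite ler_pM2l// (_ : 4 = 2 ^+ 2 :> R); last by ring.
    by rewrite lerXn2r ?nnegrE ?(ltW x0).
  by move: (x ^+ 2) => *; lra.
have xE0 : 0 < x * E x by rewrite mulr_gt0.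
have x2E0 : 0 < x ^+ 2 * E x by rewrite mulr_gt0.
have aE : `|- (a * x) * E x| = a * (x * E x).
  by rewrite mulNr normrN -mulrA ger0_norm// mulr_ge0 ?(ltW a0)// ltW.
have aaE : `|(a ^+ 2 * x ^+ 2 - a) * E x| <= a ^+ 2 * (x ^+ 2 * E x) + a * E x.
  rewrite mulrBl -mulrA; apply: (le_trans (ler_normB _ _)).
  by rewrite !ger0_norm// mulr_ge0 ?(ltW a0) ?(ltW E0)// ltW.
have [x1|x1] := ltP x 1.
  have [z1 z2] := cutoff_derive1_eq0 x0 (or_introl x1).
  rewrite /rho /rho' /rho'' z1 z2 !subr0 (eta1 x0 (ltW x1)).
  split.
  - have E1 : E x <= 1.
      by rewrite -[leRHS]expR0 ler_expR oppr_le0 mulr_ge0 ?divr_ge0 ?(ltW a0) ?(ltW x20).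
    rewrite distrC ger0_norm ?subr_ge0//.
    have h1 : 1 - E x <= a / 2 * x ^+ 2.
      by have := expR_ge1Dx (- (a / 2 * x ^+ 2)); rewrite -/(E x); lra.
    have h2 := Ee (a * x ^+ 2) (ltac:(lra)) (mulr_ge0 (ltW a0) (ltW x20)).
    have h3 : (a * e) * (x ^+ 2 * E x) <= D * (x ^+ 2 * E x).
      by rewrite ler_wpM2r ?(ltW x2E0)//; rewrite /D; move: a0; lra.
    apply: le_trans h3; rewrite (_ : a * e * _ = a * x ^+ 2 * (e * E x)); last by ring.
    by apply: le_trans h2; move: (mulr_gt0 a0 x20); lra.
  - rewrite aE ler_wpM2r ?(ltW xE0)//; rewrite /D; move: a0; lra.
  - apply: (le_trans aaE).
    have h1 : (a + a ^+ 2) * (x ^+ 2 * E x) <= D * (x ^+ 2 * E x).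
      by rewrite ler_wpM2r ?(ltW x2E0)//; rewrite /D; move: a0; lra.
    have h2 : a * E x <= D * E x.
      by rewrite ler_wpM2r ?(ltW E0)//; rewrite /D; move: a0; lra.
    rewrite split_D addrC lerD//; apply: le_trans h1.
    by rewrite ler_wpM2r ?(ltW x2E0)//; rewrite /D; move: a0; lra.
have eta_le : [/\ `|eta x| <= K * (e * E x), `|eta' x| <= K * (e * E x) & `|eta'' x| <= K * (e * E x)].
  have KeE0 : 0 <= K * (e * E x) by rewrite !mulr_ge0 ?(ltW e0) ?(ltW E0)//; lra.
  have [x2|x2] := leP x 2; last first.
    have [-> ->] := cutoff_derive1_eq0 x0 (or_intror x2).
    by rewrite (eta0 (ltW x2)) normr0.
  have [k0 k1 k2] := HK x x0.
  have k := Ee K x2 (ltac:(lra)).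
  split; first exact: le_trans k0 k.
  + apply: le_trans k; apply: le_trans k1.
    by rewrite normrM (ger0_norm (ltW x0)) ler_peMl.
  + apply: le_trans k; apply: le_trans k2.
    by rewrite normrM (ger0_norm (ltW x20)) ler_peMl// expr_ge1// ltW.
have [n0 n1 n2] := eta_le.
have xx : E x <= x * E x by rewrite ler_peMl// ltW.
have xxx : E x <= x ^+ 2 * E x by rewrite ler_peMl ?(ltW E0)// expr_ge1// ltW.
have Kx y : E x <= y -> K * (e * E x) <= K * e * y.
  by move=> h; rewrite mulrA ler_wpM2l.
have pos y : E x <= y -> 0 <= y by move=> h; apply: le_trans h; exact: ltW.
have nn (p1 p2 p3 p4 : R) : 0 <= p1 -> 0 <= p2 -> 0 <= p3 -> 0 <= p4 -> 0 <= p1 + p2 + p3 + p4.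
  by move=> *; rewrite !addr_ge0.
split.
- apply: (le_trans (ler_normB _ _)).
  have k := Kx _ xxx; have p := pos _ xxx.
  rewrite (ger0_norm (ltW E0)); apply: (le_trans (lerD xxx (le_trans n0 k))).
  rewrite -[X in X + _]mul1r -mulrDl ler_wpM2r//; rewrite /D; move: a0; lra.
- apply: (le_trans (ler_normB _ _)).
  have k := Kx _ xx; have p := pos _ xx.
  rewrite aE; apply: (le_trans (lerD (lexx _) (le_trans n1 k))).
  rewrite -mulrDl ler_wpM2r//; rewrite /D; move: a0; lra.
- apply: (le_trans (ler_normB _ _)).
  have k := Kx _ xxx; have p := pos _ xxx.
  apply: (le_trans (lerD aaE (le_trans n2 k))).
  have q1 : a * E x <= D * E x.
    by rewrite ler_wpM2r ?(ltW E0)//; rewrite /D; move: a0; lra.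
  have q2 : (a ^+ 2 + K * e) * (x ^+ 2 * E x) <= D * (x ^+ 2 * E x).
    by rewrite ler_wpM2r//; rewrite /D; move: a0; lra.
  rewrite split_D.
  apply: (le_trans _ (lerD q1 q2)).
  by rewrite mulrDl; lra.
Qed.

Let r x : R := x `^ s * rho x.
Let r' x : R := s * x `^ (s - 1) * rho x + x `^ s * rho' x.
Let r'' x : R := (s * ((s - 1) * x `^ (s - 1 - 1)) * rho x + s * x `^ (s - 1) * rho' x) +
  (s * x `^ (s - 1) * rho' x + x `^ s * rho'' x).

Let der_pow p x : 0 < x -> is_derive x 1 (fun y : R => y `^ p) (p * x `^ (p - 1)).
Proof. by move=> x0; exact: is_derive1_powR. Qed.

Let der_r x : 0 < x -> is_derive x 1 r (r' x).
Proof. by move=> x0; exact: (derM (der_pow s x0) (der_rho x0)). Qed.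

Let der_r' x : 0 < x -> is_derive x 1 r' (r'' x).
Proof.
move=> x0; exact: (derD (derM (derZ s (der_pow (s - 1) x0)) (der_rho x0))
  (derM (der_pow s x0) (der_rho' x0))).
Qed.

Let rE : gauss a - profile = r.
Proof.
apply/funext => x; rewrite [LHS](_ : _ = gauss a x - profile x)//.
by rewrite /r /rho /gauss /power_gaussian /profile -/(E x); move: (E x) => *; ring.
Qed.

(** Both terms behave like x^(1/2+m) at 0, so their difference gains a factor
    x^2 there; this is what puts it into the minimal domain. *)
Lemma rLmin_gauss_profile : rLmin (gauss a - profile) (rL (gauss a - profile)).
Proof.
have [C C0 HC] := rho_bounds.
have g0 x : 0 <= gauss a x by exact: power_gaussian_ge0.
pose c := (1 + `|s| * `|s - 1| + 2 * `|s|) * C.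
have c0 : 0 <= c by rewrite mulr_ge0 ?addr_ge0 ?mulr_ge0.
have sr : rsmooth (gauss a - profile).
  apply: (@rsmooth_ext (fun x => gauss a x + -1 * profile x)).
    by move=> x _; rewrite mulN1r.
  exact (rsmoothD (@rsmooth_gauss a) (rsmoothZ (c := -1) rsmooth_profile)).
apply: (@rLmin_weighted _ (c *: (gauss a + (fun x => x ^+ 2 * gauss a x)))) => //.
  apply: (sqintZ mH); apply: (sqintD mH); first exact: sqint_gauss.
  exact: sqint_sqr_gauss.
move=> x x0; have [h0 h1 h2] := HC x x0.
have gE : gauss a x = x `^ s * E x by [].
have x20 : 0 < x ^+ 2 by rewrite exprn_gt0.
have P0 : 0 <= x `^ s by exact: powR_ge0.
have P1 : x * x `^ (s - 1) = x `^ s.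
  by rewrite -{1}[x]powRr1 ?ltW// -powRD_gt0//; congr (_ `^ _); ring.
have P2 : x ^+ 2 * x `^ (s - 1 - 1) = x `^ s.
  by rewrite -P1 -[x `^ (s - 1)](_ : x * x `^ (s - 1 - 1) = _) ?expr2 ?mulrA//
    -{1}[x]powRr1 ?ltW// -powRD_gt0//; congr (_ `^ _); ring.
rewrite rE -(derive1n2_smooth r) (derive1n2E (f2 := r'') der_r x0 (der_r' x0)).
rewrite (der_derive1 (der_r x0)).
rewrite (_ : (c *: _) x = c * ((1 + x ^+ 2) * gauss a x)); last first.
  by rewrite [LHS](_ : _ = c * (gauss a x + x ^+ 2 * gauss a x))//; ring.
have gx0 := g0 x.
have k0 : `|r x| <= C * (x ^+ 2 * gauss a x).
  rewrite /r normrM (ger0_norm P0).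
  apply: (le_trans (ler_wpM2l P0 h0)); rewrite gE; apply: eq_imp_le.
  by move: (E x) => ?; ring.
have t1 : `|s * x `^ (s - 1) * rho x| <= `|s| * C * (x * gauss a x).
  rewrite -mulrA normrM -mulrA ler_wpM2l// normrM (ger0_norm (powR_ge0 _ _)).
  apply: (le_trans (ler_wpM2l (powR_ge0 _ _) h0)); rewrite gE -P1; apply: eq_imp_le.
  by move: (E x) => ?; ring.
have t2 : `|x `^ s * rho' x| <= C * (x * gauss a x).
  rewrite normrM (ger0_norm P0).
  apply: (le_trans (ler_wpM2l P0 h1)); rewrite gE; apply: eq_imp_le.
  by move: (E x) => ?; ring.
have t3 : `|s * ((s - 1) * x `^ (s - 1 - 1)) * rho x| <= `|s| * `|s - 1| * C * gauss a x.
  rewrite (_ : s * _ * _ = s * (s - 1) * (x `^ (s - 1 - 1) * rho x)); last first.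
    by move: (x `^ _) (rho x) => *; ring.
  rewrite normrM (normrM s) -(mulrA (`|s| * `|s - 1|)) ler_wpM2l ?mulr_ge0//.
  rewrite normrM (ger0_norm (powR_ge0 _ _)).
  apply: (le_trans (ler_wpM2l (powR_ge0 _ _) h0)); rewrite gE -P2; apply: eq_imp_le.
  by move: (E x) => ?; ring.
have t4 : `|s * x `^ (s - 1) * rho' x| <= `|s| * C * gauss a x.
  rewrite -mulrA normrM -mulrA ler_wpM2l// normrM (ger0_norm (powR_ge0 _ _)).
  apply: (le_trans (ler_wpM2l (powR_ge0 _ _) h1)); rewrite gE -P1; apply: eq_imp_le.
  by move: (E x) => ?; ring.
have t5 : `|x `^ s * rho'' x| <= C * ((1 + x ^+ 2) * gauss a x).
  rewrite normrM (ger0_norm P0).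
  apply: (le_trans (ler_wpM2l P0 h2)); rewrite gE; apply: eq_imp_le.
  by move: (E x) => ?; ring.
have cC : C <= c.
  by rewrite /c -[leLHS]mul1r ler_wpM2r// -addrA lerDl addr_ge0 ?mulr_ge0.
have csC : `|s| * C + C <= c.
  rewrite /c -[X in _ + X]mul1r -mulrDl ler_wpM2r//.
  have := mulr_ge0 (normr_ge0 s) (normr_ge0 (s - 1)); have := normr_ge0 s; lra.
have w1 : x ^+ 2 * gauss a x <= (1 + x ^+ 2) * gauss a x.
  by rewrite ler_wpM2r// lerDr.
have w2 : gauss a x <= (1 + x ^+ 2) * gauss a x.
  by rewrite -[leLHS]mul1r ler_wpM2r// lerDl ltW.
have w0 : 0 <= (1 + x ^+ 2) * gauss a x by exact: le_trans gx0 w2.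
have x2g : 0 <= x ^+ 2 * gauss a x by rewrite mulr_ge0// ltW.
split.
- by apply: (le_trans k0); rewrite ler_pM.
- apply: (le_trans k0); rewrite mulrCA ler_wpM2l ?(ltW x20)//.
  by rewrite ler_pM.
- apply: (le_trans (ler_normD _ _)); apply: (le_trans (lerD t1 t2)).
  rewrite -mulrDl (mulrCA x c); apply: ler_pM => //.
  + by rewrite addr_ge0 ?mulr_ge0.
  + by rewrite mulr_ge0 ?(ltW x0).
  + by rewrite ler_wpM2l// ltW.
- have t4' := le_trans t4 (ler_wpM2l (mulr_ge0 (normr_ge0 s) C0) w2).
  have t3' := le_trans t3 (ler_wpM2l (mulr_ge0 (mulr_ge0 (normr_ge0 s) (normr_ge0 (s - 1))) C0) w2).
  apply: (le_trans (ler_normD _ _)).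
  apply: (le_trans (lerD (le_trans (ler_normD _ _) (lerD t3' t4')) (le_trans (ler_normD _ _) (lerD t4' t5)))).
  apply: eq_imp_le.
  by rewrite /c; move: (_ * gauss a x) => *; ring.
Qed.

End difference.

Lemma sqint_profile : sqint profile.
Proof.
have [sr _ _] := rLmin_gauss_profile ltr01.
rewrite (_ : profile = gauss 1 - (gauss 1 - profile)); last by rewrite subKr.
by apply: (sqintB mH) => //; exact: sqint_gauss.
Qed.

Lemma rL_profile a x : 0 < x -> rL (gauss a - profile) x = L_gauss a x - rL profile x.
Proof.
move=> x0; rewrite (_ : gauss a - profile = -1 *: profile + gauss a); last first.
  apply/funext => y; rewrite [RHS](_ : _ = -1 * profile y + gauss a y)//.
  by rewrite mulN1r addrC.
rewrite (rL_lin (-1) rsmooth_profile (@rsmooth_gauss a) x0).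
by rewrite rL_gauss// mulN1r addrC.
Qed.

Lemma sqint_rL_profile : sqint (rL profile).
Proof.
have [_ sr _] := rLmin_gauss_profile ltr01.
have sL := sqint_L_gauss ltr01.
apply: (ae_sqint mH _ _ (sqintB mH sL sr)).
  exact: rsmooth_measurable (rsmooth_rL rsmooth_profile).
apply: aeW => x; rewrite half_lineE => x0.
by rewrite [LHS](_ : _ = L_gauss 1 x - rL (gauss 1 - profile) x)// rL_profile// subKr.
Qed.

End singular_profile.

(** * The operator diagonalized by the transform *)

Section diagonal_operator.
Implicit Types (f g h u v w phi psi : R -> R) (a b c p q x y z : R) (n k : nat).

Local Notation sqr f := (fun x => x ^+ 2 * f x).

Lemma ip_sqr f g : ip f (sqr g) = ip (sqr f) g.
Proof. by apply: eq_Rintegral => x _; rewrite mulrCA mulrA. Qed.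

(** Multiplication by x^2 carried over by the transform, whose values u' and v'
    are determined only almost everywhere. *)
Definition diag u v := exists u' v',
  [/\ weak_hankel u u', weak_hankel v v' & ae_eq mu HL v' (sqr u')].

Lemma ip_gauss_sqr a b : 0 < a -> 0 < b ->
  ip (gauss a) (sqr (gauss b)) = 2 * (m + 1) / (a + b) * ip (gauss a) (gauss b).
Proof.
move=> a0 b0; have ab0 : 0 < a + b by rewrite addr_gt0.
have -> : ip (gauss a) (sqr (gauss b)) = moment (2 * m + 1 + 2) ((a + b) / 2).
  apply: eq_Rintegral => x; rewrite inE half_lineE => x0.
  rewrite /gauss mulrCA power_gaussianM// (power_gaussianX _ 2 _ x0).
  by congr (power_gaussian _ _ x); field.
rewrite ip_gauss moment_recursion ?divr_gt0//; last by move: hm; lra.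
by congr (_ * _); field; rewrite gt_eqF.
Qed.

Lemma sqint_sqr_gauss_hat a : 0 < a -> sqint (sqr (gauss_hat a)).
Proof.
move=> a0; have aV : 0 < a^-1 by rewrite invr_gt0.
rewrite (_ : sqr _ = a `^ (- (m + 1)) *: sqr (gauss a^-1)).
  by apply: (sqintZ mH); exact: sqint_sqr_gauss.
by apply/funext => x; exact: mulrCA.
Qed.

(** The recursion for the moments shows that L acts on a Gaussian as
    multiplication by x^2 acts on its transform. *)
Lemma weak_hankel_L_gauss a : 0 < a -> weak_hankel (L_gauss a) (sqr (gauss_hat a)).
Proof.
move=> a0; split; [exact: sqint_L_gauss|exact: sqint_sqr_gauss_hat|move=> b b0].
have aV : 0 < a^-1 by rewrite invr_gt0.
have bV : 0 < b^-1 by rewrite invr_gt0.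
have sb := sqint_gauss b0; have sa := sqint_gauss a0.
have sbV := sqint_gauss bV; have saV := sqint_gauss aV.
have ssa := sqint_sqr_gauss a0; have ssaV := sqint_sqr_gauss aV.
have [_ _ /(_ b b0)] := weak_hankel_gauss a0.
rewrite {1 2}/gauss_hat (ipZl mH _ sbV sa) (ipZr mH _ saV sb) => E.
have -> : sqr (gauss_hat a) = a `^ (- (m + 1)) *: sqr (gauss a^-1).
  by apply/funext => x; exact: mulrCA.
rewrite /gauss_hat (ipZl mH _ sbV (sqint_L_gauss a0)) (ipZr mH _ ssaV sb).
have -> : L_gauss a = (2 * (m + 1) * a) *: gauss a - (a ^+ 2) *: sqr (gauss a).
  apply/funext => x; rewrite [RHS](_ : _ = 2 * (m + 1) * a * gauss a x -
    a ^+ 2 * (x ^+ 2 * gauss a x))// /L_gauss; ring.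
rewrite (ipBr mH (sqintZ mH _ sa) (sqintZ mH _ ssa) sbV).
rewrite (ipZr mH _ sa sbV) (ipZr mH _ ssa sbV) !ip_gauss_sqr//.
rewrite [RHS]mulrCA -E.
move: (ip _ _) (b `^ _) => I P; field; rewrite !(gt_eqF a0, gt_eqF b0)/=.
have ab0 : 0 < a * b by exact: mulr_gt0.
by rewrite andbT; apply: lt0r_neq0; lra.
Qed.

Lemma diag_sqint u v : diag u v -> sqint u /\ sqint v.
Proof. by move=> [u' [v' [[su _ _] [sv _ _] _]]]. Qed.

Lemma ae_sqr_sqint u' v' : sqint u' -> sqint v' -> ae_eq mu HL v' (sqr u') -> sqint (sqr u').
Proof.
move=> su sv e; apply: (ae_sqint mH _ e sv).
by apply: measurable_funM; [exact: measurable_funX|exact: sqint_meas su].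
Qed.

(** Testing against the Gaussians turns membership into identities between
    integrals, which pass to limits. *)
Lemma diagP u v : diag u v <-> [/\ sqint u, sqint v &
  forall a, 0 < a -> ip (gauss a) v = ip (L_gauss a) u].
Proof.
split=> [[u' [v' [uu' vv' e]]]|[su sv H]].
  have [su su' _] := uu'; have [sv sv' _] := vv'; split => // a a0.
  rewrite -(weak_hankel_ip (weak_hankel_gauss a0) vv').
  rewrite -(weak_hankel_ip (weak_hankel_L_gauss a0) uu').
  rewrite (ip_ae_r mH sv' (ae_sqr_sqint su' sv' e) (sqint_gauss_hat a0) e).
  exact: ip_sqr.
have [u' uu'] := weak_hankel_total su; have [v' vv'] := weak_hankel_total sv.
have [_ su' _] := uu'; have [_ sv' _] := vv'.
exists u', v'; split => //.
have msu : measurable_fun HL (sqr u').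
  by apply: measurable_funM; [exact: measurable_funX|exact: sqint_meas su'].
have ig a : 0 < a -> mu.-integrable HL (EFin \o (fun x => gauss a x * sqr u' x)).
  move=> a0; apply: eq_integrable_half_line (sqint_mul mH (sqint_sqr_gauss a0) su') => x _.
  by rewrite (mulrC (x ^+ 2)) mulrA.
have ig' a : 0 < a -> mu.-integrable HL (EFin \o (fun x => gauss a x * v' x)).
  by move=> a0; exact: (sqint_mul mH (sqint_gauss a0) sv').
have : ae_eq mu HL (fun x => v' x - sqr u' x) (cst 0).
  apply: (@gauss_eq0 _ _ 1).
  - exact: measurable_funB (sqint_meas sv') msu.
  - apply: eq_integrable_half_line (integrableB mH (ig' 1 ltr01) (ig 1 ltr01)) => x _.
    by rewrite mulrBr.
  move=> a a1; have a0 : 0 < a by exact: lt_le_trans a1.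
  have aV : 0 < a^-1 by rewrite invr_gt0.
  have -> : ip (gauss a) (fun x => v' x - sqr u' x) = ip (gauss a) v' - ip (gauss a) (sqr u').
    rewrite /ip -RintegralB ?ig ?ig'//; last exact: mH.
    by apply: eq_Rintegral => x _; rewrite mulrBr.
  have E : gauss a = a `^ (- (m + 1)) *: gauss_hat a^-1 by exact: gauss_hatK.
  have := H a^-1 aV.
  rewrite -(weak_hankel_ip (weak_hankel_gauss aV) vv').
  rewrite -(weak_hankel_ip (weak_hankel_L_gauss aV) uu') => E'.
  rewrite {1}E (ipZl mH _ (sqint_gauss_hat aV) sv') E'.
  rewrite -(ipZl mH _ (sqint_sqr_gauss_hat aV) su').
  apply/eqP; rewrite subr_eq0; apply/eqP; apply: eq_Rintegral => x _.
  by rewrite E mulrCA mulrA; congr (_ * _); exact: mulrCA.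
by apply: filterS => x /[apply] /eqP; rewrite subr_eq0 => /eqP.
Qed.

Lemma diag_ae u u1 v v1 : sqint u1 -> sqint v1 -> ae_eq mu HL u u1 ->
  ae_eq mu HL v v1 -> diag u v -> diag u1 v1.
Proof.
move=> su1 sv1 uu1 vv1 /diagP[su sv H]; apply/diagP; split => // a a0.
rewrite -(ip_ae_r mH su su1 (sqint_L_gauss a0) uu1).
by rewrite -(ip_ae_r mH sv sv1 (sqint_gauss a0) vv1) H.
Qed.

Lemma diag_lin c u v u1 v1 : diag u v -> diag u1 v1 -> diag (c *: u + u1) (c *: v + v1).
Proof.
move=> /diagP[su sv H] /diagP[su1 sv1 H1]; apply/diagP; split.
- by apply: (sqintD mH) => //; exact: (sqintZ mH).
- by apply: (sqintD mH) => //; exact: (sqintZ mH).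
move=> a a0; have sa := sqint_gauss a0; have sLa := sqint_L_gauss a0.
rewrite (ipDr mH (sqintZ mH c sv) sv1 sa) (ipDr mH (sqintZ mH c su) su1 sLa).
by rewrite (ipZr mH c sv sa) (ipZr mH c su sLa) H// H1.
Qed.

Lemma diag_sym u v u1 v1 : diag u v -> diag u1 v1 -> ip v u1 = ip u v1.
Proof.
move=> [u' [v' [uu' vv' e]]] [u1' [v1' [uu1' vv1' e1]]].
rewrite -(weak_hankel_ip vv' uu1') -(weak_hankel_ip uu' vv1').
have [_ su' _] := uu'; have [_ sv' _] := vv'.
have [_ su1' _] := uu1'; have [_ sv1' _] := vv1'.
rewrite (ip_ae_r mH sv1' (ae_sqr_sqint su1' sv1' e1) su' e1).
rewrite (ip_ae_l mH sv' (ae_sqr_sqint su' sv' e) su1' e).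
exact/esym/ip_sqr.
Qed.

Lemma diag_ge0 u v : diag u v -> 0 <= ip u v.
Proof.
move=> [u' [v' [uu' vv' e]]]; rewrite -(weak_hankel_ip uu' vv').
have [_ su' _] := uu'; have [_ sv' _] := vv'.
rewrite (ip_ae_r mH sv' (ae_sqr_sqint su' sv' e) su' e).
apply: Rintegral_ge0 => x _; rewrite mulrCA; apply: mulr_ge0; first exact: sqr_ge0.
by rewrite -expr2 sqr_ge0.
Qed.

(** Nonnegativity makes 1 + L bounded below. *)
Lemma diag_norm_le u v : diag u v -> ip u u <= ip (u + v) (u + v).
Proof.
move=> duv; have [su sv] := diag_sqint duv.
by rewrite (ipDD mH su sv); have := diag_ge0 duv; have := ip_ge0 (mu:=mu) (D:=HL) v; lra.
Qed.

Lemma diag_opp_eq0 u v : diag u v -> ae_eq mu HL v (- u) -> ae_eq mu HL u (cst 0).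
Proof.
move=> duv e; have [su sv] := diag_sqint duv.
have := diag_ge0 duv; rewrite (ip_ae_r mH sv (sqintN mH su) su e).
rewrite [ip u _]ipC (ipNl mH su su) oppr_ge0 => le0.
by apply: (ip_eq0 mH su); apply/eqP; rewrite eq_le le0 ip_ge0.
Qed.

Lemma diag_closed us vs u v : (forall n, diag (us n) (vs n)) -> sqint u -> sqint v ->
  cvgL2 us u -> cvgL2 vs v -> diag u v.
Proof.
move=> d su sv cu cv; apply/diagP; split => // a a0.
have s n := (diag_sqint (d n)).
have l1 := cvgL2_ip mH (fun n => (s n).2) sv (sqint_gauss a0) cv.
have l2 := cvgL2_ip mH (fun n => (s n).1) su (sqint_L_gauss a0) cu.
rewrite [LHS]ipC [RHS]ipC; apply: (cvg_unique _ l1) => //.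
rewrite (_ : (fun n => _) = fun n => ip (us n) (L_gauss a))//.
apply/funext => n; have /diagP[_ _ /(_ a a0)] := d n.
by move=> E; rewrite [LHS]ipC [RHS]ipC.
Qed.

Lemma diag_rtest phi : rtest phi -> diag phi (rL phi).
Proof.
move=> tphi; apply/diagP; split; first exact: rtest_sqint.
  exact: rtest_sqint (rtest_rL tphi).
by move=> a a0; exact: green_gauss.
Qed.

Lemma diag_gauss a : 0 < a -> diag (gauss a) (L_gauss a).
Proof.
move=> a0; exists (gauss_hat a), (sqr (gauss_hat a)); split.
- exact: weak_hankel_gauss.
- exact: weak_hankel_L_gauss.
- by apply: aeW.
Qed.

Lemma rLmin_diag f g : rLmin f g -> diag f g.
Proof.
move=> [sf sg [u [tu uf ug]]]; apply: diag_closed uf ug => // n.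
exact: diag_rtest.
Qed.

Lemma rLmin_sqint f g : rLmin f g -> sqint f /\ sqint g. Proof. by case. Qed.

Lemma rLmin_lin c f g f1 g1 : rLmin f g -> rLmin f1 g1 ->
  rLmin (c *: f + f1) (c *: g + g1).
Proof.
move=> [sf sg [u [tu uf ug]]] [sf1 sg1 [u1 [tu1 uf1 ug1]]]; split.
- by apply: (sqintD mH) => //; exact: (sqintZ mH).
- by apply: (sqintD mH) => //; exact: (sqintZ mH).
have su n := rtest_sqint (tu n); have su1 n := rtest_sqint (tu1 n).
have sLu n := rtest_sqint (rtest_rL (tu n)).
have sLu1 n := rtest_sqint (rtest_rL (tu1 n)).
exists (fun n => c *: u n + u1 n); split.
- by move=> n; exact: rtest_lin.
- apply: (cvgL2D mH) => //; [|exact: (sqintZ mH)|exact: (cvgL2Z mH)].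
  by move=> n; exact: (sqintZ mH).
- have : cvgL2 (fun n => c *: rL (u n) + rL (u1 n)) (c *: g + g1).
    apply: (cvgL2D mH) => //; [|exact: (sqintZ mH)|exact: (cvgL2Z mH)].
    by move=> n; exact: (sqintZ mH).
  apply: eq_cvgL2 => n x; rewrite half_lineE => x0.
  by rewrite (rL_lin c (tu n).1 (tu1 n).1 x0).
Qed.

(** Approximate h by functions phi + L phi. Since L is nonnegative the phi
    converge as well, so the part of h that is captured is (1 + L) of an
    element of the minimal domain. *)
Lemma rLmin_projection h : sqint h -> exists f0 g0, rLmin f0 g0 /\
  forall phi, rtest phi -> ip (h - (f0 + g0)) (phi + rL phi) = 0.
Proof.
move=> sh.
pose S (s : R -> R) := exists2 phi, rtest phi & forall x, 0 < x -> s x = phi x + rL phi x.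
have sS s : S s -> sqint s.
  move=> [phi tphi E].
  have sL := sqintD mH (rtest_sqint tphi) (rtest_sqint (rtest_rL tphi)).
  apply: (le_sqint mH (g := fun x => `|phi x + rL phi x|)).
  - apply: (eq_measurable_fun (phi + rL phi)); last exact: sqint_meas sL.
    by move=> x; rewrite inE half_lineE => x0; rewrite E.
  - by move=> x; rewrite half_lineE => x0; rewrite E.
  - split; first by apply: measurableT_comp => //; exact: sqint_meas sL.
    by apply: (eq_integrable_half_line _ sL.2) => x _; rewrite real_normK ?num_real.
have S0 : S 0.
  exists 0; first exact: rtest0.
  move=> x x0; rewrite rLE.
  have d0 : derive1 (0 : R -> R) = 0.
    by apply/funext => y; rewrite (der_derive1 (der_cst 0 y)).
  by rewrite !d0 [LHS](_ : _ = 0)// [(0 : R -> R) x](_ : _ = 0)// oppr0 mulr0 !addr0.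
have S_lin c s t : S s -> S t -> S (c *: s + t).
  move=> [phi tphi E] [psi tpsi E']; exists (c *: phi + psi); first exact: rtest_lin.
  move=> x x0; rewrite (rL_lin c tphi.1 tpsi.1 x0).
  rewrite [LHS](_ : _ = c * s x + t x)// E// E'// [(c *: phi + psi) x](_ : _ = c * phi x + psi x)//.
  by move: (rL phi x) (rL psi x) => *; ring.
have [p [s [sp Ss cs hp]]] := L2_projection mH sS S0 S_lin sh.
have /choice[u tu] : forall n, exists phi, rtest phi /\ forall x, 0 < x -> s n x = phi x + rL phi x.
  by move=> n; have [phi ? ?] := Ss n; exists phi.
have su n := rtest_sqint (tu n).1.
have ss n := sS _ (Ss n).
have [f0 sf0 cu] : exists2 f, sqint f & cvgL2 u f.
  apply: (L2_complete mH su) => e e0.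
  have [N HN] := cvgL2_Cauchy mH ss sp cs e0.
  exists N => n k Nn Nk; apply: le_trans (HN n k Nn Nk).
  have d : diag (-1 *: u k + u n) (-1 *: rL (u k) + rL (u n)).
    by apply: diag_lin; apply: diag_rtest; [exact: (tu k).1|exact: (tu n).1].
  have := diag_norm_le d.
  rewrite (_ : ip (_ + _ + _) _ = ip (s n - s k) (s n - s k)).
    by rewrite scaleN1r addrC.
  apply: eq_Rintegral => x; rewrite inE half_lineE => x0.
  rewrite [(s n - s k) x](_ : _ = s n x - s k x)// (tu n).2// (tu k).2//.
  rewrite [(_ + _ + _) x](_ : _ = (-1 * u k x + u n x) + (-1 * rL (u k) x + rL (u n) x))//.
  by move: (rL _ x) (rL _ x) => *; ring.
exists f0, (p - f0); split.
  split => //; first exact: (sqintB mH).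
  exists u; split => //; first by move=> n; exact: (tu n).1.
  have := cvgL2D mH ss (fun n => sqintZ mH (-1) (su n)) sp (sqintZ mH (-1) sf0) cs
    (cvgL2Z mH (-1) su sf0 cu).
  apply: eq_cvgL2 => n x; rewrite half_lineE => x0.
  rewrite [(p - f0) x](_ : _ = p x - f0 x)//.
  rewrite [(s + _) n x](_ : _ = s n x + -1 * u n x)//.
  rewrite [(p + _) x](_ : _ = p x + -1 * f0 x)// (tu n).2//.
  by move: (rL _ x) => *; ring.
move=> phi tphi; rewrite (_ : f0 + (p - f0) = p); first by apply: hp; exists phi.
by rewrite addrC subrK.
Qed.

Lemma rLmin_orthogonal (q : R -> R) f g : sqint q -> rLmin f g ->
  (forall phi, rtest phi -> ip q (phi + rL phi) = 0) -> ip q (f + g) = 0.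
Proof.
move=> sq [sf sg [u [tu cu cv]]] H.
have su n := rtest_sqint (tu n); have sLu n := rtest_sqint (rtest_rL (tu n)).
have l := cvgL2_ip mH (fun n => sqintD mH (su n) (sLu n)) (sqintD mH sf sg) sq
  (cvgL2D mH su sLu sf sg cu cv).
rewrite [LHS]ipC; apply: (cvg_unique _ l) => //.
rewrite (_ : (fun n => _) = cst 0); first exact: cvg_cst.
by apply/funext => n; rewrite [LHS]ipC H.
Qed.

End diagonal_operator.

(** * The domain of the diagonalized operator *)

Section self_adjoint_domain.
Implicit Types (f g h u v w phi psi : R -> R) (a b c p q x y z : R) (n k : nat).

Let sp : sqint profile. Proof. exact: sqint_profile. Qed.
Let sLp : sqint (rL profile). Proof. exact: sqint_rL_profile. Qed.

Lemma diag_profile : diag profile (rL profile).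
Proof.
have d1 := rLmin_diag (rLmin_gauss_profile ltr01).
have d2 := diag_lin (-1) d1 (diag_gauss ltr01).
apply: (diag_ae sp sLp _ _ d2); apply: aeW => x; rewrite half_lineE => x0.
  rewrite [LHS](_ : _ = -1 * (gauss 1 x - profile x) + gauss 1 x)//.
  by move: (gauss 1 x) => ?; ring.
rewrite [LHS](_ : _ = -1 * rL (gauss 1 - profile) x + L_gauss 1 x)//.
by rewrite rL_profile//; move: (L_gauss 1 x) => ?; ring.
Qed.

Definition rH u v := [/\ sqint u, sqint v,
  forall phi, rtest phi -> ip u (rL phi) = ip v phi &
  exists c f0 g0, rLmin f0 g0 /\ ae_eq mu HL u (f0 + c *: profile)].

(** Up to the minimal domain, (1 + L) of a Gaussian is a multiple of (1 + L)
    profile, so q is orthogonal to it. Thus L q = - q in the sense of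
    [diagP], and L is nonnegative. *)
Lemma orthogonal_complement_line (q : R -> R) : sqint q ->
  (forall phi, rtest phi -> ip q (phi + rL phi) = 0) ->
  ip q (profile + rL profile) = 0 -> ae_eq mu HL q (cst 0).
Proof.
move=> sq q0 qp.
suff d : diag q (- q) by apply: (diag_opp_eq0 d); apply: aeW.
apply/(diagP); split => //; first exact: (sqintN mH).
move=> a a0; have sa := sqint_gauss a0; have sLa := sqint_L_gauss a0.
have [sr sLr _] := rLmin_gauss_profile a0.
have := rLmin_orthogonal sq (rLmin_gauss_profile a0) q0.
rewrite (ipDr mH sr sLr sq) (ipBr mH sa sp sq).
rewrite (_ : ip q (rL (gauss a - profile)) = ip q (L_gauss a - rL profile)); last first.
  apply: eq_Rintegral => x; rewrite inE half_lineE => x0.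
  by rewrite rL_profile.
rewrite (ipBr mH sLa sLp sq); move: qp; rewrite (ipDr mH sp sLp sq).
rewrite [ip (gauss a) _]ipC [ip (L_gauss a) _]ipC (ipNl mH sq sa).
by move: (ip _ _) (ip _ _) (ip _ _) (ip _ _) => *; lra.
Qed.

(** Subtract from u + v its part in the closure of the functions (1 + L) phi,
    and from the rest q its component along e, the part of (1 + L) profile
    orthogonal to that closure. Nothing remains. Collecting the
    corresponding elements of the domain gives w with L w = - w, hence w =
    0. *)
Lemma diag_decomposition u v : diag u v ->
  exists c f0 g0, rLmin f0 g0 /\ ae_eq mu HL u (f0 + c *: profile).
Proof.
move=> d; have [su sv] := diag_sqint d.
have [f0 [g0 [l0 q0]]] := rLmin_projection (sqintD mH su sv).
have [fe [ge [le qe]]] := rLmin_projection (sqintD mH sp sLp).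
have [sf0 sg0] := rLmin_sqint l0; have [sfe sge] := rLmin_sqint le.
pose q : R -> R := u + v - (f0 + g0).
pose e : R -> R := profile + rL profile - (fe + ge).
have sq : sqint q by exact: (sqintB mH (sqintD mH su sv) (sqintD mH sf0 sg0)).
have se : sqint e by exact: (sqintB mH (sqintD mH sp sLp) (sqintD mH sfe sge)).
pose c := ip q e / ip e e.
have ce : ip q e = c * ip e e.
  rewrite /c; have [e0|e0] := eqVneq (ip e e) 0; last by rewrite divfK.
  rewrite e0 mulr0 -(ip0r (mu:=mu) (D:=HL) q).
  exact: (ip_ae_r mH se sqint0 sq (ip_eq0 mH se e0)).
have sce := sqintZ mH c se.
have r0 : ae_eq mu HL (q - c *: e) (cst 0).
  have orth phi : rtest phi -> ip (q - c *: e) (phi + rL phi) = 0.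
    move=> tphi; have st := sqintD mH (rtest_sqint tphi) (rtest_sqint (rtest_rL tphi)).
    by rewrite (ipBl mH sq sce st) (ipZl mH c se st) q0// qe// mulr0 subrr.
  apply: orthogonal_complement_line => //; first exact: (sqintB mH).
  rewrite (_ : profile + rL profile = e + (fe + ge)); last by rewrite subrK.
  have sr := sqintB mH sq sce.
  rewrite (ipDr mH se (sqintD mH sfe sge) sr) (rLmin_orthogonal sr le orth).
  by rewrite (ipBl mH sq sce se) (ipZl mH c se se) ce subrr addr0.
have dw : diag (- c *: (-1 *: fe + profile) + (-1 *: f0 + u))
    (- c *: (-1 *: ge + rL profile) + (-1 *: g0 + v)).
  apply: diag_lin => //; apply: diag_lin => //; first exact: rLmin_diag.
    exact: diag_profile.
  exact: rLmin_diag.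
exists c, (- c *: fe + f0), (- c *: ge + g0); split; first exact: rLmin_lin.
have : ae_eq mu HL (- c *: (-1 *: ge + rL profile) + (-1 *: g0 + v))
    (- (- c *: (-1 *: fe + profile) + (-1 *: f0 + u))).
  apply: filterS r0 => x /[apply].
  rewrite [(q - c *: e) x](_ : _ = u x + v x - (f0 x + g0 x) -
    c * (profile x + rL profile x - (fe x + ge x)))// => E.
  rewrite [LHS](_ : _ = - c * (-1 * ge x + rL profile x) + (-1 * g0 x + v x))//.
  rewrite [RHS](_ : _ = - (- c * (-1 * fe x + profile x) + (-1 * f0 x + u x)))//.
  by apply/eqP; rewrite -subr_eq0; apply/eqP; rewrite -[RHS]E; move: (rL profile x) => *; ring.
move=> /(diag_opp_eq0 dw); apply: filterS => x /[apply].
rewrite [(_ + _) x](_ : _ = - c * (-1 * fe x + profile x) + (-1 * f0 x + u x))// => E.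
rewrite [RHS](_ : _ = - c * fe x + f0 x + c * profile x)//.
by apply/eqP; rewrite -subr_eq0; apply/eqP; rewrite -[RHS]E; ring.
Qed.

(** From left to right, v and the value that [diag] assigns to u have the same
    pairings with test functions, and these are dense. *)
Lemma rH_diag u v : rH u v <-> diag u v.
Proof.
split=> [[su sv uv [c [f0 [g0 [l0 e]]]]]|d].
  have [sf0 sg0] := rLmin_sqint l0.
  have d0 := diag_lin c diag_profile (rLmin_diag l0).
  have [su1 sv1] := diag_sqint d0.
  have e1 : ae_eq mu HL (c *: profile + f0) u by rewrite addrC; exact: ae_eq_sym.
  have d1 := diag_ae su sv1 e1 (ae_eq_refl _ _ _) d0.
  apply: (diag_ae su sv (ae_eq_refl _ _ _) _ d1).
  have s := sqintB mH sv1 sv.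
  have : ae_eq mu HL (c *: rL profile + g0 - v) (cst 0).
    apply: (rtest_orthogonal_eq0 s) => phi tphi.
    have sphi := rtest_sqint tphi.
    rewrite (ipBl mH sv1 sv sphi) (diag_sym d1 (diag_rtest tphi)) uv//.
    by rewrite subrr.
  by apply: filterS => x /[apply] /eqP; rewrite [(_ - _) x](_ : _ = (c *: rL profile + g0) x - v x)// subr_eq0 => /eqP.
have [su sv] := diag_sqint d; split => //.
- by move=> phi tphi; exact/esym/(diag_sym d (diag_rtest tphi)).
- exact: diag_decomposition d.
Qed.

End self_adjoint_domain.

(** * Dilations *)

Section dilation.
Implicit Types (f g : R -> R) (a b c t x : R).

Definition dilate t f x := expR (t / 2) * f (expR t * x).

Lemma sqint_dilate t f : sqint f -> sqint (dilate t f).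
Proof.
move=> [mf i_f]; have t0 := expR_gt0 t; split.
  by apply: measurable_funM; [exact: measurable_cst|exact: measurable_half_line_scale].
apply: (eq_integrable_half_line (f := fun x => expR t * f (expR t * x) ^+ 2)).
  move=> x _; rewrite /dilate exprMn -expRM_natl; congr (expR _ * _); by field.
apply: integrableZl_real.
exact: (integrable_half_line_scale t0 (f := fun x => f x ^+ 2)).
Qed.

Lemma ip_dilate t f g : sqint f -> sqint g -> ip (dilate t f) g = ip f (dilate (- t) g).
Proof.
move=> sf sg.
rewrite [RHS](Rintegral_half_line_scale (expR_gt0 t)); last first.
  exact: (sqint_mul mH sf (sqint_dilate (- t) sg)).
rewrite -RintegralZl//; last 2 first.
- exact: mH.
- apply: (integrable_half_line_scale (expR_gt0 t) (f := fun x => f x * dilate (- t) g x)).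
  exact: (sqint_mul mH sf (sqint_dilate (- t) sg)).
apply: eq_Rintegral => x _; rewrite /dilate.
rewrite (_ : expR (- t) * (expR t * x) = x); last by rewrite mulrA -expRD addNr expR0 mul1r.
have -> : expR (t / 2) = expR t * expR (- t / 2) by rewrite -expRD; congr expR; field.
by move: (expR _) (expR _) (f _) (g _) => *; ring.
Qed.

Lemma dilate_gauss t a x : 0 < x ->
  dilate t (gauss a) x = expR (t * (m + 1)) * gauss (expR (2 * t) * a) x.
Proof.
move=> x0; rewrite /dilate /gauss /power_gaussian powRM ?expR_ge0 ?(ltW x0)//.
rewrite -expRM mulrA mulrA -expRD mulrA; congr (expR _ * _ * expR _); first by field.
by rewrite exprMn -expRM_natl; move: (expR _) => e; field.
Qed.

(** Dilations carry Gaussians to multiples of Gaussians, and their transforms in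
    the opposite direction. *)
Lemma weak_hankel_dilate t f g : weak_hankel f g ->
  weak_hankel (dilate t f) (dilate (- t) g).
Proof.
move=> [sf sg H]; split; [exact: sqint_dilate|exact: sqint_dilate|move=> a a0].
have ea0 : 0 < expR (2 * t) * a by rewrite mulr_gt0// expR_gt0.
have sa := sqint_gauss a0; have sha := sqint_gauss_hat a0.
have sea := sqint_gauss ea0; have sehea := sqint_gauss_hat ea0.
rewrite (ip_dilate t sf sha) || rewrite [LHS]ipC (ip_dilate t sf sha).
rewrite [RHS]ipC (ip_dilate (- t) sg sa) opprK.
have -> : ip g (dilate t (gauss a)) = expR (t * (m + 1)) * ip (gauss (expR (2 * t) * a)) g.
  rewrite -(ipZl mH _ sea sg) [LHS]ipC; apply: eq_Rintegral => x; rewrite inE half_lineE => x0.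
  by rewrite dilate_gauss.
rewrite -H// -(ipZl mH _ sehea sf) [LHS]ipC; apply: eq_Rintegral => x.
rewrite inE half_lineE => x0; congr (_ * _).
rewrite [LHS](_ : _ = a `^ (- (m + 1)) * dilate (- t) (gauss a^-1) x); last first.
  by rewrite /dilate mulrCA.
rewrite dilate_gauss// [RHS](_ : _ = expR (t * (m + 1)) *
  ((expR (2 * t) * a) `^ (- (m + 1)) * gauss (expR (2 * t) * a)^-1 x))//.
rewrite powRM ?expR_ge0 ?(ltW a0)// -expRM invfM -expRN.
rewrite mulrA (mulrC (a `^ _)) -!mulrA mulrA [RHS]mulrA -expRD.
rewrite -mulrA; congr (expR _ * (_ * gauss (expR _ / _) x)); ring.
Qed.

End dilation.

(** * Real and imaginary parts *)

Section complex_L2.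
Local Open Scope complex_scope.
Implicit Types (f g h u v : R -> R[i]) (x : R).

Definition re f x := complex.Re (f x).
Definition im f x := complex.Im (f x).

Lemma L2P f : L2 f <-> sqint (re f) /\ sqint (im f).
Proof.
split=> [[mr mi fin]|[[mr ir] [mi ii]]]; last first.
  split => //; have /integrableP[_] := integrableD mH ir ii.
  apply: le_lt_trans; apply: eq_imp_le.
  apply: eq_integral => x _; rewrite [RHS](_ : _ = `|re f x ^+ 2 + im f x ^+ 2|%:E)//.
  by rewrite ger0_norm// addr_ge0 ?sqr_ge0.
have i2 : mu.-integrable HL (EFin \o (fun x => re f x ^+ 2 + im f x ^+ 2)).
  apply/integrableP; split.
    by apply/measurable_EFinP; apply: measurable_funD; exact: measurable_funX.
  apply: le_lt_trans fin; apply: eq_imp_le.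
  apply: eq_integral => x _ /=; rewrite ger0_norm//.
  by rewrite addr_ge0 ?sqr_ge0.
split; split => //; apply: (le_integrable_real mH _ _ i2).
- exact: measurable_funX.
- by move=> x _; rewrite ger0_norm ?sqr_ge0// lerDl sqr_ge0.
- exact: measurable_funX.
- by move=> x _; rewrite ger0_norm ?sqr_ge0// lerDr sqr_ge0.
Qed.

Lemma sq_normE f : L2 f -> sq_norm f = (ip (re f) (re f) + ip (im f) (im f))%:E.
Proof.
move=> /L2P[sr si].
have ir := sqint_mul mH sr sr; have ii := sqint_mul mH si si.
rewrite /ip -RintegralD//; last exact: mH.
have i2 := integrableD mH ir ii.
rewrite /Rintegral fineK; last first.
  by apply: integrable_fin_num => //; exact: mH.
by apply: eq_integral => x _; rewrite -!expr2.
Qed.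

Lemma L2_sub f g : L2 f -> L2 g -> L2 (fun x => f x - g x).
Proof.
move=> /L2P[fr fi] /L2P[gr gi]; apply/L2P; split.
  rewrite (_ : re _ = re f - re g); first exact: (sqintB mH).
  by apply/funext => x; rewrite /re raddfB.
rewrite (_ : im _ = im f - im g); first exact: (sqintB mH).
by apply/funext => x; rewrite /im raddfB.
Qed.

Lemma cvg_L2P (u : nat -> R -> R[i]) f : (forall n, L2 (u n)) -> L2 f ->
  cvg_L2 u f <->
  cvgL2 (fun n => re (u n)) (re f) /\ cvgL2 (fun n => im (u n)) (im f).
Proof.
move=> Lu Lf.
pose A n := ip (re (u n) - re f) (re (u n) - re f).
pose B n := ip (im (u n) - im f) (im (u n) - im f).
have E : (fun n => sq_norm (fun x => u n x - f x)) = (fun n => (A n + B n)%:E).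
  apply/funext => n; rewrite (sq_normE (L2_sub (Lu n) Lf)); congr (_ + _)%:E.
    by congr ip; apply/funext => x; rewrite /re raddfB.
  by congr ip; apply/funext => x; rewrite /im raddfB.
have A0 n : 0 <= A n by exact: ip_ge0.
have B0 n : 0 <= B n by exact: ip_ge0.
rewrite /cvg_L2 E; split=> [/fine_cvgP[_ AB]|[cA cB]].
  have {}AB : (fun n => A n + B n) @ \oo --> (0 : R) by exact: AB.
  split; apply: (squeeze_cvgr _ (cvg_cst _) AB); apply: nearW => n.
    by apply/andP; split; [exact: A0|rewrite lerDl; exact: B0].
  by apply/andP; split; [exact: B0|rewrite lerDr; exact: A0].
apply/fine_cvgP; split; first exact: nearW.
rewrite -(addr0 0); exact: (cvgD cA cB).
Qed.

Lemma aeqP f g : aeq f g <-> ae_eq mu HL (re f) (re g) /\ ae_eq mu HL (im f) (im g).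
Proof.
split=> [fg|[fr fi]].
  by split; apply: filterS fg => x /[apply]; rewrite /re /im => ->.
apply: filterS2 fr fi => x Hr Hi Hx; move: (Hr Hx) (Hi Hx).
by rewrite /re /im; case: (f x) => a b; case: (g x) => c d /= -> ->.
Qed.

Lemma test_functionP f : test_function f <-> rtest (re f) /\ rtest (im f).
Proof.
split=> [[sf [a [b [a0 ab]]]]|[[sr [a [b [a0 ab]]]] [si [a' [b' [a0' ab']]]]]].
  split; (split; first by move=> n x x0; have [] := sf n x x0).
    by exists a, b; split => // x x0 H; rewrite /re ab.
  by exists a, b; split => // x x0 H; rewrite /im ab.
split; first by move=> n x x0; split; [exact: sr|exact: si].
exists (Num.min a a'), (Num.max b b'); split; first by rewrite lt_min a0.
move=> x x0 H; have r0 : re f x = 0.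
  by apply: ab => //; case: H; rewrite ?lt_min ?gt_max => /andP[? ?]; [left|right].
have i0 : im f x = 0.
  by apply: ab' => //; case: H; rewrite ?lt_min ?gt_max => /andP[? ?]; [left|right].
by move: r0 i0; rewrite /re /im; case: (f x) => c d /= -> ->.
Qed.

Lemma innerE f g : L2 f -> L2 g ->
  inner f g = (ip (re f) (re g) + ip (im f) (im g)) +i* (ip (re f) (im g) - ip (im f) (re g)).
Proof.
move=> /L2P[fr fi] /L2P[gr gi]; rewrite /inner /cintegral; congr (_ +i* _).
  rewrite /ip -RintegralD//; [|exact: mH|exact: (sqint_mul mH)|exact: (sqint_mul mH)].
  by apply: eq_Rintegral => x _; rewrite /re /im; case: (f x) => a b; case: (g x) => c d /=; ring.
rewrite /ip -RintegralB//; [|exact: mH|exact: (sqint_mul mH)|exact: (sqint_mul mH)].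
by apply: eq_Rintegral => x _; rewrite /re /im; case: (f x) => a b; case: (g x) => c d /=; ring.
Qed.

End complex_L2.

(** * The operators of the theorem on complex functions *)

Section complex_operators.
Local Open Scope complex_scope.
Implicit Types (f g h u v : R -> R[i]) (x t : R).

Lemma re_hankel_integral f : re (hankel_integral m f) = rhankel (re f).
Proof.
apply/funext => k; apply: eq_Rintegral => x _.
by rewrite /re; case: (f x) => a b /=; rewrite mul0r subr0.
Qed.

Lemma im_hankel_integral f : im (hankel_integral m f) = rhankel (im f).
Proof.
apply/funext => k; apply: eq_Rintegral => x _.
by rewrite /im; case: (f x) => a b /=; rewrite mul0r addr0.
Qed.

Lemma weak_hankel_rtest (phi : R -> R) : rtest phi -> weak_hankel phi (rhankel phi).
Proof.
move=> tphi; have [B [K [B0 HK HB]]] := rtest_bounded tphi.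
exact: (weak_hankel_rhankel (rsmooth_measurable tphi.1) B0 HK HB).
Qed.

(** The kernel is real, so the transform acts on real and imaginary parts
    separately. The closure lies in the graph of [weak_hankel] because that
    graph is closed, and exhausts it because test functions are dense and
    the transform is isometric. *)
Lemma hankelP f g : hankel m f g <->
  weak_hankel (re f) (re g) /\ weak_hankel (im f) (im g).
Proof.
split=> [[Lf Lg [u [v [uv cu cv]]]]|[wr wi]].
  have tu n : test_function (u n) by have [] := uv n.
  have Lv n : L2 (v n) by have [] := uv n.
  have Lu n : L2 (u n).
    by move/test_functionP: (tu n) => [tr ti]; apply/L2P; split; exact: rtest_sqint.
  have /(cvg_L2P Lu Lf)[cur cui] := cu; have /(cvg_L2P Lv Lg)[cvr cvi] := cv.
  move/L2P : (Lf) => [sfr sfi]; move/L2P : (Lg) => [sgr sgi].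
  split.
    apply: (weak_hankel_closed _ sfr sgr cur cvr) => n.
    move/test_functionP: (tu n) => [tr ti]; move/L2P : (Lv n) => [svr svi].
    have [_ _ /aeqP[er ei]] := uv n; rewrite re_hankel_integral in er.
    exact: (weak_hankel_ae (rtest_sqint tr) svr (ae_eq_refl _ _ _) (ae_eq_sym er)
      (weak_hankel_rtest tr)).
  apply: (weak_hankel_closed _ sfi sgi cui cvi) => n.
  move/test_functionP: (tu n) => [tr ti]; move/L2P : (Lv n) => [svr svi].
  have [_ _ /aeqP[er ei]] := uv n; rewrite im_hankel_integral in ei.
  exact: (weak_hankel_ae (rtest_sqint ti) svi (ae_eq_refl _ _ _) (ae_eq_sym ei)
    (weak_hankel_rtest ti)).
have [sfr sgr _] := wr; have [sfi sgi _] := wi.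
have Lf : L2 f by apply/L2P.
have Lg : L2 g by apply/L2P.
have iso (us : nat -> R -> R) (p q : R -> R) : (forall n, rtest (us n)) ->
    weak_hankel p q -> cvgL2 us p -> cvgL2 (fun n => rhankel (us n)) q.
  move=> tus pq; rewrite /cvgL2.
  rewrite (_ : (fun n => ip (us n - p) _) = fun n =>
    ip (rhankel (us n) - q) (rhankel (us n) - q))//.
  apply/funext => n.
  by rewrite (weak_hankel_norm (weak_hankelB (weak_hankel_rtest (tus n)) pq)).
have [ur tur cur] := rtest_dense sfr.
have [ui tui cui] := rtest_dense sfi.
pose u n x := ur n x +i* ui n x.
have tu n : test_function (u n) by apply/test_functionP; split; [exact: tur|exact: tui].
have Lu n : L2 (u n).
  by apply/L2P; split; [exact: rtest_sqint (tur n)|exact: rtest_sqint (tui n)].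
have Lv n : L2 (hankel_integral m (u n)).
  apply/L2P; rewrite re_hankel_integral im_hankel_integral.
  by have [_ ? _] := weak_hankel_rtest (tur n); have [_ ? _] := weak_hankel_rtest (tui n).
split => //; exists u, (fun n => hankel_integral m (u n)); split.
- by move=> n; split => //; apply: aeW.
- exact/(cvg_L2P Lu Lf).
- apply/(cvg_L2P Lv Lg); split.
    have -> : (fun n => re (hankel_integral m (u n))) = fun n => rhankel (ur n).
      by apply/funext => n; rewrite re_hankel_integral.
    exact: iso tur wr cur.
  have -> : (fun n => im (hankel_integral m (u n))) = fun n => rhankel (ui n).
    by apply/funext => n; rewrite im_hankel_integral.
  exact: iso tui wi cui.
Qed.

Lemma re_Ltilde f x : re (Ltilde m f) x = rL (re f) x.
Proof.
by rewrite /re /Ltilde /cderive2 /rL; case: (f x) => a b /=; rewrite mul0r subr0.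
Qed.

Lemma im_Ltilde f x : im (Ltilde m f) x = rL (im f) x.
Proof.
by rewrite /im /Ltilde /cderive2 /rL; case: (f x) => a b /=; rewrite mul0r addr0.
Qed.

Lemma LminP f g : Lmin m f g <-> rLmin (re f) (re g) /\ rLmin (im f) (im g).
Proof.
have ReE h : re (Ltilde m h) = rL (re h) by apply/funext => x; exact: re_Ltilde.
have ImE h : im (Ltilde m h) = rL (im h) by apply/funext => x; exact: im_Ltilde.
split=> [[Lf Lg [u [v [uv cu cv]]]]|[[sfr sgr [ur [tur cur cvr]]] [sfi sgi [ui [tui cui cvi]]]]].
  have tu n : test_function (u n) by have [] := uv n.
  have Lv n : L2 (v n) by have [] := uv n.
  have Lu n : L2 (u n).
    by move/test_functionP: (tu n) => [tr ti]; apply/L2P; split; exact: rtest_sqint.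
  have /(cvg_L2P Lu Lf)[cur cui] := cu; have /(cvg_L2P Lv Lg)[cvr cvi] := cv.
  move/L2P : (Lf) => [sfr sfi]; move/L2P : (Lg) => [sgr sgi].
  have ae_cvg (p q : nat -> R -> R) w : (forall n, sqint (p n)) -> (forall n, sqint (q n)) ->
      sqint w -> (forall n, ae_eq mu HL (p n) (q n)) -> cvgL2 p w -> cvgL2 q w.
    move=> sp sq sw e; rewrite /cvgL2.
    rewrite (_ : (fun n => ip (p n - w) _) = fun n => ip (q n - w) (q n - w))//.
    apply/funext => n; have s1 := sqintB mH (sp n) sw; have s2 := sqintB mH (sq n) sw.
    have e' : ae_eq mu HL (p n - w) (q n - w).
      apply: filterS (e n) => x /[apply] E.
      by rewrite [LHS](_ : _ = p n x - w x)// E.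
    by rewrite (ip_ae_l mH s1 s2 s1 e') (ip_ae_r mH s1 s2 s2 e').
  split; split => //.
    exists (fun n => re (u n)); split => //.
      by move=> n; have /test_functionP[] := tu n.
    apply: ae_cvg cvr => // n; first by have /L2P[] := Lv n.
      by have /test_functionP[tr _] := tu n; exact: rtest_sqint (rtest_rL tr).
    by have [_ _ /aeqP[er _]] := uv n; rewrite -ReE.
  exists (fun n => im (u n)); split => //.
    by move=> n; have /test_functionP[] := tu n.
  apply: ae_cvg cvi => // n; first by have /L2P[] := Lv n.
    by have /test_functionP[_ ti] := tu n; exact: rtest_sqint (rtest_rL ti).
  by have [_ _ /aeqP[_ ei]] := uv n; rewrite -ImE.
have Lf : L2 f by apply/L2P.
have Lg : L2 g by apply/L2P.
pose u n x := ur n x +i* ui n x.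
have tu n : test_function (u n) by apply/test_functionP; split; [exact: tur|exact: tui].
have Lu n : L2 (u n).
  by apply/L2P; split; [exact: rtest_sqint (tur n)|exact: rtest_sqint (tui n)].
have Lv n : L2 (Ltilde m (u n)).
  apply/L2P; rewrite ReE ImE; split.
    exact: rtest_sqint (rtest_rL (tur n)).
  exact: rtest_sqint (rtest_rL (tui n)).
split => //; exists u, (fun n => Ltilde m (u n)); split.
- by move=> n; split => //; apply: aeW.
- exact/(cvg_L2P Lu Lf).
- apply/(cvg_L2P Lv Lg); split.
    have -> : (fun n => re (Ltilde m (u n))) = fun n => rL (ur n).
      by apply/funext => n; rewrite ReE.
    exact: cvr.
  have -> : (fun n => im (Ltilde m (u n))) = fun n => rL (ui n).
    by apply/funext => n; rewrite ImE.
  exact: cvi.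
Qed.

Lemma LmaxP f g : Lmax m f g <-> [/\ L2 f, L2 g,
  forall phi, rtest phi -> ip (re f) (rL phi) = ip (re g) phi &
  forall phi, rtest phi -> ip (im f) (rL phi) = ip (im g) phi].
Proof.
split=> [[Lf Lg H]|[Lf Lg Hr Hi]].
  have key phi : rtest phi -> ip (re f) (rL phi) = ip (re g) phi /\
      ip (im f) (rL phi) = ip (im g) phi.
    move=> tphi.
    have t : test_function (fun x => (phi x)%:C).
      by apply/test_functionP; split => //; exact: rtest0.
    have zE x : 0 < x -> im (Ltilde m (fun x => (phi x)%:C)) x = 0.
      move=> x0; rewrite im_Ltilde rLE.
      have d0 : derive1 (0 : R -> R) = 0.
        by apply/funext => y; rewrite (der_derive1 (der_cst 0 y)).
      rewrite (_ : im _ = 0)// !d0 [(0 : R -> R) x](_ : _ = 0)//.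
      by rewrite oppr0 mulr0 addr0.
    have /eqP := H _ t; rewrite eq_complex => /andP[/eqP/= Er /eqP/= Ei]; split.
      transitivity (\int[mu]_(x in HL) complex.Re (f x * Ltilde m (fun x => (phi x)%:C) x)).
        apply: eq_Rintegral => x; rewrite inE half_lineE => x0.
        rewrite -(re_Ltilde (fun x => (phi x)%:C)); move: (zE x x0); rewrite /re /im.
        case: (f x) => a b; case: (Ltilde _ _ _) => c d /= ->.
        by rewrite mulr0 subr0.
      rewrite Er; apply: eq_Rintegral => x _.
      by rewrite /re; case: (g x) => a b /=; rewrite mulr0 subr0.
    transitivity (\int[mu]_(x in HL) complex.Im (f x * Ltilde m (fun x => (phi x)%:C) x)).
      apply: eq_Rintegral => x; rewrite inE half_lineE => x0.
      rewrite -(re_Ltilde (fun x => (phi x)%:C)); move: (zE x x0); rewrite /re /im.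
      case: (f x) => a b; case: (Ltilde _ _ _) => c d /= ->.
      by rewrite mulr0 add0r.
    rewrite Ei; apply: eq_Rintegral => x _.
    by rewrite /im; case: (g x) => a b /=; rewrite mulr0 add0r.
  by split => // phi tphi; have [] := key phi tphi.
split => // phi /test_functionP[tr ti].
move/L2P : Lf => [fr fi]; move/L2P : Lg => [gr gi].
have sr := rtest_sqint tr; have si := rtest_sqint ti.
have sLr := rtest_sqint (rtest_rL tr); have sLi := rtest_sqint (rtest_rL ti).
rewrite /cintegral; congr (_ +i* _).
  transitivity (ip (re f) (rL (re phi)) - ip (im f) (rL (im phi))).
    rewrite /ip -RintegralB//; [|exact: mH|exact: (sqint_mul mH)|exact: (sqint_mul mH)].
    apply: eq_Rintegral => x _; rewrite -re_Ltilde -im_Ltilde /re /im.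
    by case: (f x) => a b; case: (Ltilde _ _ _).
  rewrite Hr// Hi// /ip -RintegralB//; [|exact: mH|exact: (sqint_mul mH)|exact: (sqint_mul mH)].
  by apply: eq_Rintegral => x _; rewrite /re /im; case: (g x) => a b; case: (phi x).
transitivity (ip (re f) (rL (im phi)) + ip (im f) (rL (re phi))).
  rewrite /ip -RintegralD//; [|exact: mH|exact: (sqint_mul mH)|exact: (sqint_mul mH)].
  apply: eq_Rintegral => x _; rewrite -re_Ltilde -im_Ltilde /re /im.
  by case: (f x) => a b; case: (Ltilde _ _ _).
rewrite Hr// Hi// /ip -RintegralD//; [|exact: mH|exact: (sqint_mul mH)|exact: (sqint_mul mH)].
by apply: eq_Rintegral => x _; rewrite /re /im; case: (g x) => a b; case: (phi x).
Qed.

Lemma exp_iDP t f g : exp_iD t f g <-> [/\ L2 f, L2 g,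
  ae_eq mu HL (re g) (dilate t (re f)) & ae_eq mu HL (im g) (dilate t (im f))].
Proof.
pose d x := (expR (t / 2))%:C * f (expR t * x).
have dr : re d = dilate t (re f).
  apply/funext => x; rewrite /d /re /dilate; case: (f _) => a b /=.
  by rewrite mul0r subr0.
have di : im d = dilate t (im f).
  apply/funext => x; rewrite /d /im /dilate; case: (f _) => a b /=.
  by rewrite mul0r addr0.
rewrite -dr -di; split=> [[Lf Lg /aeqP[]]//|[Lf Lg er ei]].
by split => //; exact/aeqP.
Qed.

End complex_operators.

End cutoff_function.

(** * Unitarity, diagonalization and covariance under dilations *)

Section unitarity.
Local Open Scope complex_scope.
Implicit Types (f g h u v : R -> R[i]) (x t : R).

Variable xi : R -> R[i].
Hypothesis xi_cutoff : cutoff xi.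
Local Notation eta := (re xi).
Local Notation profile := (profile eta).
Local Notation rH := (rH eta).

Lemma rcutoff_re : rcutoff eta.
Proof.
have [sxi xi1 xi0] := xi_cutoff; split => [n x x0|x x1|x x2].
- by have [] := sxi n x x0.
- by rewrite /re xi1.
- by rewrite /re xi0.
Qed.

Let ec := rcutoff_re.

Lemma hankel_total f : L2 f -> exists g, hankel m f g.
Proof.
move=> /L2P[/(weak_hankel_total)[gr wr] /(weak_hankel_total)[gi wi]].
by exists (fun x => gr x +i* gi x); apply/(hankelP ec).
Qed.

Lemma hankel_sym f g : hankel m f g -> hankel m g f.
Proof.
by move=> /(hankelP ec)[wr wi]; apply/(hankelP ec); split; exact: weak_hankel_sym.
Qed.

Lemma hankel_unique f g h : hankel m f g -> hankel m f h -> aeq g h.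
Proof.
move=> /(hankelP ec)[gr gi] /(hankelP ec)[hr hi].
by apply/aeqP; split; [exact: weak_hankel_unique gr hr|exact: weak_hankel_unique gi hi].
Qed.

Lemma hankel_aeq f f' g g' : L2 f' -> L2 g' -> aeq f f' -> aeq g g' ->
  hankel m f g -> hankel m f' g'.
Proof.
move=> /L2P[fr fi] /L2P[gr gi] /aeqP[ffr ffi] /aeqP[ggr ggi] /(hankelP ec)[wr wi].
by apply/(hankelP ec); split; [exact: weak_hankel_ae wr|exact: weak_hankel_ae wi].
Qed.

Lemma hankel_L2 f g : hankel m f g -> L2 f /\ L2 g.
Proof. by case. Qed.

Lemma hankel_linear (a b : R[i]) f f' g g' : hankel m f g -> hankel m f' g' ->
  hankel m (fun x => a * f x + b * f' x) (fun x => a * g x + b * g' x).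
Proof.
move=> /(hankelP ec)[wr wi] /(hankelP ec)[wr' wi']; apply/(hankelP ec).
have reE p q : re (fun x => a * p x + b * q x) =
    complex.Re a *: re p + (- complex.Im a *: im p +
    (complex.Re b *: re q + (- complex.Im b *: im q + 0))).
  apply/funext => x.
  rewrite [RHS](_ : _ = complex.Re a * re p x + (- complex.Im a * im p x +
    (complex.Re b * re q x + (- complex.Im b * im q x + 0))))// /re /im.
  by case: a b (p x) (q x) => a1 a2 [b1 b2] [p1 p2] [q1 q2] /=; ring.
have imE p q : im (fun x => a * p x + b * q x) =
    complex.Re a *: im p + (complex.Im a *: re p +
    (complex.Re b *: im q + (complex.Im b *: re q + 0))).
  apply/funext => x.
  rewrite [RHS](_ : _ = complex.Re a * im p x + (complex.Im a * re p x +
    (complex.Re b * im q x + (complex.Im b * re q x + 0))))// /re /im.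
  by case: a b (p x) (q x) {reE} => a1 a2 [b1 b2] [p1 p2] [q1 q2] /=; ring.
have w0 := weak_hankel0.
rewrite !reE !imE; split.
  exact: (weak_hankel_lin _ wr (weak_hankel_lin _ wi
    (weak_hankel_lin _ wr' (weak_hankel_lin _ wi' w0)))).
exact: (weak_hankel_lin _ wi (weak_hankel_lin _ wr
    (weak_hankel_lin _ wi' (weak_hankel_lin _ wr' w0)))).
Qed.

Lemma hankel_inner f f' g g' : hankel m f g -> hankel m f' g' ->
  inner g g' = inner f f'.
Proof.
move=> fg fg'; have [Lf Lg] := hankel_L2 fg; have [Lf' Lg'] := hankel_L2 fg'.
have /(hankelP ec)[wr wi] := fg; have /(hankelP ec)[wr' wi'] := fg'.
rewrite (innerE Lg Lg') (innerE Lf Lf') (weak_hankel_ip wr wr').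
by rewrite (weak_hankel_ip wi wi') (weak_hankel_ip wr wi') (weak_hankel_ip wi wr').
Qed.

Lemma hankel_unitary : unitary_operator (hankel m).
Proof.
split.
- split.
  + exact: hankel_L2.
  + exact: hankel_aeq.
  + exact: hankel_unique.
  + exact: hankel_linear.
- exact: hankel_total.
- by move=> g /hankel_total[f gf]; exists f; exact: hankel_sym.
- exact: hankel_inner.
Qed.

Lemma hankel_involution : op_comp (hankel m) (hankel m) = op_id.
Proof.
apply/funext => f; apply/funext => h; apply/propext; split => [[g fg gh]|[Lf Lh hf]].
  have [Lf _] := hankel_L2 fg; have [_ Lh] := hankel_L2 gh.
  by split => //; exact: hankel_unique gh (hankel_sym fg).
have [g fg] := hankel_total Lf; exists g => //.
have [_ Lg] := hankel_L2 fg.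
by apply: (hankel_aeq Lg Lh _ _ (hankel_sym fg)); [exact: aeW|exact: ae_eq_sym].
Qed.

Lemma hankel_test phi : test_function phi -> hankel m phi (hankel_integral m phi).
Proof.
move=> /test_functionP[tr ti]; apply/(hankelP ec).
by rewrite re_hankel_integral im_hankel_integral; split; exact: weak_hankel_rtest.
Qed.

Lemma hankel_dilation t :
  op_comp (hankel m) (exp_iD t) = op_comp (exp_iD (- t)) (hankel m).
Proof.
apply/funext => f; apply/funext => h; apply/propext; split => [[g fg gh]|[k fk kh]].
  have /exp_iDP[Lf Lg er ei] := fg; have [_ Lh] := hankel_L2 gh.
  have [k fk] := hankel_total Lf; exists k => //.
  have [_ Lk] := hankel_L2 fk.
  have /(hankelP ec)[wr wi] := fk; have /(hankelP ec)[wr' wi'] := gh.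
  have /L2P[sgr sgi] := Lg; have /L2P[shr shi] := Lh; have /L2P[sfr sfi] := Lf.
  apply/exp_iDP; split => //.
    apply: (weak_hankel_unique _ (weak_hankel_dilate t wr)).
    exact: (weak_hankel_ae (sqint_dilate t sfr) shr er (ae_eq_refl _ _ _) wr').
  apply: (weak_hankel_unique _ (weak_hankel_dilate t wi)).
  exact: (weak_hankel_ae (sqint_dilate t sfi) shi ei (ae_eq_refl _ _ _) wi').
have /exp_iDP[Lk Lh er ei] := kh; have [Lf _] := hankel_L2 fk.
have /(hankelP ec)[wr wi] := fk.
have /L2P[shr shi] := Lh; have /L2P[sfr sfi] := Lf.
exists (fun x => dilate t (re f) x +i* dilate t (im f) x).
  apply/exp_iDP; split => //; last 2 first.
  - exact: aeW.
  - exact: aeW.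
  by apply/L2P; split; exact: sqint_dilate.
apply/(hankelP ec); split.
  exact: (weak_hankel_ae (sqint_dilate t sfr) shr (ae_eq_refl _ _ _) (ae_eq_sym er)
    (weak_hankel_dilate t wr)).
exact: (weak_hankel_ae (sqint_dilate t sfi) shi (ae_eq_refl _ _ _) (ae_eq_sym ei)
    (weak_hankel_dilate t wi)).
Qed.

(** The imaginary part of the cutoff only contributes a test function. *)
Let tau x : R := im xi x * x `^ (2^-1 + m).

Let rtest_tau : rtest tau.
Proof.
have [sxi xi1 xi0] := xi_cutoff; split.
  have simxi : rsmooth (im xi) by move=> n x x0; have [] := sxi n x x0.
  by apply: (rsmoothM simxi); apply/rsmoothP => k; exact: cdiff_powR.
exists 1, 2; split => // x x0 [x1|x2]; rewrite /tau /im.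
  by rewrite xi1 ?x0 ?ltW//= mul0r.
by rewrite xi0 ?ltW//= mul0r.
Qed.

Let rLmin_tau : rLmin tau (rL tau).
Proof.
split; [exact: rtest_sqint|exact: rtest_sqint (rtest_rL rtest_tau)|].
by exists (fun=> tau); split => //; exact: cvgL2_cst.
Qed.

(** A complex multiple of xi zeta has real and imaginary parts in the span of
    profile and of the test function tau. *)
Lemma HP f g : H xi m f g <->
  rH (re f) (re g) /\ rH (im f) (im g).
Proof.
have reE (c : R[i]) x : complex.Re (c * (xi x * zeta m x)) =
    complex.Re c * profile x - complex.Im c * tau x.
  rewrite /profile /tau /re /im /zeta.
  by case: c => c1 c2; case: (xi x) => z1 z2 /=; ring.
have imE (c : R[i]) x : complex.Im (c * (xi x * zeta m x)) =
    complex.Re c * tau x + complex.Im c * profile x.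
  rewrite /profile /tau /re /im /zeta.
  by case: c => c1 c2; case: (xi x) => z1 z2 /=; ring.
split=> [[/LmaxP[Lf Lg Hr Hi] [f0 [c [[g0 /LminP[lr li]] /aeqP[er ei]]]]]|].
  have /L2P[sfr sfi] := Lf; have /L2P[sgr sgi] := Lg.
  split; split => //.
    exists (complex.Re c), (- complex.Im c *: tau + re f0), (- complex.Im c *: rL tau + re g0).
    split; first exact: rLmin_lin.
    apply: filterS er => x /[apply] ->.
    rewrite [LHS](_ : _ = re f0 x + complex.Re (c * (xi x * zeta m x))); last first.
      by rewrite /re raddfD.
    rewrite reE [RHS](_ : _ = - complex.Im c * tau x + re f0 x + complex.Re c * profile x)//.
    by ring.
  exists (complex.Im c), (complex.Re c *: tau + im f0), (complex.Re c *: rL tau + im g0).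
  split; first exact: rLmin_lin.
  apply: filterS ei => x /[apply] ->.
  rewrite [LHS](_ : _ = im f0 x + complex.Im (c * (xi x * zeta m x))); last first.
    by rewrite /im raddfD.
  rewrite imE [RHS](_ : _ = complex.Re c * tau x + im f0 x + complex.Im c * profile x)//.
  by ring.
move=> [[sfr sgr Hr [cr [fr [gr [lr er]]]]] [sfi sgi Hi [ci [fi [gi [li ei]]]]]].
split; first by apply/LmaxP; split => //; apply/L2P.
pose c := cr +i* ci.
exists (fun x => (ci * tau x + fr x) +i* (- cr * tau x + fi x)), c; split.
  exists (fun x => (ci * rL tau x + gr x) +i* (- cr * rL tau x + gi x)).
  by apply/LminP; split; exact: rLmin_lin.
apply/aeqP; split.
  apply: filterS er => x /[apply] ->.
  rewrite [RHS](_ : _ = ci * tau x + fr x + complex.Re (c * (xi x * zeta m x))); last first.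
    by rewrite /re raddfD.
  by rewrite reE [LHS](_ : _ = fr x + cr * profile x)//=; ring.
apply: filterS ei => x /[apply] ->.
rewrite [RHS](_ : _ = - cr * tau x + fi x + complex.Im (c * (xi x * zeta m x))); last first.
  by rewrite /im raddfD.
by rewrite imE [LHS](_ : _ = fi x + ci * profile x)//=; ring.
Qed.

Lemma QQP f h : op_comp Q Q f h <-> [/\ L2 f, L2 h,
  ae_eq mu HL (re h) (fun x => x ^+ 2 * re f x) &
  ae_eq mu HL (im h) (fun x => x ^+ 2 * im f x)].
Proof.
have reE p x : re (fun x => x%:C * p x) x = x * re p x.
  by rewrite /re; case: (p x) => a b /=; rewrite mul0r subr0.
have imE p x : im (fun x => x%:C * p x) x = x * im p x.
  by rewrite /im; case: (p x) => a b /=; rewrite mul0r addr0.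
split=> [[g [Lf Lg /aeqP[gr gi]] [_ Lh /aeqP[hr hi]]]|[Lf Lh hr hi]].
  split => //.
    by apply: filterS2 gr hr => x Eg Eh x0; rewrite Eh// reE Eg// reE expr2 mulrA.
  by apply: filterS2 gi hi => x Eg Eh x0; rewrite Eh// imE Eg// imE expr2 mulrA.
(* |x p|^2 = p (x^2 p) is integrable as a product. *)
have sq (p q : R -> R) : sqint p -> sqint q -> ae_eq mu HL q (fun x => x ^+ 2 * p x) ->
    sqint (fun x => x * p x).
  move=> sp sq e; have s2 := ae_sqr_sqint sp sq e.
  split; first by apply: measurable_funM => //; exact: sqint_meas sp.
  apply: eq_integrable_half_line (sqint_mul mH sp s2) => x _.
  by rewrite exprMn (expr2 (p x)) mulrCA.
have /L2P[sfr sfi] := Lf; have /L2P[shr shi] := Lh.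
pose g x := x%:C * f x.
have rg : re g = fun x => x * re f x by apply/funext => x; exact: reE.
have ig : im g = fun x => x * im f x by apply/funext => x; exact: imE.
have Lg : L2 g.
  by apply/L2P; rewrite rg ig; split; [exact: sq hr|exact: sq hi].
exists g; split => //; first exact: aeW.
apply/aeqP; split.
  by apply: filterS hr => x /[apply] ->; rewrite reE rg expr2 mulrA.
by apply: filterS hi => x /[apply] ->; rewrite imE ig expr2 mulrA.
Qed.

Lemma hankel_diagonalizes :
  op_comp (hankel m) (op_comp (H xi m) (op_inv (hankel m))) = op_comp Q Q.
Proof.
have conj (u v f h : R -> R) : weak_hankel u f -> weak_hankel v h ->
    rH u v <-> ae_eq mu HL h (fun x => x ^+ 2 * f x).
  move=> uf vh; split=> [/(rH_diag ec)[u' [v' [uu' vv' e]]]|e]; last first.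
    by apply/(rH_diag ec); exists f, h.
  have eu := weak_hankel_unique uu' uf; have ev := weak_hankel_unique vv' vh.
  apply: filterS3 eu ev e => x Eu Ev E x0.
  by rewrite -Ev// E// Eu.
apply/funext => f; apply/funext => h; apply/propext; split.
  move=> [v [u uf /HP[Hr Hi]] vh]; apply/QQP.
  have [_ Lf] := hankel_L2 uf; have [_ Lh] := hankel_L2 vh.
  have /(hankelP ec)[ur ui] := uf; have /(hankelP ec)[vr vi] := vh.
  by split => //; [exact/(conj _ _ _ _ ur vr)|exact/(conj _ _ _ _ ui vi)].
move=> /QQP[Lf Lh er ei].
have [u fu] := hankel_total Lf; have [v hv] := hankel_total Lh.
have uf := hankel_sym fu; have vh := hankel_sym hv.
have /(hankelP ec)[ur ui] := uf; have /(hankelP ec)[vr vi] := vh.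
exists v => //; exists u => //; apply/HP.
by split; [exact/(conj _ _ _ _ ur vr)|exact/(conj _ _ _ _ ui vi)].
Qed.

End unitarity.

End order.
End half_line_L2.

Theorem theorem5p2 (R : realType) (m : R) (hm : -1 < m)
    (xi : R -> R[i]) (hxi : cutoff xi) :
  [/\ (forall phi : R -> R[i], test_function phi ->
         hankel m phi (hankel_integral m phi)),
      unitary_operator (hankel m),
      op_comp (hankel m) (hankel m) = op_id,
      op_comp (hankel m) (op_comp (H xi m) (op_inv (hankel m))) = op_comp Q Q &
      forall t : R,
        op_comp (hankel m) (exp_iD t) = op_comp (exp_iD (- t)) (hankel m)].
Proof.
split.
- by move=> phi; exact: (hankel_test hm hxi).
- exact: (hankel_unitary hm hxi).
- exact: (hankel_involution hm hxi).
- exact: (hankel_diagonalizes hm hxi).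
- by move=> t; exact: (hankel_dilation hm hxi t).
Qed.
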